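(* Let $T>0$, $I=(0,T)$, $\bar I=[0,T]$, and let $\lambda\in C^1(\bar I,D^{-1/2,q}(\Gamma))$. Let $(E_0,H_0)$ and $(F,G)$ (and $\lambda$) satisfy - $(E_0,H_0)\in D^q(\Omega)\times\Delta^{q+1}(\Omega)$, - $(F,G)\in C^0(\bar I,\mathbb{H})\cap L^2(I,D^q(\Omega)\times\Delta^{q+1}(\Omega))$, - $d\check\tau_t\lambda(t)\in\mu\Delta^{q+1}(\Omega)$ for all $t\in\bar I$, - $\tau_tF(t)=\partial_t\lambda(t)$ for almost all $t\in I$, - $\tau_tE_0=\lambda(0)$. Then the Cauchy problem $$\partial_tE-\varepsilon^{-1}\delta H=F,\quad \partial_tH-\mu^{-1}dE=G\ \text{ in } I\times\Omega,\qquad \tau_tE=\lambda\ \text{ in } I\times\Gamma,\qquad (E,H)(0)=(E_0,H_0)\ \text{ in }\Omega$$ is uniquely solved in $$C^1(\bar I,\mathbb{H})\cap C^0\big(\bar I,D^q(\Omega)\times\Delta^{q+1}(\Omega)\big)$$ by $$(E,H)(t)=(\check\tau_t\lambda,0)(t)+\exp(-\mathrm{i}t\mathcal{M})\big(E_0-\check\tau_t\lambda(0),H_0\big)+\int_0^t\exp\big(-\mathrm{i}(t-s)\mathcal{M}\big)\big(F-\partial_s\check\tau_t\lambda,\;G+\mu^{-1}d\check\tau_t\lambda\big)(s)\,ds,\qquad t\in\bar I.$$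
   Context: **Domain and forms.** $\Omega\subset\mathbb{R}^N$ is an exterior domain (complement of a compact set) with Lipschitz boundary $\Gamma=\partial\Omega$, and $q$ is a form degree, $0\le q\le N$ (spaces of forms of degree $>N$ are $\{0\}$). $L^{2,q}(\Omega)$ is the complex Hilbert space of square integrable $q$-forms with $\langle E,H\rangle_{L^{2,q}(\Omega)}=\int_\Omega E\wedge *\bar H$, where $*$ is the Euclidean Hodge star. $d$ is the exterior derivative and $\delta=(-1)^{(q-1)N}*d*$ on $q$-forms is the co-derivative, so that $\langle dE,H\rangle_{L^{2,q+1}(\Omega)}=-\langle E,\delta H\rangle_{L^{2,q}(\Omega)}$ for smooth compactly supported forms; both are understood in the weak sense. Set $D^q(\Omega)=\{E\in L^{2,q}(\Omega): dE\in L^{2,q+1}(\Omega)\}$ and $\Delta^{q}(\Omega)=\{H\in L^{2,q}(\Omega):\delta H\in L^{2,q-1}(\Omega)\}$, with graph norms. $\mathring D^q(\Omega)$ is the closure in $D^q(\Omega)$ of the smooth $q$-forms with compact support in $\Omega$. **Coefficients.** $\varepsilon$ and $\mu$ are real, linear, symmetric, bounded and uniformly positive definite, time-independent transformations on $q$-forms and $(q+1)$-forms respectively (acting pointwise, with $L^\infty(\Omega)$ matrix entries). $\mathbb{H}$ is $L^{2,q}(\Omega)\times L^{2,q+1}(\Omega)$ with scalar product $\langle (E,H),(\Phi,\Psi)\rangle_{\mathbb{H}}=\langle\varepsilon E,\Phi\rangle_{L^{2,q}(\Omega)}+\langle\mu H,\Psi\rangle_{L^{2,q+1}(\Omega)}$.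 The operator $\mathcal{M}(E,H)=\mathrm{i}(\varepsilon^{-1}\delta H,\mu^{-1}dE)$ with domain $D(\mathcal{M})=\mathring D^q(\Omega)\times\Delta^{q+1}(\Omega)$ is selfadjoint in $\mathbb{H}$, and $\exp(-\mathrm{i}t\mathcal{M})$ is defined by spectral calculus. **Traces.** $D^{-1/2,q}(\Gamma)$ is the Hilbert space of tangential traces of forms in $D^q(\Omega)$. The tangential trace $\tau_t:D^q(\Omega)\to D^{-1/2,q}(\Gamma)$ is linear, continuous and surjective with kernel $\mathring D^q(\Omega)$ (so $D^{-1/2,q}(\Gamma)$ is isomorphic to $D^q(\Omega)/\mathring D^q(\Omega)$), generalizes the pullback $\iota^*E$ under $\iota:\Gamma\hookrightarrow\overline\Omega$, and has a (fixed) linear continuous right inverse $\check\tau_t:D^{-1/2,q}(\Gamma)\to D^q(\Omega)\cap\varepsilon^{-1}\Delta^q(\Omega)$ whose values are supported in one fixed compact set. $\tau_t$ and $\check\tau_t$ act on time-dependent forms pointwise in time. *)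

(* Defs.v *)
From HB Require Import structures.
From mathcomp Require Import all_boot all_order all_algebra ring_quotient.
From mathcomp Require Import complex.
From mathcomp Require Import all_classical all_reals all_analysis.

Set Implicit Arguments.
Unset Strict Implicit.
Unset Printing Implicit Defensive.
Import Order.TTheory GRing.Theory Num.Theory.
Import numFieldNormedType.Exports.
Local Open Scope classical_set_scope.
Local Open Scope ring_scope.
Local Open Scope complex_scope.
Local Open Scope quotient_scope.

Section LebesgueMeasure.
Context {R : realType} {N : nat}.

Definition box (a b : 'rV[R]_N) : set 'rV[R]_N :=
  [set x | forall i, a 0 i <= x 0 i < b 0 i].

(* The volume of half-open boxes; sets that are not boxes have volume +oo, so
   that they are useless in the coverings defining the outer measure. *)
Definition box_volume (A : set 'rV[R]_N) : \bar R :=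
  if `[< A = set0 >] then 0%E
  else ereal_inf [set (\prod_i (p.2 0 i - p.1 0 i))%:E |
                  p in [set p : 'rV[R]_N * 'rV[R]_N | A = box p.1 p.2]].

(* R^N with all its subsets, so that [mu_ext] ranges over all countable
   coverings. *)
Definition all_subsets : Type := 'rV[R]_N.
HB.instance Definition _ := Pointed.on all_subsets.
HB.instance Definition _ := @isMeasurable.Build default_measure_display
  all_subsets setT I (fun _ _ => I) (fun _ _ => I).

Definition lebesgue_outer : set 'rV[R]_N -> \bar R :=
  mu_ext (box_volume : set all_subsets -> \bar R).

Lemma box_volume0 : box_volume set0 = 0%E.
Proof. by rewrite /box_volume asboolT. Qed.

Lemma box_volume_ge0 A : (0 <= box_volume A)%E.
Proof.
rewrite /box_volume; case: asboolP => // A0.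
apply: le_ereal_inf_tmp => _ [p /= Ap <-]; rewrite lee_fin prodr_ge0// => i _.
have [x] : A !=set0 by apply/set0P/eqP.
by rewrite Ap => /(_ i) /andP[/le_lt_trans h /h]; rewrite subr_ge0 => /ltW.
Qed.

HB.instance Definition _ := isOuterMeasure.Build R 'rV[R]_N lebesgue_outer
  (@mu_ext0 _ all_subsets R box_volume box_volume0 box_volume_ge0)
  (@mu_ext_ge0 _ all_subsets R box_volume box_volume_ge0)
  (@le_mu_ext _ all_subsets R box_volume)
  (@mu_ext_sigma_subadditive _ all_subsets R box_volume box_volume_ge0).

End LebesgueMeasure.

(* The Caratheodory-measurable sets are the Lebesgue measurable ones. *)
Notation Rn R N :=
  (caratheodory_type ([the {outer_measure set 'rV[R]_N -> \bar R} of lebesgue_outer])).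

HB.lock Definition lebesgueN {R : realType} {N : nat} :
  {measure set (Rn R N) -> \bar R} :=
  [the measure _ _ of ([the {outer_measure set 'rV[R]_N -> \bar R} of lebesgue_outer] : set (Rn R N) -> \bar R)].
Canonical lebesgueN_unlockable := Unlockable lebesgueN.unlock.

Section Forms.
Context {R : realType} {N : nat}.

(* Differential forms of arbitrary, possibly mixed, degree on R^N: [w x A] is
   the coefficient of dx^A at x, where dx^A = dx^{i_1} /\ ... /\ dx^{i_p} for
   A = {i_1 < ... < i_p}. The form is of degree q when only the [A] with q
   elements contribute; in degrees > N this leaves only 0. *)
Definition form := 'rV[R]_N -> {set 'I_N} -> R[i]^o.

Definition of_degree (q : nat) (w : form) : Prop :=
  forall x (A : {set 'I_N}), #|A| != q -> w x A = 0.

(* The forms on Omega are extended by 0 to R^N. *)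
Definition l2_pred (Omega : set 'rV[R]_N) (q : nat) : {pred form} :=
  mem [set w : form | [/\ of_degree q w,
    forall x, ~ Omega x -> forall A, w x A = 0,
    forall A, (fun x : Rn R N => complex.Re (w x A)) \in Lfun lebesgueN 2%:E &
    forall A, (fun x : Rn R N => complex.Im (w x A)) \in Lfun lebesgueN 2%:E]].

Section L2.
Variables (Omega : set 'rV[R]_N) (q : nat).

Let le12 : (1 <= 2%:E :> \bar R)%E. Proof. by rewrite lee_fin ler1n. Qed.

Lemma Lfun2_comb (a b : R) (f g h : Rn R N -> R) :
  f \in Lfun lebesgueN 2%:E -> g \in Lfun lebesgueN 2%:E ->
  h \in Lfun lebesgueN 2%:E ->
  (fun x => a * f x + (b * g x + h x)) \in Lfun lebesgueN 2%:E.
Proof.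
have [_ LD] := Lfun_submod_closed (@lebesgueN R N) le12.
by move=> Lf Lg Lh; have := LD a _ _ Lf (LD b _ _ Lg Lh).
Qed.

Lemma l2_submod_closed : submod_closed (l2_pred Omega q).
Proof.
split=> [|a u v /set_mem[du ou ru iu] /set_mem[dv ov rv iv]].
  have [L0 _] := Lfun_submod_closed (@lebesgueN R N) le12.
  by rewrite inE; split=> // A; exact: L0.
rewrite inE; split.
- by move=> x A qA; rewrite !fctE du // dv // scaler0 addr0.
- by move=> x Ox A; rewrite !fctE ou // ov // scaler0 addr0.
- move=> A; have -> : (fun x : Rn R N => complex.Re ((a *: u + v) x A)) =
    (fun x => complex.Re a * complex.Re (u x A) +
      (- complex.Im a * complex.Im (u x A) + complex.Re (v x A))).
    apply/funext => x; rewrite !fctE.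
    by case: a (u x A) (v x A) => [a1 a2] [u1 u2] [v1 v2] /=; rewrite addrA mulNr.
  exact: Lfun2_comb.
- move=> A; have -> : (fun x : Rn R N => complex.Im ((a *: u + v) x A)) =
    (fun x => complex.Re a * complex.Im (u x A) +
      (complex.Im a * complex.Re (u x A) + complex.Im (v x A))).
    apply/funext => x; rewrite !fctE.
    by case: a (u x A) (v x A) => [a1 a2] [u1 u2] [v1 v2] /=; rewrite addrA.
  exact: Lfun2_comb.
Qed.

HB.instance Definition _ := GRing.isSubmodClosed.Build R[i] form
  (l2_pred Omega q) l2_submod_closed.

Record l2_form := L2Form { l2_val : form; _ : l2_val \in l2_pred Omega q }.
HB.instance Definition _ := [isSub for l2_val].
HB.instance Definition _ := [Choice of l2_form by <:].
HB.instance Definition _ := [SubChoice_isSubLmodule of l2_form by <:].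

Definition l2_null : {pred l2_form} :=
  mem [set w : l2_form | {ae lebesgueN, forall x : Rn R N, forall A, l2_val w x A = 0}].

Lemma l2_null_submod_closed : submod_closed l2_null.
Proof.
split=> [|a u v /set_mem /= u0 /set_mem /= v0]; rewrite inE /=.
  exact: filterE.
by move: u0 v0; apply: filterS2 => x ux vx A; rewrite !fctE ux vx scaler0 addr0.
Qed.

HB.instance Definition _ := GRing.isSubmodClosed.Build R[i] l2_form
  l2_null l2_null_submod_closed.

(* The space L^{2,q}(Omega), forms being identified when they agree almost
   everywhere. *)
Definition L2 : Type := Quotient.quot l2_null.
HB.instance Definition _ := GRing.Zmodule.on L2.
HB.instance Definition _ := EqQuotient.on L2.

Definition L2_scale (a : R[i]) (u : L2) : L2 := \pi_L2 (a *: repr u).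

Lemma L2_scale_pi a (w : l2_form) : L2_scale a (\pi_L2 w) = \pi_L2 (a *: w).
Proof.
apply/eqP; rewrite -[L2]/(Quotient.quot l2_null) -Quotient.idealrBE -scalerBr.
by rewrite rpredZ // Quotient.idealrBE reprK.
Qed.

Lemma L2_piD (v w : l2_form) : \pi_L2 (v + w) = \pi_L2 v + \pi_L2 w.
Proof. exact: Quotient.pi_add. Qed.

Lemma L2_scaleA a b u : L2_scale a (L2_scale b u) = L2_scale (a * b) u.
Proof. by rewrite [L2_scale b u]/L2_scale L2_scale_pi scalerA. Qed.

Lemma L2_scale1 : left_id 1 L2_scale.
Proof. by move=> u; rewrite /L2_scale scale1r reprK. Qed.

Lemma L2_scaleDr : right_distributive L2_scale +%R.
Proof.
move=> a u v; rewrite -{1}[u]reprK -{1}[v]reprK -L2_piD L2_scale_pi.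
by rewrite scalerDr L2_piD.
Qed.

Lemma L2_scaleDl u : {morph L2_scale^~ u : a b / a + b}.
Proof. by move=> a b; rewrite /L2_scale scalerDl L2_piD. Qed.

HB.instance Definition _ := GRing.Zmodule_isLmodule.Build R[i] L2
  L2_scaleA L2_scale1 L2_scaleDr L2_scaleDl.

(* The class of the form [w], or 0 if [w] is not a square integrable q-form. *)
Definition L2_class (w : form) : L2 := \pi_L2 (insubd (0 : l2_form) w).

End L2.
End Forms.
Arguments form : clear implicits.

Section WeakDerivatives.
Context {R : realType} {N : nat}.

Definition complex_integral d (T : measurableType d) (m : set T -> \bar R)
    (D : set T) (f : T -> R[i]) : R[i] :=
  fine (\int[m]_(x in D) (complex.Re (f x))%:E)
  +i* fine (\int[m]_(x in D) (complex.Im (f x))%:E).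

(* For v, w of the same degree, v /\ * conj(w) has coefficient
   \sum_A v_A conj(w_A) with respect to the volume form. *)
Definition form_pairing (Omega : set 'rV[R]_N) (v w : form R N) : R[i] :=
  complex_integral lebesgueN (Omega : set (Rn R N))
    (fun x => \sum_A v x A * (w x A)^*).

Definition L2_rep {Omega : set 'rV[R]_N} {q} (u : L2 Omega q) : form R N :=
  l2_val (repr u).

Definition L2_ip {Omega : set 'rV[R]_N} {q} (u v : L2 Omega q) : R[i] :=
  form_pairing Omega (L2_rep u) (L2_rep v).

Fixpoint continuously_differentiable (k : nat) (f : 'rV[R]_N -> R) : Prop :=
  if k is k'.+1 then
    (forall i x, derivable f x (delta_mx 0 i)) /\
    forall i, continuously_differentiable k' (fun x => 'D_(delta_mx 0 i) f x)
  else continuous f.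

Definition smooth (f : 'rV[R]_N -> R) : Prop :=
  forall k, continuously_differentiable k f.

Definition test_form (Omega : set 'rV[R]_N) (q : nat) (phi : form R N) : Prop :=
  [/\ of_degree q phi,
    forall A, smooth (fun x => complex.Re (phi x A)) /\
              smooth (fun x => complex.Im (phi x A)) &
    exists K : set 'rV[R]_N, [/\ compact K, K `<=` Omega &
      forall x, ~ K x -> forall A, phi x A = 0]].

Definition partial (i : 'I_N) (f : 'rV[R]_N -> R[i]) (x : 'rV[R]_N) : R[i] :=
  'D_(delta_mx 0 i) (fun y => complex.Re (f y)) x
  +i* 'D_(delta_mx 0 i) (fun y => complex.Im (f y)) x.

(* dx^i /\ dx^(A :\ i) = (-1)^#{j in A | j < i} dx^A for i in A. *)
Definition exterior_derivative (w : form R N) : form R N := fun x A =>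
  \sum_(i in A) (-1) ^+ #|[set j in A | (j < i)%N]| *
    partial i (fun y => w y (A :\ i)) x.

(* * dx^A = s(A) dx^(~: A), where dx^A /\ dx^(~: A) = s(A) dx^1 /\ ... /\ dx^N. *)
Definition hodge (w : form R N) : form R N := fun x A =>
  (-1) ^+ #|[set p : 'I_N * 'I_N | [&& p.1 \in ~: A, p.2 \in A & (p.2 < p.1)%N]]| *
    w x (~: A).

(* On q-forms; the exponent (q + 1) N has the parity of (q - 1) N. *)
Definition coderivative (q : nat) (w : form R N) : form R N := fun x A =>
  (-1) ^+ (q.+1 * N) * hodge (exterior_derivative (hodge w)) x A.

Section Spaces.
Variable Omega : set 'rV[R]_N.

Definition weak_d q (E : L2 Omega q) (F : L2 Omega q.+1) : Prop :=
  forall phi, test_form Omega q.+1 phi ->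
    form_pairing Omega (L2_rep F) phi =
    - form_pairing Omega (L2_rep E) (coderivative q.+1 phi).

(* In degree 0 this makes the coderivative 0, as [exterior_derivative phi] is
   of degree 1 for all test forms [phi]. *)
Definition weak_delta q (H : L2 Omega q) (K : L2 Omega q.-1) : Prop :=
  forall phi, test_form Omega q.-1 phi ->
    form_pairing Omega (L2_rep K) phi =
    - form_pairing Omega (L2_rep H) (exterior_derivative phi).

Definition Dspace q : set (L2 Omega q) := [set E | exists F, weak_d E F].
Definition Deltaspace q : set (L2 Omega q) := [set H | exists K, weak_delta H K].

Definition extd q (E : L2 Omega q) : L2 Omega q.+1 := xget 0 (weak_d E).
Definition codiff q (H : L2 Omega q) : L2 Omega q.-1 := xget 0 (weak_delta H).

Definition L2_norm q (u : L2 Omega q) : R := Num.sqrt (complex.Re (L2_ip u u)).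

Definition Dspace_norm q (E : L2 Omega q) : R :=
  Num.sqrt (L2_norm E ^+ 2 + L2_norm (extd E) ^+ 2).
Definition Deltaspace_norm q (H : L2 Omega q) : R :=
  Num.sqrt (L2_norm H ^+ 2 + L2_norm (codiff H) ^+ 2).

Definition D0space q : set (L2 Omega q) := [set E | Dspace E /\
  forall e : R, 0 < e -> exists2 phi, test_form Omega q phi &
    Dspace_norm (E - L2_class Omega q phi) < e].

End Spaces.
End WeakDerivatives.

Section Geometry.
Context {R : realType} {N : nat}.

Definition exterior_domain (Omega : set 'rV[R]_N) : Prop :=
  open Omega /\ compact (~` Omega).

Definition dot (u v : 'rV[R]_N) : R := \sum_i u 0 i * v 0 i.

(* Near each boundary point, Omega is the set of the points strictly above the
   graph of a Lipschitz function over a hyperplane with unit normal [e]. *)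
Definition lipschitz_boundary (Omega : set 'rV[R]_N) : Prop :=
  forall x, (closure Omega `\` interior Omega) x ->
  exists (e : 'rV[R]_N) (g : 'rV[R]_N -> R) (k : R),
    [/\ dot e e = 1, k.-lipschitz g &
    \forall y \near x, Omega y <-> g (y - dot y e *: e) < dot y e].

Definition coefficient := 'rV[R]_N -> {set 'I_N} -> {set 'I_N} -> R.

(* Real symmetric bounded uniformly positive definite transformations of
   q-forms; only the entries indexed by sets with q elements matter. *)
Definition admissible (Omega : set 'rV[R]_N) (q : nat) (a : coefficient) : Prop :=
  [/\ forall A B : {set 'I_N}, #|A| = q -> #|B| = q ->
        measurable_fun (Omega : set (Rn R N)) (fun x : Rn R N => a x A B),
    exists c : R, {ae lebesgueN, forall x : Rn R N, Omega x ->
      forall A B : {set 'I_N}, #|A| = q -> #|B| = q -> `|a x A B| <= c},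
    {ae lebesgueN, forall x : Rn R N, Omega x ->
      forall A B : {set 'I_N}, #|A| = q -> #|B| = q -> a x A B = a x B A} &
    exists2 c : R, 0 < c & {ae lebesgueN, forall x : Rn R N, Omega x ->
      forall xi : {set 'I_N} -> R,
        c * \sum_(A : {set 'I_N} | #|A| == q) xi A ^+ 2 <=
        \sum_(A : {set 'I_N} | #|A| == q) \sum_(B : {set 'I_N} | #|B| == q)
          a x A B * xi A * xi B}].

Definition coeff_form (q : nat) (a : coefficient) (w : form R N) : form R N := fun x A =>
  if #|A| == q then
    \sum_(B : {set 'I_N} | #|B| == q) (a x A B)%:C * w x B
  else 0.

Definition coeff_op {Omega : set 'rV[R]_N} {q} (a : coefficient)
  (u : L2 Omega q) : L2 Omega q := L2_class Omega q (coeff_form q a (L2_rep u)).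

Definition coeff_inv {Omega : set 'rV[R]_N} {q} (a : coefficient)
  (u : L2 Omega q) : L2 Omega q := xget 0 [set v | coeff_op a v = u].

End Geometry.
Arguments coefficient : clear implicits.

(* [nrm] is the norm of the space [dom], a subspace of [X]; functions of time
   are only meant on [0, T]. *)
Section Time.
Context {R : realType} {X : lmodType R[i]}.
Implicit Types (dom : set X) (nrm : X -> R) (u f : R -> X).

Definition is_C0 dom nrm (T : R) u : Prop := forall t, t \in `[0, T] ->
  dom (u t) /\
  (fun s => nrm (u s - u t)) @ within `[0, T]%classic (nbhs t) --> (0 : R).

Definition is_tderiv nrm (T : R) u (t : R) (v : X) : Prop :=
  (fun s => nrm ((s - t)^-1%:C *: (u s - u t) - v))
    @ within (`[0, T]%classic `\ t) (nbhs t) --> (0 : R).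

Definition tderiv nrm (T : R) u (t : R) : X := xget 0 (is_tderiv nrm T u t).

Definition is_C1 nrm (T : R) u : Prop :=
  (forall t, t \in `[0, T] -> exists v, is_tderiv nrm T u t v) /\
  is_C0 setT nrm T (tderiv nrm T u).

Record simple_function := SimpleFunction {
  simple_size : nat;
  simple_set : 'I_simple_size -> set R;
  simple_value : 'I_simple_size -> X }.

Definition simple_in dom (s : simple_function) : Prop := forall i,
  [/\ measurable (simple_set i), (lebesgue_measure (@simple_set s i) < +oo)%E &
      dom (simple_value i)].

Definition simple_fun (s : simple_function) (t : R) : X :=
  \sum_i (\1_(@simple_set s i) t)%:C *: simple_value i.

Definition simple_integral (I : set R) (s : simple_function) : X :=
  \sum_i (fine (lebesgue_measure (@simple_set s i `&` I)))%:C *: simple_value i.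

Definition strongly_measurable dom nrm (I : set R) f : Prop :=
  {ae lebesgue_measure, forall t, I t -> dom (f t)} /\
  exists s : nat -> simple_function, (forall n, simple_in dom (s n)) /\
    {ae lebesgue_measure, forall t, I t ->
      (fun n => nrm (f t - simple_fun (s n) t)) @ \oo --> (0 : R)}.

Definition is_L2 dom nrm (I : set R) f : Prop :=
  strongly_measurable dom nrm I f /\
  (\int[lebesgue_measure]_(t in I) (nrm (f t) ^+ 2)%:E < +oo)%E.

Definition is_bochner_integral nrm (I : set R) f (y : X) : Prop :=
  strongly_measurable setT nrm I f /\
  exists s : nat -> simple_function, [/\ forall n, simple_in setT (s n),
    (fun n => (\int[lebesgue_measure]_(t in I)
                 (nrm (f t - simple_fun (s n) t))%:E)%E) @ \oo --> 0%E &
    (fun n => nrm (simple_integral I (s n) - y)) @ \oo --> (0 : R)].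

Definition bochner_integral nrm (I : set R) f : X :=
  xget 0 (is_bochner_integral nrm I f).

End Time.

Section Hilbert.
Context {R : realType} {X : lmodType R[i]}.
Variable ip : X -> X -> R[i].

Definition ip_norm (x : X) : R := Num.sqrt (complex.Re (ip x x)).

Record hilbert_space : Prop := HilbertSpace {
  ip_linear : forall a x y z, ip (a *: x + y) z = a * ip x z + ip y z;
  ip_conj : forall x y, ip y x = (ip x y)^*;
  ip_ge0 : forall x, 0 <= ip x x;
  ip_eq0 : forall x, ip x x = 0 -> x = 0;
  ip_complete : forall u : nat -> X,
    (forall e : R, 0 < e -> exists n, forall k l, (n <= k)%N -> (n <= l)%N ->
       ip_norm (u k - u l) < e) ->
    exists x, (fun n => ip_norm (u n - x)) @ \oo --> (0 : R) }.

(* Orthogonal-projection valued measures on the Borel sets of R. *)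
Record projection_measure (P : set R -> X -> X) : Prop := ProjectionMeasure {
  pm_linear : forall B, measurable B -> linear (P B);
  pm_idem : forall B x, measurable B -> P B (P B x) = P B x;
  pm_sym : forall B x y, measurable B -> ip (P B x) y = ip x (P B y);
  pm_setT : forall x, P setT x = x;
  pm_sigma_additive : forall B : nat -> set R, (forall n, measurable (B n)) ->
    trivIset setT B -> forall x,
    (fun n => ip_norm (\sum_(k < n) P (B k) x - P (\bigcup_k B k) x))
      @ \oo --> (0 : R) }.

Variable P : set R -> X -> X.

(* B |-> <P(B) x, x> = |P(B) x|^2 *)
Definition spectral_measure (x : X) (B : set R) : \bar R :=
  (ip_norm (P B x) ^+ 2)%:E.

(* The integral of f with respect to the complex measure B |-> <P(B) x, y>,
   obtained by polarization. *)
Definition spectral_integral (f : R -> R[i]) (x y : X) : R[i] :=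
  4^-1 * \sum_(k < 4) (0 +i* 1) ^+ k *
    complex_integral (spectral_measure (x + (0 +i* 1) ^+ k *: y)) setT f.

(* A = \int l dP(l), as an operator with domain [dom]. *)
Definition spectral_resolution (dom : set X) (A : X -> X) : Prop :=
  [/\ projection_measure P,
    forall x, dom x <->
      (\int[spectral_measure x]_l (l ^+ 2)%:E < +oo)%E &
    forall x y, dom x -> dom y ->
      ip (A x) y = spectral_integral (fun l => l%:C) x y].

(* f(A) = \int f(l) dP(l), for bounded f *)
Definition spectral_calculus (f : R -> R[i]) (x : X) : X :=
  xget 0 [set z | forall y, ip z y = spectral_integral f x y].

(* exp(-i t A) *)
Definition exp_group (t : R) : X -> X :=
  spectral_calculus (fun l => cos (t * l) -i* sin (t * l)).

End Hilbert.

Section Maxwell.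
Context {R : realType} {N : nat}.
Variables (Omega : set 'rV[R]_N) (q : nat).
Variables (eps mu : coefficient R N).

Definition Hspace : lmodType R[i] := (L2 Omega q * L2 Omega q.+1)%type.

Definition Hspace_ip (u v : Hspace) : R[i] :=
  L2_ip (coeff_op eps u.1) v.1 + L2_ip (coeff_op mu u.2) v.2.

Definition Hspace_norm : Hspace -> R := ip_norm Hspace_ip.

Definition graph_dom : set Hspace := [set u | Dspace u.1 /\ Deltaspace u.2].

Definition graph_norm (u : Hspace) : R :=
  Num.sqrt (Dspace_norm u.1 ^+ 2 + Deltaspace_norm u.2 ^+ 2).

Definition maxwell_dom : set Hspace := [set u | D0space u.1 /\ Deltaspace u.2].

Definition maxwell (u : Hspace) : Hspace :=
  (0 +i* 1) *: (coeff_inv eps (codiff u.2), coeff_inv mu (extd u.1)).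

Section Trace.
Variables (V : lmodType R[i]) (ipV : V -> V -> R[i]).

Record tangential_trace (tau : L2 Omega q -> V) : Prop := TangentialTrace {
  trace_linear : forall a E E', Dspace E -> Dspace E' ->
    tau (a *: E + E') = a *: tau E + tau E';
  trace_bounded : exists c : R, forall E, Dspace E ->
    ip_norm ipV (tau E) <= c * Dspace_norm E;
  trace_surjective : forall v, exists2 E, Dspace E & tau E = v;
  trace_kernel : forall E, Dspace E -> (tau E = 0 <-> D0space E) }.

Record trace_extension (tau : L2 Omega q -> V) (ext : {linear V -> L2 Omega q}) :
    Prop := TraceExtension {
  ext_dom : forall v, Dspace (ext v) /\ Deltaspace (coeff_op eps (ext v));
  ext_right_inverse : forall v, tau (ext v) = v;
  ext_bounded : exists c : R, forall v,
    Num.sqrt (Dspace_norm (ext v) ^+ 2 + Deltaspace_norm (coeff_op eps (ext v)) ^+ 2)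
    <= c * ip_norm ipV v;
  ext_support : exists2 K : set 'rV[R]_N, compact K &
    forall v, {ae lebesgueN, forall x : Rn R N, ~ K x ->
      forall A, L2_rep (ext v) x A = 0} }.

Definition maxwell_solution (tau : L2 Omega q -> V) (T : R)
    (lambda : R -> V) (E0 : L2 Omega q) (H0 : L2 Omega q.+1)
    (F : R -> L2 Omega q) (G : R -> L2 Omega q.+1) (u : R -> Hspace) : Prop :=
  let E := fun t => (u t).1 in let H := fun t => (u t).2 in
  [/\ is_C1 Hspace_norm T u,
    is_C0 graph_dom graph_norm T u,
    forall t, t \in `]0, T[ ->
      [/\ tderiv (@L2_norm R N Omega q) T E t - coeff_inv eps (codiff (H t)) = F t,
        tderiv (@L2_norm R N Omega q.+1) T H t - coeff_inv mu (extd (E t)) = G t &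
        tau (E t) = lambda t] &
    u 0 = (E0, H0)].

End Trace.
End Maxwell.

(* Main.v *)
Require Import Defs.
From HB Require Import structures.
From mathcomp Require Import all_boot all_order all_algebra ring_quotient.
From mathcomp Require Import complex ring lra.
From mathcomp Require Import all_classical all_reals all_analysis measurable_realfun.

Set Implicit Arguments.
Unset Strict Implicit.
Unset Printing Implicit Defensive.
Import Order.TTheory GRing.Theory Num.Theory.
Import numFieldNormedType.Exports.
Local Open Scope classical_set_scope.
Local Open Scope ring_scope.
Local Open Scope complex_scope.
Local Open Scope quotient_scope.

(** The group U(t) = exp(- i t M) is unitary and commutes with the spectral projections P_n
    of the Maxwell operator M onto [-n, n]. On the range of P_n everything is bounded, and a
    vector x lies in D(M) with M x = z if and only if M P_n x = P_n z for all n
    ([lcut_dom]). With this criterion the spectral theorem is used only through bounded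
    operators, which pass through integrals and limits.

    Subtracting the extension of the boundary values turns the problem into
    v' = - i M v + g with v(0) in D(M), where g is the sum of g1 = (F - d/dt ext lambda, G) and
    g2 = (0, mu^-1 d ext lambda). The candidate is v(t) = U(t) (v(0) + W(t)) with
    W(t) = \int_0^t U(-s) g(s) ds, and it is a classical solution as soon as W takes values in
    D(M) with M W continuous ([duhamel_solution]). There are two reasons for that:
    - the tangential trace of F - d/dt ext lambda vanishes, so that g1 takes almost all its
      values in D(M), with \int |M g1|^2 finite. By Cauchy-Schwarz in time and orthogonality
      of spectral regions, M P_n W converges uniformly in time
      ([square_integrable_generator]);
    - g2 is continuously differentiable, and an integration by parts expresses i M W by g2, its
      derivative and continuous integrals ([smooth_generator]).
    The difference w of two solutions has zero trace, so it lies in D(M), and |w|^2 has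
    derivative 2 Re <- i M w, w> = 0 because M is symmetric ([evolution_unique]).

    To apply this, the concrete spaces are shown to be as expected. The forms are a Hilbert
    space by Riesz-Fischer ([L2_hilbert]); the coefficients are bounded and coercive, hence
    invertible by a Neumann iteration, and the energy norm is equivalent to the standard one
    ([coeff_op_coercive], [coercive_surj], [Hspace_norm_equiv]). Weak derivatives are unique
    and linear once test forms separate points. This too comes from the spectral theorem: D(M)
    is dense, and the first components of its elements are limits of test forms, so that test
    q-forms are dense ([maxwell_dense_separating]); renaming coefficients transfers the
    separation to degree q + 1 ([separatingS]). *)

(** * Complex Hilbert spaces as real ones *)

Notation Re := complex.Re.
Notation Im := complex.Im.

Section ComplexParts.
Context {R : rcfType}.
Implicit Types a b z : R[i].

Lemma ReD a b : Re (a + b) = Re a + Re b. Proof. by case: a b => [? ?] []. Qed.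
Lemma ImD a b : Im (a + b) = Im a + Im b. Proof. by case: a b => [? ?] []. Qed.
Lemma ReN a : Re (- a) = - Re a. Proof. by case: a. Qed.
Lemma ImN a : Im (- a) = - Im a. Proof. by case: a. Qed.
Lemma ReM a b : Re (a * b) = Re a * Re b - Im a * Im b.
Proof. by case: a b => [? ?] []. Qed.
Lemma ImM a b : Im (a * b) = Re a * Im b + Im a * Re b.
Proof. by case: a b => [? ?] []. Qed.
Lemma ReJ a : Re a^* = Re a. Proof. by case: a. Qed.
Lemma ImJ a : Im a^* = - Im a. Proof. by case: a. Qed.

Lemma complex_ext a b : Re a = Re b -> Im a = Im b -> a = b.
Proof. by case: a b => [? ?] [? ?] /= -> ->. Qed.

Lemma Re_sum I (r : seq I) (Q : pred I) (f : I -> R[i]) :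
  Re (\sum_(i <- r | Q i) f i) = \sum_(i <- r | Q i) Re (f i).
Proof. by apply: (big_morph _ ReD). Qed.

Lemma Im_sum I (r : seq I) (Q : pred I) (f : I -> R[i]) :
  Im (\sum_(i <- r | Q i) f i) = \sum_(i <- r | Q i) Im (f i).
Proof. by apply: (big_morph _ ImD). Qed.

End ComplexParts.

Lemma real_cvg_unique {R : realType} {T : Type} {G : set_system T} {FG : ProperFilter G}
  (u : T -> R) (a b : R) : u @ G --> a -> u @ G --> b -> a = b.
Proof. exact: (@cvg_unique _ (@norm_hausdorff _ R^o)). Qed.

Section HilbertSpace.
Context {R : realType} {X : lmodType R[i]}.
Variable ip : X -> X -> R[i].

(** The real part of the scalar product makes a complex Hilbert space a real
    one with the same norm. It determines the complex scalar product, so all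
    weak formulations below are written with it. *)
Definition rip (x y : X) : R := Re (ip x y).

Local Notation nrm := (ip_norm ip).

Hypothesis HX : hilbert_space ip.
Implicit Types (x y z : X) (a : R).

Lemma ipDl x y z : ip (x + y) z = ip x z + ip y z.
Proof. by rewrite -{1}[x]scale1r (ip_linear HX) mul1r. Qed.

Lemma ip0l z : ip 0 z = 0.
Proof. by apply: (addIr (ip 0 z)); rewrite -ipDl addr0 add0r. Qed.

Lemma ipZl (c : R[i]) x z : ip (c *: x) z = c * ip x z.
Proof. by rewrite -{1}[c *: x]addr0 (ip_linear HX) ip0l addr0. Qed.

Lemma ipZr (c : R[i]) x z : ip x (c *: z) = c^* * ip x z.
Proof.
rewrite [LHS](ip_conj HX) ipZl [ip z x](ip_conj HX).
by apply: complex_ext; rewrite ?(ReJ,ImJ,ReM,ImM); ring.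
Qed.

Lemma ipDr x y z : ip z (x + y) = ip z x + ip z y.
Proof.
rewrite [LHS](ip_conj HX) ipDl (ip_conj HX x z) (ip_conj HX y z).
by apply: complex_ext; rewrite ?(ReJ,ImJ,ReD,ImD) ?(ReJ,ImJ) //; ring.
Qed.

Lemma ripC x y : rip x y = rip y x.
Proof. by rewrite /rip (ip_conj HX) ReJ. Qed.

Lemma ripDl x y z : rip (x + y) z = rip x z + rip y z.
Proof. by rewrite /rip ipDl ReD. Qed.

Lemma ripDr x y z : rip z (x + y) = rip z x + rip z y.
Proof. by rewrite ripC ripDl !(ripC z). Qed.

Lemma ripZl a x z : rip (a%:C *: x) z = a * rip x z.
Proof. by rewrite /rip ipZl ReM /= mul0r subr0. Qed.

Lemma ripZr a x z : rip x (a%:C *: z) = a * rip x z.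
Proof. by rewrite ripC ripZl ripC. Qed.

Lemma rip0l z : rip 0 z = 0.
Proof. by rewrite /rip ip0l. Qed.

Lemma rip0r z : rip z 0 = 0.
Proof. by rewrite ripC rip0l. Qed.

Lemma ripNl x z : rip (- x) z = - rip x z.
Proof. by apply/eqP; rewrite -addr_eq0 -ripDl addNr rip0l. Qed.

Lemma ripNr x z : rip z (- x) = - rip z x.
Proof. by rewrite ripC ripNl ripC. Qed.

Lemma ripBl x y z : rip (x - y) z = rip x z - rip y z.
Proof. by rewrite ripDl ripNl. Qed.

Lemma ripBr x y z : rip z (x - y) = rip z x - rip z y.
Proof. by rewrite ripDr ripNr. Qed.

Lemma rip_suml I (r : seq I) (Q : pred I) (f : I -> X) y :
  rip (\sum_(i <- r | Q i) f i) y = \sum_(i <- r | Q i) rip (f i) y.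
Proof. by apply: (big_morph (rip^~ y)) => [u v|]; [exact: ripDl|exact: rip0l]. Qed.

Lemma rip_sumr I (r : seq I) (Q : pred I) (f : I -> X) y :
  rip y (\sum_(i <- r | Q i) f i) = \sum_(i <- r | Q i) rip y (f i).
Proof. by rewrite ripC rip_suml; apply: eq_bigr => i _; rewrite ripC. Qed.

Lemma rip_ge0 x : 0 <= rip x x.
Proof. by have := ip_ge0 HX x; rewrite lecE => /andP[_]. Qed.

Lemma ipxx x : ip x x = (rip x x)%:C.
Proof.
apply: complex_ext => //=.
by have := ip_ge0 HX x; rewrite lecE => /andP[/eqP/= <-].
Qed.

Lemma Im_ip x y : Im (ip x y) = rip x ('i *: y).
Proof. by rewrite /rip ipZr ReM /=; ring. Qed.

Lemma ripiC x y : rip ('i *: x) y = - rip x ('i *: y).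
Proof. by rewrite /rip ipZl ipZr !ReM /=; ring. Qed.

Lemma ripii x y : rip ('i *: x) ('i *: y) = rip x y.
Proof. by rewrite /rip ipZl ipZr !(ReM,ImM) /=; ring. Qed.

Lemma rip_inj x y : (forall z, rip x z = rip y z) -> x = y.
Proof.
move=> xy; apply/eqP; rewrite -subr_eq0; apply/eqP/(ip_eq0 HX).
by rewrite ipxx ripBl xy subrr.
Qed.

Lemma ip_inj x y : (forall z, ip x z = ip y z) -> x = y.
Proof. by move=> xy; apply: rip_inj => z; rewrite /rip xy. Qed.

Lemma nrm_ge0 x : 0 <= nrm x.
Proof. exact: sqrtr_ge0. Qed.

Lemma nrm2 x : nrm x ^+ 2 = rip x x.
Proof. by rewrite /ip_norm sqr_sqrtr // rip_ge0. Qed.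

Lemma nrm0 : nrm 0 = 0.
Proof. by apply/eqP; rewrite -sqrf_eq0 nrm2 rip0l. Qed.

Lemma nrm_eq0 x : nrm x = 0 -> x = 0.
Proof.
by move=> x0; apply: (ip_eq0 HX); rewrite ipxx -nrm2 x0 expr0n.
Qed.

Lemma le_nrm x b : 0 <= b -> rip x x <= b ^+ 2 -> nrm x <= b.
Proof. by move=> b0; rewrite -nrm2 ler_pXn2r // nnegrE nrm_ge0. Qed.

Lemma nrmZ (c : R[i]) x : nrm (c *: x) ^+ 2 = (Re c ^+ 2 + Im c ^+ 2) * nrm x ^+ 2.
Proof.
rewrite !nrm2 /rip ipZl ipZr !(ReM,ImM,ReJ,ImJ) ipxx /=.
by rewrite /rip; ring.
Qed.

Lemma nrmZr a x : nrm (a%:C *: x) = `|a| * nrm x.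
Proof.
apply/eqP; rewrite -(@eqrXn2 _ 2) ?mulr_ge0 ?nrm_ge0//.
by rewrite nrmZ /= expr0n addr0 exprMn real_normK ?num_real.
Qed.

Lemma nrmN x : nrm (- x) = nrm x.
Proof.
by apply/eqP; rewrite -(@eqrXn2 _ 2) ?nrm_ge0// !nrm2 ripNl ripNr opprK.
Qed.

Lemma nrmC x y : nrm (x - y) = nrm (y - x).
Proof. by rewrite -nrmN opprB. Qed.

Lemma nrm_i x : nrm ('i *: x) = nrm x.
Proof.
by apply/eqP; rewrite -(@eqrXn2 _ 2) ?nrm_ge0// !nrm2 ripii.
Qed.

Lemma rip_le x y : rip x y <= nrm x * nrm y.
Proof.
have [x0|x0] := eqVneq (nrm x) 0; first by rewrite (nrm_eq0 x0) rip0l nrm0 mul0r.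
have [y0|y0] := eqVneq (nrm y) 0; first by rewrite (nrm_eq0 y0) rip0r nrm0 mulr0.
have xy : 0 < nrm x * nrm y by rewrite mulr_gt0 // lt0r ?x0 ?y0 nrm_ge0.
have := rip_ge0 ((nrm y)%:C *: x - (nrm x)%:C *: y).
rewrite !(ripBl,ripBr,ripZl,ripZr) (ripC y) -!nrm2 => h.
rewrite -(ler_pM2l xy); nra.
Qed.

Lemma cauchy_schwarz x y : `|rip x y| <= nrm x * nrm y.
Proof.
by rewrite ler_norml rip_le andbT lerNl -ripNl -(nrmN x) rip_le.
Qed.

Lemma nrmD x y : nrm (x + y) <= nrm x + nrm y.
Proof.
apply: le_nrm; first by rewrite addr_ge0 ?nrm_ge0.
rewrite !(ripDl,ripDr) (ripC y x) -!nrm2.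
by have := rip_le x y; nra.
Qed.

Lemma nrmB x y : nrm (x - y) <= nrm x + nrm y.
Proof. by rewrite (le_trans (nrmD _ _)) // nrmN. Qed.

Lemma nrm_triangle z x y : nrm (x - y) <= nrm (x - z) + nrm (z - y).
Proof. by rewrite (le_trans _ (nrmD _ _)) // addrA subrK. Qed.

Lemma nrm_lipschitz x y : `|nrm x - nrm y| <= nrm (x - y).
Proof.
have h1 := nrmD (x - y) y; have h2 := nrmD (y - x) x.
by rewrite !subrK (nrmC y) in h1 h2; rewrite ler_norml; apply/andP; split; lra.
Qed.

Lemma nrm_sum I (r : seq I) (Q : pred I) (f : I -> X) :
  nrm (\sum_(i <- r | Q i) f i) <= \sum_(i <- r | Q i) nrm (f i).
Proof.
elim/big_rec2: _ => [|i a x _ h]; first by rewrite nrm0.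
by rewrite (le_trans (nrmD _ _)) // lerD2l.
Qed.

(** ** Convergence of vectors *)

Definition vcvg {T : Type} (G : set_system T) (u : T -> X) (l : X) : Prop :=
  (fun t => nrm (u t - l)) @ G --> (0 : R).

Section Convergence.
Context {T : Type} {G : set_system T} {FG : ProperFilter G}.
Implicit Types (u v : T -> X) (b : T -> R).

Lemma vcvg_le u l b : (forall t, nrm (u t - l) <= b t) ->
  b @ G --> (0 : R) -> vcvg G u l.
Proof.
move=> ub b0; apply: (@squeeze_cvgr _ _ _ _ (cst 0) b) => //; last exact: cvg_cst.
by apply: nearW => t; rewrite nrm_ge0 ub.
Qed.

Lemma vcvg_le_near u l b : (\forall t \near G, nrm (u t - l) <= b t) ->
  b @ G --> (0 : R) -> vcvg G u l.
Proof.
move=> ub b0; apply: (@squeeze_cvgr _ _ _ _ (cst 0) b) => //; last exact: cvg_cst.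
by near=> t; rewrite nrm_ge0 /=; near: t.
Unshelve. all: by end_near.
Qed.

Lemma vcvg_cst l : vcvg G (fun _ => l) l.
Proof. by rewrite /vcvg subrr nrm0; exact: cvg_cst. Qed.

Lemma vcvgD u v l m : vcvg G u l -> vcvg G v m ->
  vcvg G (fun t => u t + v t) (l + m).
Proof.
move=> ul vm; apply: (@vcvg_le _ _ (fun t => nrm (u t - l) + nrm (v t - m))).
  by move=> t; rewrite opprD addrACA nrmD.
by rewrite -[0]addr0; exact: cvgD.
Qed.

Lemma vcvgN u l : vcvg G u l -> vcvg G (fun t => - u t) (- l).
Proof. by apply: cvg_trans; rewrite /vcvg; under eq_fun do rewrite -opprD nrmN. Qed.

Lemma vcvgB u v l m : vcvg G u l -> vcvg G v m ->
  vcvg G (fun t => u t - v t) (l - m).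
Proof. by move=> ul /vcvgN; exact: vcvgD. Qed.

Lemma vcvg_nrm u l : vcvg G u l -> (fun t => nrm (u t)) @ G --> nrm l.
Proof.
move=> ul; apply/(@cvgrPdist_le _ R^o) => e e0.
have /(@cvgrPdist_le _ R^o)/(_ _ e0) := ul; apply: filterS => t.
rewrite sub0r normrN ger0_norm ?nrm_ge0//; apply: le_trans.
by rewrite distrC nrm_lipschitz.
Qed.

Lemma cvg_rip u v l m : vcvg G u l -> vcvg G v m ->
  (fun t => rip (u t) (v t)) @ G --> rip l m.
Proof.
move=> ul vm.
have cu : (fun t => rip (u t - l) (v t)) @ G --> (0 : R).
  apply: norm_cvg0; apply: (@squeeze_cvgr _ _ _ _ (cst 0)
      (fun t => nrm (u t - l) * nrm (v t))) => //; last 1 first.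
  - by rewrite -[0](mul0r (nrm m)); apply: cvgM => //; exact: vcvg_nrm.
  - by apply: nearW => t; rewrite normr_ge0 cauchy_schwarz.
  - exact: cvg_cst.
have cv : (fun t => rip l (v t - m)) @ G --> (0 : R).
  apply: norm_cvg0; apply: (@squeeze_cvgr _ _ _ _ (cst 0)
      (fun t => nrm l * nrm (v t - m))) => //; last 1 first.
  - by rewrite -[0](mulr0 (nrm l)); apply: cvgM => //; exact: cvg_cst.
  - by apply: nearW => t; rewrite normr_ge0 cauchy_schwarz.
  - exact: cvg_cst.
rewrite -[rip l m]add0r -[0 + _]add0r.
rewrite (_ : (fun t => _) = fun t => rip (u t - l) (v t) + (rip l (v t - m) + rip l m)).
  by apply: cvgD => //; apply: cvgD => //; exact: cvg_cst.
by apply/funext => t; rewrite ripBl ripBr; ring.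
Qed.

Lemma vcvg_unique u l m : vcvg G u l -> vcvg G u m -> l = m.
Proof.
move=> ul um; have h := vcvgB ul um; apply/eqP; rewrite -subr_eq0; apply/eqP.
apply: nrm_eq0; rewrite -nrmN.
have : vcvg G (fun=> 0 : X) (l - m) by move: h; under eq_fun do rewrite subrr.
rewrite /vcvg sub0r => h0.
have hc : (fun _ : T => nrm (- (l - m)) : R^o) @ G --> (nrm (- (l - m)) : R^o).
  exact: cvg_cst.
exact: (@cvg_unique _ (@norm_hausdorff _ R^o) _ _ _ _ hc h0).
Qed.

Lemma vcvg_eq u v l : (forall t, u t = v t) -> vcvg G u l -> vcvg G v l.
Proof. by move=> /funext ->. Qed.

Lemma vcvg_lip (Y : X -> X) c u l :
  (forall x y, nrm (Y x - Y y) <= c * nrm (x - y)) ->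
  vcvg G u l -> vcvg G (fun t => Y (u t)) (Y l).
Proof.
move=> Yc ul; apply: (@vcvg_le _ _ (fun t => c * nrm (u t - l))) => //.
by rewrite -[0](mulr0 c); apply: cvgM => //; exact: cvg_cst.
Qed.

Lemma vcvgZ (b : T -> R) (a : R) u l : b @ G --> a -> vcvg G u l ->
  vcvg G (fun t => (b t)%:C *: u t) (a%:C *: l).
Proof.
move=> ba ul; apply: (@vcvg_le _ _ (fun t => `|b t| * nrm (u t - l) + `|b t - a| * nrm l)).
  move=> t; rewrite -!nrmZr (le_trans _ (nrmD _ _)) // scalerBr rmorphB scalerBl.
  by rewrite addrA subrK.
rewrite (_ : 0 = `|a| * 0 + 0 * nrm l); last by rewrite mulr0 mul0r addr0.
apply: cvgD; apply: cvgM => //; try exact: cvg_cst.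
  exact: cvg_norm.
rewrite -[0](@normr0 R R^o) -(subrr a); apply: cvg_norm; apply: cvgB => //; exact: cvg_cst.
Qed.

End Convergence.

(** A sequence is convergent as soon as it is close to the values of a
    function that becomes small. *)
Lemma vcauchy_cvg (u : nat -> X) (b : nat -> R) : b @ \oo --> (0 : R) ->
  (forall m n, (m <= n)%N -> nrm (u n - u m) <= b m) ->
  exists l, vcvg \oo u l.
Proof.
move=> b0 ub; apply: (ip_complete HX) => e e0.
have e2 : 0 < e / 2 by rewrite divr_gt0.
have /(@cvgrPdist_lt _ R^o)/(_ _ e2) := b0.
case=> n _ nb; exists n => k l nk nl.
rewrite (le_lt_trans (nrm_triangle (u n) _ _)) // [e]splitr.
have := nb n (leqnn n); rewrite /= sub0r normrN => bn.
have {}bn := le_lt_trans (ler_norm _) bn.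
by rewrite ltrD // ?(le_lt_trans (ub _ _ nk))// nrmC (le_lt_trans (ub _ _ nl)).
Qed.

End HilbertSpace.

(** * Functional calculus of a projection-valued measure *)

Section ProjectionMeasure.
Context {R : realType} {X : lmodType R[i]}.
Variable ip : X -> X -> R[i].
Variable P : set R -> X -> X.
Hypothesis HX : hilbert_space ip.
Hypothesis HP : projection_measure ip P.
Implicit Types (x y z : X) (A B : set R).

Local Notation nrm := (ip_norm ip).
Local Notation rip := (rip ip).

Lemma pmD B x y : measurable B -> P B (x + y) = P B x + P B y.
Proof. by move=> mB; have := pm_linear HP mB 1 x y; rewrite !scale1r. Qed.

Lemma pm0r B : measurable B -> P B 0 = 0.
Proof. by move=> mB; apply: (addIr (P B 0)); rewrite -pmD // addr0 add0r. Qed.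

Lemma pmZ B (c : R[i]) x : measurable B -> P B (c *: x) = c *: P B x.
Proof.
by move=> mB; have := pm_linear HP mB c x 0; rewrite !addr0 pm0r // addr0.
Qed.

Lemma pmN B x : measurable B -> P B (- x) = - P B x.
Proof. by move=> mB; rewrite -scaleN1r pmZ // scaleN1r. Qed.

Lemma pmB B x y : measurable B -> P B (x - y) = P B x - P B y.
Proof. by move=> mB; rewrite pmD // pmN. Qed.

Lemma rip_pm B x y : measurable B -> rip (P B x) y = rip x (P B y).
Proof. by move=> mB; rewrite /rip (pm_sym HP). Qed.

Lemma rip_pm2 B x y : measurable B -> rip (P B x) (P B y) = rip (P B x) y.
Proof. by move=> mB; rewrite -rip_pm // (pm_idem HP). Qed.

Lemma nrm_pm B x : measurable B -> nrm (P B x) <= nrm x.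
Proof.
move=> mB; have [->|Px0] := eqVneq (nrm (P B x)) 0; first exact: nrm_ge0.
have Px : 0 < nrm (P B x) by rewrite lt0r Px0 nrm_ge0.
rewrite -(ler_pM2l Px) -expr2 (nrm2 HX) rip_pm2 //; exact: rip_le.
Qed.

Lemma pm_set0 x : P set0 x = 0.
Proof.
have := pm_sigma_additive HP (fun _ : nat => measurable0) (@trivIset_set0 _ _ setT) x.
rewrite bigcup0 // => /(@cvgrPdist_lt _ R^o) h; apply: (nrm_eq0 HX).
apply/eqP; rewrite eq_le nrm_ge0 andbT; apply/ler_addgt0Pl => e e0.
have [n _ /(_ n.+2 (leqW (leqW (leqnn n))))] := h e e0.
rewrite sumr_const card_ord mulrSr addrK sub0r normrN.
rewrite ger0_norm ?nrm_ge0// addr0 -scaler_nat -(rmorph_nat (real_complex R)) (nrmZr HX) => hn.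
apply: ltW; apply: le_lt_trans hn.
by rewrite ler_peMl ?nrm_ge0// ger0_norm // ler1n.
Qed.

Lemma pmU A B x : measurable A -> measurable B -> [disjoint A & B] ->
  P (A `|` B) x = P A x + P B x.
Proof.
move=> mA mB dAB; pose F := bigcup2 A B.
have mF n : measurable (F n) by rewrite /F /bigcup2; do 2 case: ifP => // _.
have tF : trivIset setT F by rewrite /F -trivIset_bigcup2; exact/disj_set2P.
have := pm_sigma_additive HP mF tF x; rewrite bigcup2E => h.
apply: (vcvg_unique HX (G := \oo) (u := fun n => \sum_(k < n) P (F k) x)) => //.
apply: (vcvg_le_near (b := cst 0)); last exact: cvg_cst.
exists 2%N => // -[//|[//|n]] _ /=.
rewrite !big_ord_recl big1 => [|i _]; last by rewrite /F /bigcup2 /= pm_set0.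
by rewrite addr0 /F /bigcup2 /= subrr (nrm0 HX).
Qed.

(** Projections whose sum is a projection annihilate each other. *)
Lemma pm_disj A B x : measurable A -> measurable B -> [disjoint A & B] ->
  P A (P B x) = 0.
Proof.
move=> mA mB dAB.
have anti z : P A (P B z) = - P B (P A z).
  have := pm_idem HP z (measurableU _ _ mA mB); rewrite !pmU // !pmD //.
  rewrite !(pm_idem HP) // [X in _ + X = _]addrC addrACA -[RHS]addr0.
  by move=> /addrI /eqP; rewrite addr_eq0 => /eqP.
have PAB : P A (P B x) = - P A (P B x).
  by rewrite -{1}(pm_idem HP (P B x) mA) anti pmN // anti !opprK (pm_idem HP).
apply: (nrm_eq0 HX); apply/eqP; rewrite -sqrf_eq0 (nrm2 HX); apply/eqP.
by have := ripNl HX (P A (P B x)) (P A (P B x)); rewrite -PAB; lra.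
Qed.

Lemma pm_setI A B x : measurable A -> measurable B ->
  P A (P B x) = P (A `&` B) x.
Proof.
move=> mA mB; have mI := measurableI _ _ mA mB.
have mAB := measurableD mA mB; have mBA := measurableD mB mA.
have splitP C D z : measurable C -> measurable D ->
    P C z = P (C `&` D) z + P (C `\` D) z.
  move=> mC mD; rewrite -pmU ?setUIDK //; [exact: measurableI|exact: measurableD|].
  by rewrite disj_set2E; apply/eqP/seteqP; split => // t [[_ ?] []].
rewrite (splitP A B) // (splitP B A x) // (setIC B) !pmD // (pm_idem HP) //.
rewrite !pm_disj ?addr0 //; rewrite disj_set2E; apply/eqP/seteqP; split => // t /=.
- by move=> [[_ nB]] [].
- by move=> [[_ nB]] [].
- by move=> [[? ?]] [].
Qed.

(** ** The spectral measures *)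

(** The measure structure rests on the axioms of [ip] and [P], so the proofs are
    arguments. *)
Definition smeas_of (_ : hilbert_space ip) (_ : projection_measure ip P) x :
  set R -> \bar R := spectral_measure ip P x.

Local Notation smeas := (smeas_of HX HP).

Lemma smeasE x B : measurable B -> smeas x B = (rip (P B x) x)%:E.
Proof. by move=> mB; rewrite /smeas_of /spectral_measure (nrm2 HX) rip_pm2. Qed.

Let smeas0 x : smeas x set0 = 0%E.
Proof. by rewrite smeasE // pm_set0 (rip0l HX). Qed.

Let smeas_ge0 x B : (0 <= smeas x B)%E.
Proof. by rewrite lee_fin sqr_ge0. Qed.

Let smeas_sigma x : semi_sigma_additive (smeas x).
Proof.
move=> F mF tF mUF; rewrite smeasE //.
rewrite (_ : (fun n => _) = EFin \o (fun n => rip (\sum_(k < n) P (F k) x) x)).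
  apply: cvg_EFin; first exact: nearW.
  exact: (cvg_rip HX (pm_sigma_additive HP mF tF x) (vcvg_cst HX _)).
apply/funext => n /=; rewrite (rip_suml HX) -sumEFin big_mkord.
by apply: eq_bigr => i _; rewrite smeasE.
Qed.

HB.instance Definition _ x := isMeasure.Build _ _ _ (smeas x)
  (smeas0 x) (smeas_ge0 x) (@smeas_sigma x).

Let smeas_fin x : fin_num_fun (smeas x).
Proof. by []. Qed.

HB.instance Definition _ x := Measure_isFinite.Build _ _ _ (smeas x) (@smeas_fin x).

(** ** Simple functions of the spectral variable *)

Definition mset := {B : set R | measurable B}.
Implicit Types s t : seq (R * mset).

Definition sval_fun s (l : R) : R := \sum_(p <- s) p.1 * \1_(sval p.2) l.

Definition sop s x : X := \sum_(p <- s) (p.1)%:C *: P (sval p.2) x.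

Definition sprod s t : seq (R * mset) :=
  [seq (p.1 * r.1, exist _ _ (measurableI _ _ (svalP p.2) (svalP r.2))) | p <- s, r <- t].

Definition sneg s : seq (R * mset) := [seq (- p.1, p.2) | p <- s].

Lemma sval_fun_prod s t l : sval_fun (sprod s t) l = sval_fun s l * sval_fun t l.
Proof.
rewrite /sval_fun big_allpairs_dep mulr_suml; apply: eq_bigr => p _.
rewrite mulr_sumr; apply: eq_bigr => r _ /=.
by rewrite indicI /= mulrACA.
Qed.

Lemma sval_fun_neg s l : sval_fun (sneg s) l = - sval_fun s l.
Proof. by rewrite /sval_fun big_map -sumrN; apply: eq_bigr => p _; rewrite mulNr. Qed.

Lemma sval_fun_cat s t l : sval_fun (s ++ t) l = sval_fun s l + sval_fun t l.
Proof. by rewrite /sval_fun big_cat. Qed.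

Lemma sop_cat s t x : sop (s ++ t) x = sop s x + sop t x.
Proof. by rewrite /sop big_cat. Qed.

Lemma sop_neg s x : sop (sneg s) x = - sop s x.
Proof.
by rewrite /sop big_map -sumrN; apply: eq_bigr => p _; rewrite rmorphN scaleNr.
Qed.

Lemma sop_lin s (c : R[i]) x y : sop s (c *: x + y) = c *: sop s x + sop s y.
Proof.
rewrite /sop scaler_sumr -big_split; apply: eq_bigr => p _ /=.
by rewrite pmD ?pmZ ?scalerDr ?scalerA 1?mulrC //; exact: svalP.
Qed.

Lemma sop_prod s t x : sop (sprod s t) x = sop s (sop t x).
Proof.
rewrite /sop big_allpairs_dep; apply: eq_bigr => p _ /=.
rewrite (big_morph (P (sval p.2)) (id1 := 0) (op1 := +%R)); first last.
- by rewrite pm0r //; exact: svalP.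
- by move=> u v; rewrite pmD //; exact: svalP.
rewrite scaler_sumr; apply: eq_bigr => r _.
rewrite pmZ ?pm_setI ?scalerA ?rmorphM //; exact: svalP.
Qed.

Lemma rip_sop s x y : rip (sop s x) y = rip x (sop s y).
Proof.
rewrite /sop (rip_suml HX) (rip_sumr HX); apply: eq_bigr => p _.
by rewrite (ripZl HX) (ripZr HX) rip_pm //; exact: svalP.
Qed.

Lemma measurable_sval_fun s : measurable_fun setT (sval_fun s).
Proof.
apply: measurable_sum => p; apply: measurable_funM => //.
by apply: measurable_indic; exact: svalP.
Qed.

Lemma sval_fun_bounded s : exists C, forall l, `|sval_fun s l| <= C.
Proof.
exists (\sum_(p <- s) `|p.1|) => l; rewrite (le_trans (ler_norm_sum _ _ _)) //.
apply: ler_sum => p _; rewrite normrM ler_piMr // indicE.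
by case: (_ \in _); rewrite ?normr1 ?normr0.
Qed.

(** ** Bounded measurable functions of the spectral variable *)

Definition bmeas (f : R -> R) : Prop :=
  measurable_fun setT f /\ exists C, forall l, `|f l| <= C.

Lemma bmeas_integrable f x : bmeas f -> (smeas x).-integrable setT (EFin \o f).
Proof.
move=> [mf [C fC]]; apply: measurable_bounded_integrable => //.
  by rewrite ltey_eq fin_num_measure.
exists C; split; first exact: num_real.
by move=> M CM l _ /=; rewrite (le_trans (fC l)) // ltW.
Qed.

Lemma bmeas_cst c : bmeas (cst c).
Proof. by split => //; exists `|c|. Qed.

Lemma bmeasD f g : bmeas f -> bmeas g -> bmeas (fun l => f l + g l).
Proof.
move=> [mf [C fC]] [mg [D gD]]; split; first exact: measurable_funD.
by exists (C + D) => l; rewrite (le_trans (ler_normD _ _)) // lerD.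
Qed.

Lemma bmeasM f g : bmeas f -> bmeas g -> bmeas (fun l => f l * g l).
Proof.
move=> [mf [C fC]] [mg [D gD]]; split; first exact: measurable_funM.
by exists (C * D) => l; rewrite normrM ler_pM.
Qed.

Lemma bmeasN f : bmeas f -> bmeas (fun l => - f l).
Proof.
by move=> [mf [C fC]]; split; [exact: measurableT_comp|exists C => l; rewrite normrN].
Qed.

Lemma bmeas_sval_fun s : bmeas (sval_fun s).
Proof. by split; [exact: measurable_sval_fun|exact: sval_fun_bounded]. Qed.

Lemma bmeas_indic B : measurable B -> bmeas (\1_B).
Proof.
move=> mB; split; first exact: measurable_indic.
by exists 1 => l; rewrite indicE; case: (_ \in _); rewrite ?normr1 ?normr0.
Qed.

(** The integral of f with respect to the spectral measure of x. *)
Definition sint (f : R -> R) x : R := \int[smeas x]_l f l.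

Lemma sintD f g x : bmeas f -> bmeas g ->
  sint (fun l => f l + g l) x = sint f x + sint g x.
Proof. by move=> bf bg; rewrite /sint RintegralD //; exact: bmeas_integrable. Qed.

Lemma sintZ c f x : bmeas f -> sint (fun l => c * f l) x = c * sint f x.
Proof. by move=> bf; rewrite /sint RintegralZl //; exact: bmeas_integrable. Qed.

Lemma sint_le f g x : bmeas f -> bmeas g -> (forall l, f l <= g l) ->
  sint f x <= sint g x.
Proof. by move=> bf bg fg; apply: le_Rintegral => //; exact: bmeas_integrable. Qed.

Lemma sint_indic B x : measurable B -> sint (\1_B) x = rip (P B x) x.
Proof.
move=> mB; transitivity (fine (smeas x B)); last by rewrite smeasE.
by rewrite /sint /Rintegral integral_indic // setIT.
Qed.

Lemma sint_cst c x : sint (cst c) x = c * nrm x ^+ 2.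
Proof.
transitivity (c * fine (smeas x setT)); first by rewrite /sint Rintegral_cst.
by rewrite smeasE // (pm_setT HP) (nrm2 HX).
Qed.

Lemma sint_sval s x : sint (sval_fun s) x = rip (sop s x) x.
Proof.
elim: s => [|p s IH].
  rewrite /sop big_nil (rip0l HX) (_ : sval_fun _ = cst 0) ?sint_cst ?mul0r //.
  by apply/funext => l; rewrite /sval_fun big_nil.
rewrite -cat1s sop_cat (ripDl HX) -IH.
rewrite (_ : sval_fun _ = fun l => p.1 * \1_(sval p.2) l + sval_fun s l); last first.
  by apply/funext => l; rewrite sval_fun_cat {1}/sval_fun big_seq1.
have mp := svalP p.2; have bp := bmeas_indic mp.
rewrite sintD ?sintZ ?sint_indic //; last exact: bmeas_sval_fun.
  by rewrite /sop big_seq1 (ripZl HX).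
by apply: bmeasM => //; exact: bmeas_cst.
Qed.

(** Multiplicativity turns the norm into an integral, so that uniformly close simple
    functions have close operators: this is what extends the calculus to all bounded
    measurable functions. *)
Lemma sop_nrm2 s x : nrm (sop s x) ^+ 2 = sint (fun l => sval_fun s l ^+ 2) x.
Proof.
rewrite (nrm2 HX) -rip_sop -sop_prod -sint_sval.
by congr sint; apply/funext => l; rewrite sval_fun_prod expr2.
Qed.

Lemma sop_nrm_le s x c : (forall l, `|sval_fun s l| <= c) -> nrm (sop s x) <= c * nrm x.
Proof.
move=> sc; have c0 : 0 <= c by apply: le_trans (sc 0).
have b2 : bmeas (fun l => sval_fun s l ^+ 2).
  by under eq_fun do rewrite expr2; apply: bmeasM; exact: bmeas_sval_fun.
apply: (le_nrm HX); first by rewrite mulr_ge0 ?nrm_ge0.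
rewrite -(nrm2 HX) sop_nrm2 exprMn -sint_cst.
apply: sint_le => //; first exact: bmeas_cst.
by move=> l; rewrite -real_normK ?num_real // ler_pXn2r ?nnegrE.
Qed.

(** Values [k / n.+1 - C] taken where [f] lies in the corresponding interval of
    length [n.+1^-1]. *)
Lemma sval_fun_dense f : bmeas f -> exists s : nat -> seq (R * mset),
  forall n l, `|f l - sval_fun (s n) l| <= n.+1%:R^-1.
Proof.
move=> [mf [C fC]].
suff h n : exists s, forall l, `|f l - sval_fun s l| <= n.+1%:R^-1.
  by exists (fun n => projT1 (cid (h n))) => n; exact: projT2 (cid (h n)).
set d : R := n.+1%:R^-1; have d0 : 0 < d by rewrite invr_gt0.
pose c (k : nat) : R := k%:R * d - C.
pose B (k : nat) : set R := f @^-1` `[c k, c k.+1[%classic.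
have mB k : measurable (B k) by rewrite -[B k]setTI; exact: mf.
(* f + C lies in [0, 2 C], which m intervals of length d cover *)
pose m := (Num.truncn (2 * C / d)).+1.
exists [seq (c k, exist _ (B k) (mB k)) | k <- iota 0 m] => l.
rewrite /sval_fun big_map /=.
pose k := Num.truncn ((f l + C) / d).
have Cl : 0 <= f l + C by have := fC l; rewrite ler_norml; lra.
have /andP[k1 k2] := truncn_itv (divr_ge0 Cl (ltW d0)).
rewrite -/k ler_pdivlMr // in k1; rewrite -/k ltr_pdivrMr // in k2.
have km : (k < m)%N.
  rewrite ltnS; apply: le_truncn; rewrite ler_pM2r ?invr_gt0 //.
  by have := fC l; rewrite ler_norml; lra.
have kin : k \in iota 0 m by rewrite mem_iota.
rewrite (bigD1_seq k kin) ?iota_uniq // big1 => [|j jk].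
  rewrite /= addr0 indicE mem_set ?mulr1; last first.
    by rewrite /B /= in_itv /= /c; apply/andP; split; lra.
  rewrite /c ger0_norm; first by move: k2; rewrite -natr1 mulrDl mul1r; lra.
  by lra.
rewrite /= indicE memNset ?mulr0 // /B /= in_itv /= /c => /andP[j1 j2].
have [jk'|kj|/eqP] := ltngtP j k; last by rewrite (negbTE jk).
  have : j.+1%:R * d <= k%:R * d by rewrite ler_pM2r // ler_nat.
  by lra.
have : k.+1%:R * d <= j%:R * d by rewrite ler_pM2r // ler_nat.
by lra.
Qed.

Definition approx f (s : nat -> seq (R * mset)) : Prop :=
  exists2 b : nat -> R, b @ \oo --> (0 : R) &
    forall n l, `|f l - sval_fun (s n) l| <= b n.

Lemma cvg_inv_nat : (fun n : nat => n.+1%:R^-1 : R) @ \oo --> (0 : R).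
Proof. exact: cvg_harmonic. Qed.

Lemma approx_exists f : bmeas f -> exists s : nat -> seq (R * mset), approx f s.
Proof.
by move=> /sval_fun_dense[s hs]; exists s; eexists; [exact: cvg_inv_nat|exact: hs].
Qed.

Lemma approxD f g (s t : nat -> seq (R * mset)) : approx f s -> approx g t ->
  approx (fun l => f l + g l) (fun n => s n ++ t n).
Proof.
move=> [b b0 hb] [c c0 hc]; exists (fun n => b n + c n).
  by rewrite -[0]addr0; exact: cvgD.
move=> n l; rewrite sval_fun_cat opprD addrACA.
by rewrite (le_trans (ler_normD _ _)) // lerD.
Qed.

Lemma approxN f (s : nat -> seq (R * mset)) : approx f s -> approx (fun l => - f l) (fun n => sneg
  (s n)).
Proof.
move=> [b b0 hb]; exists b => // n l; rewrite sval_fun_neg -opprD normrN.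
exact: hb.
Qed.

Lemma approxM f g (s t : nat -> seq (R * mset)) : bmeas f -> bmeas g -> approx f s -> approx g t ->
  approx (fun l => f l * g l) (fun n => sprod (s n) (t n)).
Proof.
move=> [_ [C fC]] [_ [D gD]] [b b0 hb] [c c0 hc].
exists (fun n => b n * (D + c n) + C * c n).
  rewrite (_ : 0 = 0 * (D + 0) + C * 0); last by rewrite mul0r mulr0 addr0.
  by apply: cvgD; apply: cvgM => //; try (apply: cvgD => //); exact: cvg_cst.
move=> n l; rewrite sval_fun_prod.
have -> : f l * g l - sval_fun (s n) l * sval_fun (t n) l =
  (f l - sval_fun (s n) l) * sval_fun (t n) l + f l * (g l - sval_fun (t n) l) by ring.
rewrite (le_trans (ler_normD _ _)) // !normrM lerD // ler_pM //.
rewrite -[sval_fun _ _](subrK (g l)) addrC (le_trans (ler_normD _ _)) // lerD //.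
by rewrite distrC.
Qed.

Lemma approx_sval (s : seq (R * mset)) : approx (sval_fun s) (fun _ => s).
Proof.
exists (cst 0); first exact: cvg_cst.
by move=> n l; rewrite subrr normr0.
Qed.

Lemma sop_sub_le (s t : seq (R * mset)) x c : (forall l, `|sval_fun s l - sval_fun t l| <= c) ->
  nrm (sop s x - sop t x) <= c * nrm x.
Proof.
move=> stc; rewrite -sop_neg -sop_cat; apply: sop_nrm_le => l.
by rewrite sval_fun_cat sval_fun_neg.
Qed.

Lemma approx_sop_cvg f (s : nat -> seq (R * mset)) x : approx f s -> exists z, vcvg ip \oo (fun n
  => sop (s n) x) z.
Proof.
move=> [b b0 hb]; apply: (ip_complete HX) => e e0.
have bx0 : (fun n => b n * nrm x) @ \oo --> (0 : R).
  by rewrite -[0](mul0r (nrm x)); apply: cvgM => //; exact: cvg_cst.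
have e2 : 0 < e / 2 by rewrite divr_gt0.
have /(@cvgrPdist_lt _ R^o)/(_ _ e2)[n _ hn] := bx0; exists n => k l nk nl.
have := hn k nk; have := hn l nl; rewrite /= !sub0r !normrN.
move=> /(le_lt_trans (ler_norm _)) hl /(le_lt_trans (ler_norm _)) hk.
have : nrm (sop (s k) x - sop (s l) x) <= (b k + b l) * nrm x.
  apply: sop_sub_le => r.
  by rewrite (le_trans (ler_distD (f r) _ _)) // lerD // distrC.
by rewrite mulrDl; lra.
Qed.

(** Two approximations of f are approximations of each other. *)
Lemma approx_sop_unique f (s t : nat -> seq (R * mset)) x z : approx f s -> approx f t ->
  vcvg ip \oo (fun n => sop (s n) x) z -> vcvg ip \oo (fun n => sop (t n) x) z.
Proof.
move=> [b b0 hb] [c c0 hc] sz.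
apply: (vcvg_le (b := fun n => (c n + b n) * nrm x + nrm (sop (s n) x - z))).
  move=> n; rewrite (le_trans (nrm_triangle HX (sop (s n) x) _ _)) // lerD2r.
  apply: sop_sub_le => r.
  by rewrite (le_trans (ler_distD (f r) _ _)) // lerD // distrC.
rewrite (_ : 0 = (0 + 0) * nrm x + 0); last by rewrite !addr0 mul0r.
by apply: cvgD => //; apply: cvgM; [exact: cvgD|exact: cvg_cst].
Qed.

(** ** Functional calculus *)

(** The integral of f with respect to P, as the common limit over all uniform
    approximations of f by simple functions. *)
Definition fcalc (f : R -> R) (x : X) : X :=
  xget 0 [set z | forall s : nat -> seq (R * mset), approx f s -> vcvg ip \oo (fun n => sop (s n) x) z].

Lemma fcalc_cvg f (s : nat -> seq (R * mset)) x : approx f s ->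
  vcvg ip \oo (fun n => sop (s n) x) (fcalc f x).
Proof.
move=> fs; have [z sz] := approx_sop_cvg x fs.
have : exists z, [set z | forall s : nat -> seq (R * mset), approx f s -> vcvg ip \oo (fun n => sop
  (s n) x) z] z.
  by exists z => t ft; exact: (approx_sop_unique fs ft sz).
by move=> /xgetPex => /(_ 0); apply.
Qed.

Lemma fcalc_unique f (s : nat -> seq (R * mset)) x z : approx f s ->
  vcvg ip \oo (fun n => sop (s n) x) z -> fcalc f x = z.
Proof. by move=> fs; apply: (vcvg_unique HX); exact: fcalc_cvg. Qed.

Lemma fcalcD f g x : bmeas f -> bmeas g ->
  fcalc (fun l => f l + g l) x = fcalc f x + fcalc g x.
Proof.
move=> /approx_exists[s fs] /approx_exists[t gt].
apply: (fcalc_unique (approxD fs gt)).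
by under eq_fun do rewrite sop_cat; apply: (vcvgD HX); exact: fcalc_cvg.
Qed.

Lemma fcalcN f x : bmeas f -> fcalc (fun l => - f l) x = - fcalc f x.
Proof.
move=> /approx_exists[s fs]; apply: (fcalc_unique (approxN fs)).
by under eq_fun do rewrite sop_neg; apply: (vcvgN HX); exact: fcalc_cvg.
Qed.

Lemma fcalc_sval (s : seq (R * mset)) x : fcalc (sval_fun s) x = sop s x.
Proof. by apply: (fcalc_unique (approx_sval s)); exact: vcvg_cst. Qed.

Lemma fcalc_lin f (c : R[i]) x y : bmeas f ->
  fcalc f (c *: x + y) = c *: fcalc f x + fcalc f y.
Proof.
move=> /approx_exists[s fs]; apply: (fcalc_unique fs).
under eq_fun do rewrite sop_lin; apply: (vcvgD HX); last exact: fcalc_cvg.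
apply: (vcvg_lip (Y := fun z => c *: z) (c := Num.sqrt (Re c ^+ 2 + Im c ^+ 2))); last exact: fcalc_cvg.
move=> u v; rewrite -scalerBr -(@ler_pXn2r _ 2) ?nnegrE ?mulr_ge0 ?nrm_ge0 ?sqrtr_ge0 //.
by rewrite (nrmZ HX) exprMn [Num.sqrt (_ + _) ^+ 2]sqr_sqrtr ?addr_ge0 ?sqr_ge0.
Qed.

Lemma rip_fcalc f x y : bmeas f -> rip (fcalc f x) y = rip x (fcalc f y).
Proof.
move=> /approx_exists[s fs].
apply: (real_cvg_unique (G := \oo) (u := fun n => rip (sop (s n) x) y)).
  exact: (cvg_rip HX (fcalc_cvg x fs) (vcvg_cst HX y (G := \oo))).
under eq_fun do rewrite rip_sop.
exact: (cvg_rip HX (vcvg_cst HX x (G := \oo)) (fcalc_cvg y fs)).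
Qed.

Lemma fcalcM f g x : bmeas f -> bmeas g ->
  fcalc (fun l => f l * g l) x = fcalc f (fcalc g x).
Proof.
move=> bf bg; have [s fs] := approx_exists bf; have [t gt] := approx_exists bg.
apply: (rip_inj HX) => y; rewrite [RHS]rip_fcalc //.
apply: (real_cvg_unique (G := \oo) (u := fun n => rip (sop (t n) x) (sop (s n) y))).
  under eq_fun do rewrite -rip_sop -sop_prod.
  exact: (cvg_rip HX (fcalc_cvg x (approxM bf bg fs gt)) (vcvg_cst HX y (G := \oo))).
exact: (cvg_rip HX (fcalc_cvg x gt) (fcalc_cvg y fs)).
Qed.

Lemma sint_norm_le f x c : bmeas f -> (forall l, `|f l| <= c) ->
  `|sint f x| <= c * nrm x ^+ 2.
Proof.
move=> bf fc; rewrite ler_norml -mulNr -!sint_cst; apply/andP; split.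
- apply: sint_le => //; first exact: bmeas_cst.
  by move=> l; have := fc l; rewrite ler_norml => /andP[].
- apply: sint_le => //; first exact: bmeas_cst.
  by move=> l; have := fc l; rewrite ler_norml => /andP[].
Qed.

Lemma sint_fcalc f x : bmeas f -> sint f x = rip (fcalc f x) x.
Proof.
move=> bf; have [s fs] := approx_exists bf; have [b b0 hb] := fs.
have h1 : (fun n => rip (sop (s n) x) x) @ \oo --> rip (fcalc f x) x.
  exact: (cvg_rip HX (fcalc_cvg x fs) (vcvg_cst HX x (G := \oo))).
apply/eqP; rewrite -subr_eq0; apply/eqP.
have h2 : (fun n => sint f x - rip (sop (s n) x) x) @ \oo --> sint f x - rip (fcalc f x) x.
  by apply: cvgB => //; exact: cvg_cst.
have h3 : (fun n => sint f x - rip (sop (s n) x) x) @ \oo --> (0 : R).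
  apply: norm_cvg0; apply: (@squeeze_cvgr _ _ _ _ (cst 0) (fun n => b n * nrm x ^+ 2)).
  - apply: nearW => n; rewrite normr_ge0 /= -sint_sval.
    have bs := bmeas_sval_fun (s n).
    rewrite -mulN1r -sintZ // -sintD //; last by apply: bmeasM => //; exact: bmeas_cst.
    apply: sint_norm_le => [|l]; last by rewrite mulN1r.
    by apply: bmeasD => //; apply: bmeasM => //; exact: bmeas_cst.
  - exact: cvg_cst.
  - by rewrite -[0](mul0r (nrm x ^+ 2)); apply: cvgM => //; exact: cvg_cst.
exact: real_cvg_unique h2 h3.
Qed.

Lemma fcalc_nrm2 f x : bmeas f -> nrm (fcalc f x) ^+ 2 = sint (fun l => f l ^+ 2) x.
Proof.
move=> bf; have bf2 : bmeas (fun l => f l ^+ 2) by under eq_fun do rewrite expr2; exact: bmeasM.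
rewrite sint_fcalc // (nrm2 HX) -rip_fcalc // -fcalcM //.
Qed.

Lemma fcalc_nrm_le f x c : bmeas f -> (forall l, `|f l| <= c) -> nrm (fcalc f x) <= c * nrm x.
Proof.
move=> bf fc; have c0 : 0 <= c by apply: le_trans (fc 0).
have bf2 : bmeas (fun l => f l ^+ 2) by under eq_fun do rewrite expr2; exact: bmeasM.
apply: (le_nrm HX); first by rewrite mulr_ge0 ?nrm_ge0.
rewrite -(nrm2 HX) fcalc_nrm2 // exprMn -sint_cst.
apply: sint_le => //; first exact: bmeas_cst.
by move=> l; rewrite -real_normK ?num_real // ler_pXn2r ?nnegrE.
Qed.

Lemma fcalc_indic B x : measurable B -> fcalc (\1_B) x = P B x.
Proof.
move=> mB; rewrite (_ : \1_B = sval_fun [:: (1, exist _ B mB)]).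
  by rewrite fcalc_sval /sop big_seq1 scale1r.
by apply/funext => l; rewrite /sval_fun big_seq1 mul1r.
Qed.

End ProjectionMeasure.

(** * The unitary group and the spectral cutoffs *)

Section TrigonometricBounds.
Context {R : realType}.
Implicit Types a b : R.

Lemma norm_sin_le a : `|sin a| <= `|a|.
Proof.
wlog a0 : a / 0 <= a => [h|].
  have [/h//|/ltW a0] := leP 0 a.
  by have := h (- a); rewrite oppr_ge0 sinN !normrN; apply.
have cs : {within `[0, a], continuous sin}.
  by apply: continuous_subspaceT => x; exact: continuous_sin.
have [c _] := @MVT_segment _ sin cos 0 a a0 (fun x _ => is_derive_sin x) cs.
rewrite sin0 !subr0 => ->; rewrite normrM ler_piMl // ler_norml cos_geN1 cos_le1 //.
Qed.

Lemma norm_cos1_le a : `|cos a - 1| <= a ^+ 2.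
Proof.
wlog a0 : a / 0 <= a => [h|].
  have [/h//|/ltW a0] := leP 0 a.
  by have := h (- a); rewrite oppr_ge0 cosN sqrrN; apply.
have cs : {within `[0, a], continuous cos}.
  by apply: continuous_subspaceT => x; exact: continuous_cos.
have [c] := @MVT_segment _ cos (fun x => - sin x) 0 a a0 (fun x _ => is_derive_cos x) cs.
rewrite in_itv /= => /andP[c0 ca]; rewrite cos0 !subr0 => ->.
rewrite normrM normrN expr2 ler_pM // ?(le_trans (norm_sin_le _)) //.
  by rewrite !ger0_norm.
by rewrite ger0_norm.
Qed.

Lemma norm_sinB_le a : `|sin a - a| <= `|a| ^+ 3.
Proof.
wlog a0 : a / 0 <= a => [h|].
  have [/h//|/ltW a0] := leP 0 a.
  have := h (- a); rewrite oppr_ge0 sinN -opprD !normrN; apply => //.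
have cs : {within `[0, a], continuous (sin \- id)}.
  by apply: continuous_subspaceT => x; apply: cvgB; [exact: continuous_sin|exact: cvg_id].
have dr x : x \in `]0, a[ -> is_derive x 1 (sin \- id) (cos x - 1).
  by move=> _; apply: is_deriveB.
have [c] := @MVT_segment _ _ _ 0 a a0 dr cs.
rewrite in_itv /= => /andP[c0 ca]; rewrite sin0 !subr0 => ->.
rewrite normrM exprSr ler_pM // ?(le_trans (norm_cos1_le _)) //.
by rewrite ger0_norm // ler_pXn2r ?nnegrE.
Qed.

End TrigonometricBounds.

Section UnitaryGroup.
Context {R : realType} {X : lmodType R[i]}.
Variable ip : X -> X -> R[i].
Variable P : set R -> X -> X.
Hypothesis HX : hilbert_space ip.
Hypothesis HP : projection_measure ip P.
Implicit Types (x y z : X) (t s : R) (f g : R -> R).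

Local Notation nrm := (ip_norm ip).
Local Notation rip := (rip ip).
Local Notation fcalc := (fcalc ip P).
Local Notation sint := (sint HX HP).
Local Notation smeas := (smeas_of HX HP).

Lemma fcalcZ f (c : R[i]) x : bmeas f -> fcalc f (c *: x) = c *: fcalc f x.
Proof.
move=> bf; have f0 : fcalc f 0 = 0.
  have := fcalc_lin HX HP 1 0 0 bf; rewrite !scale1r !addr0.
  by move=> h; apply: (addIr (fcalc f 0)); rewrite add0r -h.
by have := fcalc_lin HX HP c x 0 bf; rewrite f0 !addr0.
Qed.

Lemma fcalc_addv f x y : bmeas f -> fcalc f (x + y) = fcalc f x + fcalc f y.
Proof. by move=> bf; have := fcalc_lin HX HP 1 x y bf; rewrite !scale1r. Qed.

Lemma fcalc_oppv f x : bmeas f -> fcalc f (- x) = - fcalc f x.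
Proof. by move=> bf; rewrite -scaleN1r fcalcZ // scaleN1r. Qed.

Lemma fcalc_subv f x y : bmeas f -> fcalc f (x - y) = fcalc f x - fcalc f y.
Proof. by move=> bf; rewrite fcalc_addv // fcalc_oppv. Qed.

Lemma fcalc_cst c x : fcalc (cst c) x = c%:C *: x.
Proof.
rewrite (_ : cst c = fun l => cst c l * \1_[set: R] l); last first.
  by apply/funext => l; rewrite indicT mulr1.
have -> : (fun l => cst c l * \1_[set: R] l) =
    sval_fun [:: (c, exist (fun B : set R => measurable B) _ measurableT)].
  by apply/funext => l; rewrite /sval_fun big_seq1.
by rewrite (fcalc_sval HX HP) /sop big_seq1 (pm_setT HP).
Qed.

Lemma bmeas_cos t : bmeas (fun l => cos (t * l)).
Proof.
split; last by exists 1 => l; rewrite ler_norml cos_geN1 cos_le1.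
apply: (measurableT_comp (f := cos)); last exact: measurable_funM.
exact: (continuous_measurable_fun (@continuous_cos _)).
Qed.

Lemma bmeas_sin t : bmeas (fun l => sin (t * l)).
Proof.
split; last by exists 1 => l; exact: sin_max.
apply: (measurableT_comp (f := sin)); last exact: measurable_funM.
exact: (continuous_measurable_fun (@continuous_sin _)).
Qed.

(** The integral of f - i g with respect to P. The calculus itself is kept to real
    functions, whose operators are symmetric. *)
Definition cfcalc f g x : X := fcalc f x - 'i *: fcalc g x.

(** A symmetric operator S has real <S x, x>. *)
Lemma rip_fcalc_i f x : bmeas f -> rip (fcalc f x) ('i *: x) = 0.
Proof.
move=> bf; have := ripiC HX (fcalc f x) x.
have -> : rip ('i *: fcalc f x) x = rip (fcalc f x) ('i *: x).
  by rewrite (rip_fcalc HX HP) // fcalcZ // (ripC HX).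
by lra.
Qed.

Lemma cfcalc_nrm2 f g x : bmeas f -> bmeas g ->
  nrm (cfcalc f g x) ^+ 2 = sint (fun l => f l ^+ 2 + g l ^+ 2) x.
Proof.
move=> bf bg; rewrite (nrm2 HX) /cfcalc !(ripBl HX, ripBr HX) (ripii HX).
have sq h : bmeas h -> bmeas (fun l => h l ^+ 2).
  by move=> bh; under eq_fun do rewrite expr2; exact: bmeasM.
rewrite (sintD HX HP) // -?(fcalc_nrm2 HX HP) //; [|exact: sq..].
rewrite !(nrm2 HX) (ripC HX ('i *: _)).
suff -> : rip (fcalc f x) ('i *: fcalc g x) = 0 by ring.
rewrite -fcalcZ // -(rip_fcalc HX HP _ _ bg) -(fcalcM HX HP) //.
by rewrite rip_fcalc_i //; exact: bmeasM.
Qed.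

Definition ugroup t x : X := cfcalc (fun l => cos (t * l)) (fun l => sin (t * l)) x.

Let bc := bmeas_cos.
Let bs := bmeas_sin.

Lemma ugroup_lin t (c : R[i]) x y :
  ugroup t (c *: x + y) = c *: ugroup t x + ugroup t y.
Proof.
rewrite /ugroup /cfcalc !(fcalc_lin HX HP) // scalerBr !scalerDr opprD !scalerA.
by rewrite (mulrC 'i) addrACA.
Qed.

Lemma ugroupD t x y : ugroup t (x + y) = ugroup t x + ugroup t y.
Proof. by have := ugroup_lin t 1 x y; rewrite !scale1r. Qed.

Lemma ugroup0r t : ugroup t 0 = 0.
Proof. by apply: (addIr (ugroup t 0)); rewrite -ugroupD addr0 add0r. Qed.

Lemma ugroupZ t (c : R[i]) x : ugroup t (c *: x) = c *: ugroup t x.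
Proof. by have := ugroup_lin t c x 0; rewrite ugroup0r !addr0. Qed.

Lemma ugroupN t x : ugroup t (- x) = - ugroup t x.
Proof. by rewrite -scaleN1r ugroupZ scaleN1r. Qed.

Lemma ugroupB t x y : ugroup t (x - y) = ugroup t x - ugroup t y.
Proof. by rewrite ugroupD ugroupN. Qed.

Lemma nrm_ugroup t x : nrm (ugroup t x) = nrm x.
Proof.
apply/eqP; rewrite -(@eqrXn2 _ 2) ?nrm_ge0 // cfcalc_nrm2 //.
have -> : (fun l => cos (t * l) ^+ 2 + sin (t * l) ^+ 2) = cst 1.
  by apply/funext => l; rewrite cos2Dsin2.
by rewrite (sint_cst HX HP) mul1r.
Qed.

Lemma ugroup0 x : ugroup 0 x = x.
Proof.
rewrite /ugroup /cfcalc.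
have -> : (fun l : R => cos (0 * l)) = cst 1 by apply/funext => l; rewrite mul0r cos0.
have -> : (fun l : R => sin (0 * l)) = cst 0 by apply/funext => l; rewrite mul0r sin0.
by rewrite !fcalc_cst scale1r scale0r scaler0 subr0.
Qed.

Lemma ugroup_comp s t x : ugroup s (ugroup t x) = ugroup (s + t) x.
Proof.
rewrite /ugroup /cfcalc.
have -> : (fun l => cos ((s + t) * l)) =
    (fun l => cos (s * l) * cos (t * l) + - (sin (s * l) * sin (t * l))).
  by apply/funext => l; rewrite mulrDl cosD.
have -> : (fun l => sin ((s + t) * l)) =
    (fun l => sin (s * l) * cos (t * l) + cos (s * l) * sin (t * l)).
  by apply/funext => l; rewrite mulrDl sinD.
have bM := bmeasM.
rewrite !(fcalcD HX HP, fcalcN HX HP, fcalcM HX HP, fcalc_subv, fcalcZ) //;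
  try (by apply: bM); try (by apply: bmeasN; apply: bM).
rewrite scalerBr !scalerDr !scalerA.
have -> : ('i : R[i]) * 'i = -1 by apply: complex_ext => /=; ring.
by rewrite scaleN1r opprK !opprD !addrA [LHS](ACl (1*4*3*2)).
Qed.

Lemma fcalc_ugroup f t x : bmeas f -> fcalc f (ugroup t x) = ugroup t (fcalc f x).
Proof.
move=> bf; rewrite /ugroup /cfcalc fcalc_subv // fcalcZ // -!(fcalcM HX HP) //.
by congr (_ - 'i *: _); congr (fcalc _ _); apply/funext => l; rewrite mulrC.
Qed.

Lemma rip_ugroup t x y : rip (ugroup t x) y = rip x (ugroup (- t) y).
Proof.
rewrite /ugroup /cfcalc (ripBl HX) (ripBr HX).
have -> : (fun l => cos (- t * l)) = (fun l => cos (t * l)).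
  by apply/funext => l; rewrite mulNr cosN.
have -> : (fun l => sin (- t * l)) = (fun l => - sin (t * l)).
  by apply/funext => l; rewrite mulNr sinN.
rewrite (fcalcN HX HP) // scalerN (ripNr HX) opprK (rip_fcalc HX HP) //.
by rewrite (ripiC HX) opprK (rip_fcalc HX HP) // fcalcZ.
Qed.

(** ** Polarization *)

(** The quadratic form of a linear operator determines its sesquilinear form. With S the
    operator of a function, the summands are the integrals that define
    [spectral_integral]. *)
Lemma polarization (S : X -> X) x y :
  (forall (c : R[i]) u v, S (c *: u + v) = c *: S u + S v) ->
  4^-1 * \sum_(k < 4) (0 +i* 1) ^+ k *
    ip (S (x + (0 +i* 1) ^+ k *: y)) (x + (0 +i* 1) ^+ k *: y) = ip (S x) y.
Proof.
move=> Slin; have expand (c d : R[i]) : c^* = d -> ip (S (x + c *: y)) (x + c *: y) =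
    ip (S x) x + d * ip (S x) y + c * ip (S y) x + c * d * ip (S y) y.
  move=> <-; rewrite [x + _]addrC Slin (ipDl HX) !(ipDr HX) !(ipZl HX) !(ipZr HX).
  by ring.
have ii : (0 +i* 1) * (0 +i* 1) = -1 :> R[i] by apply: complex_ext => /=; ring.
rewrite !big_ord_recl big_ord0 /= /bump /= !addn0 !add1n expr0 expr1.
have -> : (0 +i* 1) ^+ 3 = - (0 +i* 1) :> R[i] by rewrite exprS expr2 ii mulrN1.
rewrite expr2 ii (expand 1 1) ?(expand (0 +i* 1) (- (0 +i* 1))) ?(expand (-1) (-1))
  ?(expand (- (0 +i* 1)) (0 +i* 1)); try by apply: complex_ext => /=; rewrite ?oppr0 ?opprK.
move: (ip (S x) x) (ip (S x) y) (ip (S y) x) (ip (S y) y) => a b d e.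
move: (0 +i* 1 : R[i]) ii => i ii.
rewrite -[RHS](mulKf (_ : 4 != 0)) ?pnatr_eq0 //; congr (_ * _).
transitivity (2 * b - 2 * (i * i) * b + 2 * (1 + i * i) * d); first by ring.
by rewrite ii; ring.
Qed.

Lemma ip_cfcalc f g x : bmeas f -> bmeas g ->
  complex_integral (spectral_measure ip P x) setT (fun l => f l -i* g l) =
  ip (cfcalc f g x) x.
Proof.
move=> bf bg; apply: complex_ext => /=.
  transitivity (sint f x) => //; rewrite (sint_fcalc HX HP) //.
  by rewrite -/(rip _ _) (ripBl HX) (ripiC HX) rip_fcalc_i // oppr0 subr0.
transitivity (sint (fun l => - g l) x) => //.
rewrite (sint_fcalc HX HP) ?(fcalcN HX HP) //; last exact: bmeasN.
by rewrite (Im_ip HX) (ripBl HX) rip_fcalc_i // (ripii HX) (ripNl HX) sub0r.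
Qed.

Lemma exp_groupE t x : exp_group ip P t x = ugroup t x.
Proof.
rewrite /exp_group /spectral_calculus.
have E y : ip (ugroup t x) y =
    spectral_integral ip P (fun l => cos (t * l) -i* sin (t * l)) x y.
  rewrite /spectral_integral; under [in RHS]eq_bigr do rewrite ip_cfcalc //.
  by rewrite polarization //; exact: ugroup_lin.
apply: xget_unique => //.
by move=> z zE; apply: (ip_inj HX) => y; rewrite E zE.
Qed.

(** ** Cutoffs of the spectral variable *)

Definition cutoff (n : nat) : set R := `[- n%:R, n%:R]%classic.

Lemma measurable_cutoff n : measurable (cutoff n).
Proof. exact: measurable_itv. Qed.

Lemma cutoffP n l : cutoff n l <-> `|l| <= n%:R.
Proof. by rewrite /cutoff /= in_itv /= ler_norml. Qed.

Lemma cutoff_subset m n : (m <= n)%N -> cutoff m `<=` cutoff n.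
Proof. by move=> mn l /cutoffP lm; apply/cutoffP; rewrite (le_trans lm) // ler_nat. Qed.

(** The spectral projection onto [-n, n], and below the restriction of the generator to
    its range, a bounded operator. Every identity for the unbounded generator is obtained
    from identities for these bounded pieces. *)
Definition pcut n x : X := P (cutoff n) x.

Definition lcut n x : X := fcalc (fun l => l * \1_(cutoff n) l) x.

Lemma bmeas_cut f n : measurable_fun setT f -> (exists C, forall l, cutoff n l -> `|f l| <= C) ->
  bmeas (fun l => f l * \1_(cutoff n) l).
Proof.
move=> mf [C fC]; split.
  by apply: measurable_funM => //; apply: measurable_indic; exact: measurable_cutoff.
exists `|C| => l; rewrite indicE; case: (boolP (l \in cutoff n)) => [/set_mem cl|_].
  by rewrite mulr1 (le_trans (fC _ cl)) // ler_norm.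
by rewrite mulr0 normr0.
Qed.

Lemma bmeas_lcut n : bmeas (fun l => l * \1_(cutoff n) l).
Proof. by apply: bmeas_cut => //; exists n%:R => l /cutoffP. Qed.

Lemma bmeas_pcut n : bmeas (\1_(cutoff n) : R -> R).
Proof. by apply: bmeas_indic; exact: measurable_cutoff. Qed.

Lemma pcutE n x : pcut n x = fcalc (\1_(cutoff n)) x.
Proof. by rewrite (fcalc_indic HX HP) //; exact: measurable_cutoff. Qed.

Lemma pcutD n x y : pcut n (x + y) = pcut n x + pcut n y.
Proof. by apply: (pmD HP); exact: measurable_cutoff. Qed.

Lemma pcutB n x y : pcut n (x - y) = pcut n x - pcut n y.
Proof. by apply: (pmB HP); exact: measurable_cutoff. Qed.

Lemma pcutZ n (c : R[i]) x : pcut n (c *: x) = c *: pcut n x.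
Proof. by apply: (pmZ HP); exact: measurable_cutoff. Qed.

(** Continuity from below of the spectral measure of x. *)
Lemma pcut_cvg x : vcvg ip \oo (fun n => pcut n x) x.
Proof.
have h : (smeas x \o cutoff) @ \oo --> smeas x (\bigcup_n cutoff n).
  apply: nondecreasing_cvg_mu => //.
  - by move=> n; exact: measurable_cutoff.
  - by apply: bigcupT_measurable => n; exact: measurable_cutoff.
  - by move=> m n mn; apply/subsetPset; exact: cutoff_subset.
have UT : \bigcup_n cutoff n = [set: R].
  apply/seteqP; split => // l _; exists (Num.truncn `|l|).+1 => //.
  by apply/cutoffP; apply: ltW; have /andP[] := truncn_itv (normr_ge0 l).
have {}h : (fun n => rip (pcut n x) x) @ \oo --> rip x x.
  move: h; rewrite UT (smeasE HX HP) // (pm_setT HP) => /fine_cvg.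
  rewrite (_ : _ \o _ = fun n => rip (pcut n x) x) //.
  apply/funext => n; transitivity (fine (smeas x (cutoff n))) => //.
  by rewrite (smeasE HX HP) //; exact: measurable_cutoff.
have h2 : (fun n => nrm (pcut n x - x) ^+ 2) @ \oo --> (0 : R).
  rewrite -(subrr (rip x x)) (_ : (fun n => _) = fun n => rip x x - rip (pcut n x) x).
    by apply: cvgB => //; exact: cvg_cst.
  apply/funext => n; rewrite (nrm2 HX) !(ripBl HX, ripBr HX) (ripC HX x).
  rewrite (rip_pm2 HP) ?subrr ?sub0r ?opprB //; exact: measurable_cutoff.
have h3 : (fun n => Num.sqrt (nrm (pcut n x - x) ^+ 2)) @ \oo --> Num.sqrt (0 : R).
  by apply: continuous_cvg => //; exact: sqrt_continuous.
move: h3; rewrite sqrtr0; apply: cvg_trans; apply: near_eq_cvg; apply: nearW => n.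
by rewrite /= sqrtr_sqr ger0_norm ?nrm_ge0.
Qed.

Lemma rip_lcut n x y : rip (lcut n x) y = rip x (lcut n y).
Proof. by rewrite (rip_fcalc HX HP) //; exact: bmeas_lcut. Qed.

Lemma lcut_ugroup n t x : lcut n (ugroup t x) = ugroup t (lcut n x).
Proof. by apply: fcalc_ugroup; exact: bmeas_lcut. Qed.

Lemma pcut_lcut m n x : (n <= m)%N -> pcut n (lcut m x) = lcut n x.
Proof.
move=> nm; rewrite pcutE -(fcalcM HX HP) //; [|exact: bmeas_pcut|exact: bmeas_lcut].
congr fcalc; apply/funext => l; rewrite mulrCA !indicE.
case: (boolP (l \in cutoff n)) => [/set_mem cl|_]; last by rewrite mul0r.
by rewrite mem_set ?mulr1 //; exact: cutoff_subset cl.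
Qed.

Lemma lcut_pcut m n x : lcut m (pcut n x) = pcut m (lcut n x).
Proof.
rewrite /lcut !pcutE -!(fcalcM HX HP) //; [|by (apply: bmeas_pcut || apply: bmeas_lcut) ..].
by congr fcalc; apply/funext => l; ring.
Qed.

Lemma nrm_lcut n x : nrm (lcut n x) ^+ 2 = sint (fun l => l ^+ 2 * \1_(cutoff n) l) x.
Proof.
rewrite (fcalc_nrm2 HX HP) ?exprMn; last exact: bmeas_lcut.
congr sint; apply/funext => l; rewrite exprMn indicE.
by case: (_ \in _); rewrite ?expr1n ?expr0n.
Qed.

Lemma lcut_le n x : nrm (lcut n x) <= n%:R * nrm x.
Proof.
apply: (fcalc_nrm_le HX HP); first exact: bmeas_lcut.
move=> l; rewrite indicE; case: (boolP (l \in _)) => [/set_mem/cutoffP|_].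
  by rewrite mulr1.
by rewrite mulr0 normr0.
Qed.

End UnitaryGroup.

(** * The generator below its spectral cutoffs *)

Section SpectralResolution.
Context {R : realType} {X : lmodType R[i]}.
Variable ip : X -> X -> R[i].
Variable P : set R -> X -> X.
Hypothesis HX : hilbert_space ip.
Hypothesis HP : projection_measure ip P.
Implicit Types (x y z : X) (t s h : R) (f g : R -> R).

Local Notation nrm := (ip_norm ip).
Local Notation rip := (rip ip).
Local Notation fcalc := (fcalc ip P).
Local Notation cfcalc := (cfcalc ip P).
Local Notation ugroup := (ugroup ip P).
Local Notation pcut := (pcut P).
Local Notation lcut := (lcut ip P).
Local Notation sint := (sint HX HP).
Local Notation smeas := (smeas_of HX HP).

(** ** Small times *)

Lemma cfcalc_pcut f g n x : bmeas f -> bmeas g -> cfcalc f g (pcut n x) =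
  cfcalc (fun l => f l * \1_(cutoff n) l) (fun l => g l * \1_(cutoff n) l) x.
Proof.
by move=> bf bg; rewrite /cfcalc (pcutE HX HP) -!(fcalcM HX HP) //; exact: bmeas_pcut.
Qed.

Lemma cfcalcD f g f' g' x : bmeas f -> bmeas g -> bmeas f' -> bmeas g' ->
  cfcalc f g x + cfcalc f' g' x = cfcalc (fun l => f l + f' l) (fun l => g l + g' l) x.
Proof.
move=> bf bg bf' bg'; rewrite /cfcalc !(fcalcD HX HP) // scalerDr opprD.
by rewrite addrACA.
Qed.

Let bc := @bmeas_cos R.
Let bs := @bmeas_sin R.

Let bcut f n : bmeas f -> bmeas (fun l => f l * \1_(cutoff n) l).
Proof. by move=> bf; apply: bmeasM => //; exact: bmeas_pcut. Qed.

Lemma ugroup_pcutE h n x : ugroup h (pcut n x) - pcut n x =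
  cfcalc (fun l => (cos (h * l) - 1) * \1_(cutoff n) l)
         (fun l => sin (h * l) * \1_(cutoff n) l) x.
Proof.
have -> : - pcut n x = cfcalc (fun l => -1 * \1_(cutoff n) l) (fun l => 0 * \1_(cutoff n) l) x.
  rewrite -(cfcalc_pcut n x (bmeas_cst (-1)) (bmeas_cst 0)) /cfcalc.
  by rewrite !(fcalc_cst HX HP) scale0r scaler0 subr0 rmorphN scaleN1r.
rewrite [ugroup _ _]cfcalc_pcut // cfcalcD //; try (by apply: bcut); last 2 first.
- by apply: bcut; exact: bmeas_cst.
- by apply: bcut; exact: bmeas_cst.
by congr cfcalc; apply/funext => l; ring.
Qed.

Lemma ugroup_pcutE2 h n x :
  ugroup h (pcut n x) - pcut n x + h%:C *: ('i *: lcut n x) =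
  cfcalc (fun l => (cos (h * l) - 1) * \1_(cutoff n) l)
         (fun l => (sin (h * l) - h * l) * \1_(cutoff n) l) x.
Proof.
have bl := bmeas_lcut (R := R) n.
have bhl : bmeas (fun l => - h * (l * \1_(cutoff n) l)) by apply: (bmeasM (bmeas_cst (- h))).
have b0 : bmeas (fun l : R => 0) by exact: bmeas_cst.
have -> : h%:C *: ('i *: lcut n x) = cfcalc (fun=> 0) (fun l => - h * (l * \1_(cutoff n) l)) x.
  rewrite /cfcalc (fcalcM HX HP) //; last exact: (bmeas_cst (- h)).
  rewrite !(fcalc_cst HX HP) scale0r sub0r rmorphN scaleNr scalerN opprK.
  by rewrite !scalerA mulrC.
rewrite ugroup_pcutE cfcalcD //.
- by congr cfcalc; apply/funext => l; ring.
- by apply: bcut; apply: bmeasD => //; exact: bmeas_cst.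
- exact: bcut.
Qed.

Lemma ugroup_pcut_le h n x :
  nrm (ugroup h (pcut n x) - pcut n x) <= 2 * `|h| * nrm (lcut n x).
Proof.
have bl := bmeas_lcut (R := R) n.
have bc1 : bmeas (fun l => (cos (h * l) - 1) * \1_(cutoff n) l).
  by apply: bcut; apply: bmeasD => //; exact: bmeas_cst.
have sq f : bmeas f -> bmeas (fun l => f l ^+ 2).
  by move=> bf; under eq_fun do rewrite expr2; exact: bmeasM.
have bl2 := sq _ bl.
apply: (le_nrm HX); first by rewrite !mulr_ge0 ?nrm_ge0.
rewrite -(nrm2 HX) ugroup_pcutE (cfcalc_nrm2 HX HP) //; last exact: bcut.
rewrite exprMn (fcalc_nrm2 HX HP) // -(sintZ HX HP) //.
apply: (sint_le HX HP).
- by apply: bmeasD; apply: sq => //; exact: bcut.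
- exact: (bmeasM (bmeas_cst _)).
move=> l; rewrite !exprMn real_normK ?num_real //; set c := \1__ _.
have c0 : 0 <= c ^+ 2 by exact: sqr_ge0.
set a := h * l.
have -> : 2 ^+ 2 * h ^+ 2 * (l ^+ 2 * c ^+ 2) = 4 * a ^+ 2 * c ^+ 2 by rewrite /a; ring.
rewrite -mulrDl ler_wpM2r //.
have h1 := norm_cos1_le a; have h2 := norm_sin_le a.
have {}h2 : sin a ^+ 2 <= a ^+ 2 by rewrite -ler_sqrt ?sqr_ge0 // !sqrtr_sqr.
have h3 := cos_geN1 a; have h4 := cos_le1 a.
have : (cos a - 1) ^+ 2 <= 2 * a ^+ 2.
  move: h1; rewrite ler0_norm; last by lra.
  by move=> h1; nra.
by have := sqr_ge0 a; lra.
Qed.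

(** On the range of the cutoff the first order expansion of the exponential holds uniformly
    in the spectral variable. *)
Lemma ugroup_pcut_le2 h n x : `|h| <= 1 ->
  nrm (ugroup h (pcut n x) - pcut n x + h%:C *: ('i *: lcut n x)) <=
  h ^+ 2 * (n%:R ^+ 2 + n%:R ^+ 3) * nrm x.
Proof.
move=> h1; have bl := bmeas_lcut (R := R) n.
have bc1 : bmeas (fun l => (cos (h * l) - 1) * \1_(cutoff n) l).
  by apply: bcut; apply: bmeasD => //; exact: bmeas_cst.
have bs1 : bmeas (fun l => (sin (h * l) - h * l) * \1_(cutoff n) l).
  rewrite (_ : (fun l => _) = fun l => sin (h * l) * \1_(cutoff n) l
    + - h * (l * \1_(cutoff n) l)); last by apply/funext => l; ring.
  by apply: bmeasD; [exact: bcut|apply: (bmeasM (bmeas_cst (- h)))].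
have sq f : bmeas f -> bmeas (fun l => f l ^+ 2).
  by move=> bf; under eq_fun do rewrite expr2; exact: bmeasM.
have k0 : 0 <= n%:R ^+ 2 + n%:R ^+ 3 :> R by rewrite addr_ge0 ?exprn_ge0.
apply: (le_nrm HX); first by rewrite mulr_ge0 ?nrm_ge0 // mulr_ge0 ?sqr_ge0.
rewrite -(nrm2 HX) ugroup_pcutE2 (cfcalc_nrm2 HX HP) //.
rewrite exprMn -(sint_cst HX HP).
apply: (sint_le HX HP).
- by apply: bmeasD; exact: sq.
- exact: bmeas_cst.
move=> l /=; rewrite indicE; case: (boolP (l \in _)) => [/set_mem/cutoffP ln|_]; last first.
  by rewrite !mulr0 expr0n addr0 sqr_ge0.
rewrite !mulr1; set a := h * l.
have e1 : `|cos a - 1| <= h ^+ 2 * n%:R ^+ 2.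
  rewrite (le_trans (norm_cos1_le a)) // exprMn ler_wpM2l ?sqr_ge0 //.
  by rewrite -(real_normK (num_real l)) ler_pXn2r ?nnegrE.
have e2 : `|sin a - a| <= h ^+ 2 * n%:R ^+ 3.
  rewrite (le_trans (norm_sinB_le a)) // normrM exprMn ler_pM ?exprn_ge0 //.
    by rewrite exprS real_normK ?num_real // ler_piMl ?sqr_ge0.
  by rewrite ler_pXn2r ?nnegrE.
rewrite -[(cos a - 1) ^+ 2]real_normK ?num_real // -[(sin a - a) ^+ 2]real_normK ?num_real //.
have n1 := normr_ge0 (cos a - 1); have n2 := normr_ge0 (sin a - a).
rewrite mulrDr; nra.
Qed.

Lemma ugroup_sub_le h n x :
  nrm (ugroup h x - x) <= 2 * `|h| * nrm (lcut n x) + 2 * nrm (pcut n x - x).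
Proof.
have -> : ugroup h x - x = (ugroup h (pcut n x) - pcut n x) -
    ugroup h (pcut n x - x) + (pcut n x - x).
  rewrite (ugroupB HX HP) [- (ugroup h (pcut n x) - _)]opprB.
  by rewrite [RHS](AC ((2*2)*2) ((1*4)*(2*5)*(3*6))) /= subrr addNr !add0r.
have h1 := nrmD HX (ugroup h (pcut n x) - pcut n x - ugroup h (pcut n x - x)) (pcut n x - x).
have h2 := nrmB HX (ugroup h (pcut n x) - pcut n x) (ugroup h (pcut n x - x)).
have h3 := ugroup_pcut_le h n x.
by rewrite (nrm_ugroup HX HP) in h2; lra.
Qed.

(** ** The generator *)

Variables (dom : set X) (A : X -> X).
Hypothesis domE : forall x, dom x <-> (\int[spectral_measure ip P x]_l (l ^+ 2)%:E < +oo)%E.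
Hypothesis AE : forall x y, dom x -> dom y ->
  ip (A x) y = spectral_integral ip P (fun l => l%:C) x y.

Lemma cutoff_near (l : R) : \forall n \near \oo, \1_(cutoff n) l = 1 :> R.
Proof.
exists (Num.truncn `|l|).+1 => // n /= ln; rewrite indicE mem_set //.
apply/cutoffP; apply: ltW; have /andP[_ h] := truncn_itv (normr_ge0 l).
by rewrite (lt_le_trans h) // ler_nat.
Qed.

Lemma measurable_mul_cut (f : R -> R) n : measurable_fun setT f ->
  measurable_fun setT (fun l => (f l * \1_(cutoff n) l)%:E).
Proof.
move=> mf; apply/measurable_EFinP; apply: measurable_funM => //.
by apply: measurable_indic; exact: measurable_cutoff.
Qed.

Let bsq n : bmeas (fun l : R => l ^+ 2 * \1_(cutoff n) l).
Proof.
apply: bmeas_cut; first exact: exprn_measurable.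
by exists (n%:R ^+ 2) => l /cutoffP ln; rewrite normrX ler_pXn2r ?nnegrE.
Qed.

Lemma nrm_lcutE n x :
  (nrm (lcut n x) ^+ 2)%:E = (\int[smeas x]_l (l ^+ 2 * \1_(cutoff n) l)%:E)%E.
Proof.
rewrite (nrm_lcut HX HP) /sint /Rintegral fineK //.
by apply: integrable_fin_num => //; exact: bmeas_integrable.
Qed.

(** Monotone convergence. *)
Lemma nrm_lcut_cvg x :
  ((nrm (lcut n x) ^+ 2)%:E @[n --> \oo] --> \int[smeas x]_l (l ^+ 2)%:E)%E.
Proof.
under eq_fun do rewrite nrm_lcutE.
rewrite (_ : (fun l : R => (l ^+ 2)%:E) =
    fun l : R => limn (fun n => (l ^+ 2 * \1_(cutoff n) l)%:E)).
  apply: cvg_monotone_convergence => //.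
  - by move=> n; apply: measurable_mul_cut; exact: exprn_measurable.
  - by move=> n l _; rewrite lee_fin mulr_ge0 ?sqr_ge0 // indicE.
  - move=> l _ m n mn; rewrite lee_fin ler_wpM2l ?sqr_ge0 // !indicE ler_nat.
    case: (boolP (l \in cutoff m)) => // /set_mem lm.
    by rewrite mem_set //; exact: cutoff_subset lm.
apply/funext => l; apply/esym; apply: lim_near_cst => //.
by near=> n; congr (_ %:E); rewrite (_ : \1_ _ _ = 1) ?mulr1 //; near: n; exact: cutoff_near.
Unshelve. all: by end_near. Qed.

(** The domain is the set of the x with finite second spectral moment, which is the supremum
    of the squared norms of [lcut n x]. *)
Lemma dom_bounded x : dom x <-> exists C, forall n, nrm (lcut n x) <= C.
Proof.
split=> [/domE dx|[C xC]].
  have i0 : (0 <= \int[smeas x]_l (l ^+ 2)%:E)%E.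
    by apply: integral_ge0 => l _; rewrite lee_fin sqr_ge0.
  have ifin : (\int[smeas x]_l (l ^+ 2)%:E)%E \is a fin_num by rewrite ge0_fin_numE.
  exists (Num.sqrt (fine (\int[smeas x]_l (l ^+ 2)%:E)%E)) => n.
  rewrite -[nrm _](ger0_norm (nrm_ge0 _ _)) -sqrtr_sqr ler_sqrt ?fine_ge0 //.
  rewrite -lee_fin fineK // nrm_lcutE; apply: ge0_le_integral => //.
  - by move=> l _; rewrite lee_fin mulr_ge0 ?sqr_ge0 // indicE.
  - by apply: measurable_mul_cut; exact: exprn_measurable.
  - by apply/measurable_EFinP; exact: exprn_measurable.
  - by move=> l _; rewrite lee_fin ler_piMr ?sqr_ge0.
apply/domE; have h := @nrm_lcut_cvg x.
have := cvg_lim _ h => <- //; apply: (@le_lt_trans _ _ ((C ^+ 2)%:E)); last exact: ltry.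
apply: lime_le; first by apply/cvg_ex; eexists; exact: h.
apply: nearW => n; rewrite lee_fin ler_pXn2r ?nnegrE ?nrm_ge0 //.
by rewrite (le_trans (nrm_ge0 ip _) (xC 0%N)).
Qed.

Lemma lcutD n x y : lcut n (x + y) = lcut n x + lcut n y.
Proof. by apply: (fcalc_addv HX HP); exact: bmeas_lcut. Qed.

Lemma lcutB n x y : lcut n (x - y) = lcut n x - lcut n y.
Proof. by apply: (fcalc_subv HX HP); exact: bmeas_lcut. Qed.

Lemma lcutZ n (c : R[i]) x : lcut n (c *: x) = c *: lcut n x.
Proof. by apply: (fcalcZ HX HP); exact: bmeas_lcut. Qed.

Lemma domD x y : dom x -> dom y -> dom (x + y).
Proof.
move=> /dom_bounded[C xC] /dom_bounded[D yD]; apply/dom_bounded; exists (C + D) => n.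
by rewrite lcutD (le_trans (nrmD HX _ _)) // lerD.
Qed.

Lemma domN x : dom x -> dom (- x).
Proof.
move=> /dom_bounded[C xC]; apply/dom_bounded; exists C => n.
by rewrite -scaleN1r lcutZ scaleN1r (nrmN HX).
Qed.

Lemma domB x y : dom x -> dom y -> dom (x - y).
Proof. by move=> dx dy; apply: domD => //; exact: domN. Qed.

Lemma pcut_dom n x : dom (pcut n x).
Proof.
apply/dom_bounded; exists (n%:R * nrm x) => m.
rewrite (lcut_pcut HX HP) (le_trans (nrm_pm HX HP _ _)) ?lcut_le //.
  exact: measurable_cutoff.
Qed.

Lemma dom_integrable x : dom x -> (smeas x).-integrable setT (fun l : R => (1 + l ^+ 2)%:E).
Proof.
move=> /domE dx; under eq_fun do rewrite EFinD.
apply: integrableD => //.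
  exact: finite_measure_integrable_cst.
apply/integrableP; split; first by apply/measurable_EFinP; exact: exprn_measurable.
by under eq_integral => l _ do rewrite /= ger0_norm ?sqr_ge0 //.
Qed.

Lemma rip_lcut_cvg x : dom x ->
  (fun n => rip (lcut n x) x) @ \oo --> (\int[smeas x]_l l)%R.
Proof.
move=> dx; have gi := dom_integrable dx.
have bound (l : R) (c : R) : 0 <= c <= 1 -> `|l * c| <= 1 + l ^+ 2.
  move=> /andP[c0 c1]; rewrite normrM [`|c|]ger0_norm // (@le_trans _ _ `|l|) //.
    by rewrite ler_piMr.
  by rewrite -(real_normK (num_real l)); have := normr_ge0 l; nra.
have il : (smeas x).-integrable setT (fun l : R => l%:E).
  apply: le_integrable gi => //; first exact/measurable_EFinP.
  move=> l _; rewrite /= lee_fin [`|1 + _|]ger0_norm ?addr_ge0 ?sqr_ge0 //.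
  by have := bound l 1; rewrite mulr1 lexx ler01; apply.
have h : (\int[smeas x]_l (l * \1_(cutoff n) l)%:E @[n --> \oo] --> \int[smeas x]_l l%:E)%E.
  apply: (dominated_cvg measurableT _ _ _ gi) => //.
  - by move=> n; apply: measurable_mul_cut.
  - move=> l _; apply: cvg_near_cst; near=> n; congr (_ %:E).
    by rewrite (_ : \1_ _ _ = 1) ?mulr1 //; near: n; exact: cutoff_near.
  - move=> n l _; rewrite lee_fin bound // indicE.
    by case: (_ \in _); rewrite ?lexx ?ler01.
have ifin := integrable_fin_num measurableT il.
move: h; rewrite -(fineK ifin) => /fine_cvg; rewrite (_ : _ \o _ = fun n => rip (lcut n x) x); last
  first.
  by apply/funext => n; rewrite -(sint_fcalc HX HP) //; exact: bmeas_lcut.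
by rewrite /Rintegral.
Unshelve. all: by end_near. Qed.

(** The generator is the weak limit of the bounded operators [lcut n]. *)
Lemma rip_A_cvg x y : dom x -> dom y ->
  (fun n => rip (lcut n x) y) @ \oo --> rip (A x) y.
Proof.
move=> dx dy; have h1 := rip_lcut_cvg (domD dx dy); have h2 := rip_lcut_cvg (domB dx dy).
have -> : rip (A x) y = 4^-1 * ((\int[smeas (x + y)]_l l) - (\int[smeas (x - y)]_l l)).
  rewrite /rip AE // /spectral_integral.
  have cint z : complex_integral (spectral_measure ip P z) setT (fun l => l%:C) =
      (\int[smeas z]_l l)%:C.
    apply: complex_ext => //=; transitivity (fine (\int[smeas z]_l cst 0%E l)%E) => //.
    by rewrite integral0.
  under eq_bigr do rewrite cint.
  have ii : (0 +i* 1) ^+ 2 = -1 :> R[i] by rewrite expr2; apply: complex_ext => /=; ring.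
  have -> : (4^-1 : R[i]) = (4^-1 : R)%:C by rewrite fmorphV rmorph_nat.
  have S4 (f : nat -> R[i]) : \sum_(k < 4) f k = f 0%N + f 1%N + f 2%N + f 3%N.
    by rewrite !big_ord_recr big_ord0 /= add0r.
  rewrite (S4 (fun k => (0 +i* 1) ^+ k * (\int[smeas (x + (0 +i* 1) ^+ k *: y)]_l l)%:C)).
  rewrite expr0 expr1 ii scale1r scaleN1r.
  have -> : (0 +i* 1) ^+ 3 = - (0 +i* 1) :> R[i] by rewrite exprS ii mulrN1.
  move: (\int[_]_l l) (\int[_]_l l) (\int[_]_l l) (\int[_]_l l) => a b c d.
  by rewrite !(ReM,ReD,ReN,ImM,ImD,ImN) /=; ring.
rewrite (_ : (fun n => _) = fun n => 4^-1 * (rip (lcut n (x + y)) (x + y) -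
    rip (lcut n (x - y)) (x - y))).
  by apply: cvgM; [exact: cvg_cst|exact: cvgB].
apply/funext => n; rewrite lcutD lcutB !(ripDl HX,ripDr HX,ripNl HX,ripNr HX).
by rewrite (rip_lcut HX HP n y x) (ripC HX y); field.
Qed.

Lemma pcut_A n x : dom x -> pcut n (A x) = lcut n x.
Proof.
move=> dx; apply: (rip_inj HX) => y; rewrite (rip_pm HP); last exact: measurable_cutoff.
have h := rip_A_cvg dx (pcut_dom n y).
apply: (real_cvg_unique h); apply: cvg_near_cst; exists n => // m /= nm.
transitivity (rip (pcut n (lcut m x)) y); last by rewrite (pcut_lcut HX HP).
by rewrite (rip_pm HP) //; exact: measurable_cutoff.
Qed.

(** The working criterion for membership in the domain: it only involves bounded operators,
    hence commutes with integrals and limits. *)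
Lemma lcut_dom x z : (forall n, lcut n x = pcut n z) -> dom x /\ A x = z.
Proof.
move=> xz; have dx : dom x.
  apply/dom_bounded; exists (nrm z) => n.
  by rewrite xz (nrm_pm HX HP) //; exact: measurable_cutoff.
split=> //; apply: (vcvg_unique HX (pcut_cvg HX HP (A x))).
by under eq_fun do rewrite pcut_A // xz; exact: (pcut_cvg HX HP).
Qed.

Lemma pcut_A2 n x : A (pcut n x) = lcut n x.
Proof.
by have [] := @lcut_dom (pcut n x) (lcut n x) (fun m => lcut_pcut HX HP m n x).
Qed.

Lemma A_sub x y : dom x -> dom y -> A (x - y) = A x - A y.
Proof.
move=> dx dy; have [|] // := @lcut_dom (x - y) (A x - A y).
by move=> n; rewrite lcutB -!pcut_A // (pcutB HP).
Qed.

Lemma A_sym x y : dom x -> dom y -> rip (A x) y = rip x (A y).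
Proof.
move=> dx dy; apply: (real_cvg_unique (rip_A_cvg dx dy)).
under eq_fun do rewrite (rip_lcut HX HP) (ripC HX).
by rewrite (ripC HX); exact: rip_A_cvg.
Qed.

Lemma AZ (c : R[i]) x : dom x -> A (c *: x) = c *: A x.
Proof.
move=> dx; have [|] // := @lcut_dom (c *: x) (c *: A x).
by move=> n; rewrite lcutZ -pcut_A // (pcutZ HP).
Qed.

Lemma domZ (c : R[i]) x : dom x -> dom (c *: x).
Proof.
move=> dx; have [|] // := @lcut_dom (c *: x) (c *: A x).
by move=> n; rewrite lcutZ -pcut_A // (pcutZ HP).
Qed.

Lemma A_add x y : dom x -> dom y -> A (x + y) = A x + A y.
Proof.
move=> dx dy; have [|] // := @lcut_dom (x + y) (A x + A y).
by move=> n; rewrite lcutD -!pcut_A // (pcutD HP).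
Qed.

Lemma A_ugroup t x : dom x -> dom (ugroup t x) /\ A (ugroup t x) = ugroup t (A x).
Proof.
move=> dx; apply: lcut_dom => n.
rewrite (lcut_ugroup HX HP).
by rewrite -pcut_A // !(pcutE HX HP) (fcalc_ugroup HX HP) //; exact: bmeas_pcut.
Qed.

(** ** Continuity and differentiability of the group *)

Lemma ugroup_cvg x (t : R) : vcvg ip (nbhs t) (fun s => ugroup s x) (ugroup t x).
Proof.
apply/(@cvgrPdist_le _ R^o) => e e0; have e2 : 0 < e / 4 by rewrite divr_gt0.
have /(@cvgrPdist_le _ R^o)/(_ _ e2)[n _ /(_ n (leqnn n))] := pcut_cvg HX HP x.
rewrite sub0r normrN ger0_norm ?nrm_ge0 // => hn.
have K0 : 0 < 4 * (1 + nrm (lcut n x)) by rewrite mulr_gt0 // ltr_pwDl ?nrm_ge0.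
near=> s; rewrite sub0r normrN ger0_norm ?nrm_ge0 //.
have -> : ugroup s x - ugroup t x = ugroup t (ugroup (s - t) x - x).
  by rewrite (ugroupB HX HP) (ugroup_comp HX HP) [t + _]addrC subrK.
rewrite (nrm_ugroup HX HP) (le_trans (ugroup_sub_le (s - t) n x)) //.
have st : `|t - s| <= e / (4 * (1 + nrm (lcut n x))).
  by near: s; apply: cvgr_dist_le => //; rewrite divr_gt0.
move: st; rewrite distrC ler_pdivlMr // => st.
by have := nrm_ge0 ip (lcut n x); have := normr_ge0 (s - t); nra.
Unshelve. all: by end_near. Qed.

Lemma ugroup_sub_A h x : dom x -> nrm (ugroup h x - x) <= 2 * `|h| * nrm (A x).
Proof.
move=> dx; apply: (@ler_cvg_to _ \oo _ _ (fun n => nrm (ugroup h (pcut n x) - pcut n x))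
  (fun n => 2 * `|h| * nrm (A x))) => //.
- apply: vcvg_nrm => //; apply: vcvgB => //; last exact: pcut_cvg.
  apply: (vcvg_lip (Y := ugroup h) (c := 1)); last exact: pcut_cvg.
  by move=> u v; rewrite -(ugroupB HX HP) (nrm_ugroup HX HP) mul1r.
- exact: cvg_cst.
- near=> n; rewrite (le_trans (ugroup_pcut_le _ _ _)) // ler_wpM2l ?mulr_ge0 //.
  by rewrite -pcut_A // (nrm_pm HX HP) //; exact: measurable_cutoff.
Unshelve. all: by end_near. Qed.

(** Split [x] at a large spectral cutoff: on the bounded part the expansion of
    the exponential is uniform, and the remainder is controlled by its image
    under the generator. *)
Lemma ugroup_derive0 x : dom x ->
  vcvg ip (0^') (fun h => h^-1%:C *: (ugroup h x - x)) (- 'i *: A x).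
Proof.
move=> dx; apply/(@cvgrPdist_le _ R^o) => e e0; have e4 : 0 < e / 8 by rewrite divr_gt0.
have /(@cvgrPdist_le _ R^o)/(_ _ e4)[n _ /(_ n (leqnn n))] := pcut_cvg HX HP (A x).
rewrite sub0r normrN ger0_norm ?nrm_ge0 // => hn.
set K : R := n%:R ^+ 2 + n%:R ^+ 3.
have K0 : 0 <= K by rewrite addr_ge0 ?exprn_ge0.
have KK : 0 < 2 * (1 + K * nrm x) by rewrite mulr_gt0 // ltr_pwDl ?mulr_ge0 ?nrm_ge0.
near=> h; rewrite sub0r normrN ger0_norm ?nrm_ge0 //.
have h0 : h != 0 by near: h; exact: nbhs_dnbhs_neq.
have h1 : `|h| <= 1.
  near: h; apply: nbhs_dnbhs; near=> h; rewrite -normrN -sub0r; near: h.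
  exact: cvgr_dist_le.
have he : `|h| <= e / (2 * (1 + K * nrm x)).
  near: h; apply: nbhs_dnbhs; near=> h; rewrite -normrN -sub0r; near: h.
  by apply: cvgr_dist_le => //; rewrite divr_gt0.
set p := pcut n x; pose r := x - p.
have dr : dom r by apply: domB => //; exact: pcut_dom.
have Ar : A r = A x - pcut n (A x) by rewrite A_sub ?pcut_A2 ?pcut_A //; exact: pcut_dom.
have -> : h^-1%:C *: (ugroup h x - x) - - 'i *: A x =
  h^-1%:C *: (ugroup h p - p + h%:C *: ('i *: lcut n x)) +
  (h^-1%:C *: (ugroup h r - r) + 'i *: A r).
  rewrite scaleNr opprK Ar pcut_A // [X in _ = X + _]scalerDr scalerA.
  rewrite -rmorphM mulVf // scale1r (ugroupB HX HP) /r [RHS]addrACA.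
  rewrite -[X in _ = X + _]scalerDr -[X in _ = _ + X]scalerDr.
  congr (_ *: _ + _ *: _); last by rewrite addrC subrK.
  by rewrite [- (x - p)]opprB [RHS](AC (2*(2*2)) ((1*4)*(5*2)*(3*6))) /= !subrr !add0r.
rewrite (le_trans (nrmD HX _ _)) // (nrmZr HX).
have b1 := ugroup_pcut_le2 n x h1.
have b2 := ugroup_sub_A h dr.
have b3 := nrmD HX (h^-1%:C *: (ugroup h r - r)) ('i *: A r).
have nAr : nrm (A r) <= e / 8 by rewrite Ar (nrmC HX).
rewrite (nrm_i HX) (nrmZr HX) in b3.
have h0' : 0 < `|h| by rewrite normr_gt0.
have {}b2 : `|h^-1| * nrm (ugroup h r - r) <= 2 * nrm (A r).
  by rewrite normfV ler_pdivrMl // mulrCA mulrA.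
have {}b1 : `|h^-1| * nrm (ugroup h p - p + h%:C *: ('i *: lcut n x)) <= `|h| * (K * nrm x).
  by rewrite normfV ler_pdivrMl // !mulrA -expr2 real_normK ?num_real.
rewrite ler_pdivlMr // in he.
have := nrm_ge0 ip x => nx.
have : `|h| * (K * nrm x) <= e / 2 by nra.
lra.
Unshelve. all: by end_near. Qed.

End SpectralResolution.

(** * Bochner integrals of continuous functions *)

Lemma real_integrableB d (T : measurableType d) (R : realType)
  (m : {measure set T -> \bar R}) (D : set T) (f g : T -> R) : measurable D ->
  m.-integrable D (EFin \o f) -> m.-integrable D (EFin \o g) ->
  m.-integrable D (EFin \o (fun x => f x - g x)).
Proof.
move=> mD fi gi; rewrite (_ : EFin \o _ = (EFin \o f) \- (EFin \o g))%E //.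
exact: integrableB.
Qed.

Lemma real_integrableD d (T : measurableType d) (R : realType)
  (m : {measure set T -> \bar R}) (D : set T) (f g : T -> R) : measurable D ->
  m.-integrable D (EFin \o f) -> m.-integrable D (EFin \o g) ->
  m.-integrable D (EFin \o (fun x => f x + g x)).
Proof.
move=> mD fi gi; rewrite (_ : EFin \o _ = (EFin \o f) \+ (EFin \o g))%E //.
exact: integrableD.
Qed.

Lemma real_integrableZl d (T : measurableType d) (R : realType)
  (m : {measure set T -> \bar R}) (D : set T) (k : R) (f : T -> R) : measurable D ->
  m.-integrable D (EFin \o f) -> m.-integrable D (EFin \o (fun x => k * f x)).
Proof.
move=> mD fi; rewrite (_ : EFin \o _ = fun x => (k%:E * (EFin \o f) x)%E) //.
exact: integrableZl.
Qed.

HB.lock Definition vint {R : realType} {X : lmodType R[i]} (ip : X -> X -> R[i])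
  (b : R) (f : R -> X) : X := bochner_integral (ip_norm ip) `]0, b[%classic f.

Section Bochner.
Context {R : realType} {X : lmodType R[i]}.
Variable ip : X -> X -> R[i].
Hypothesis HX : hilbert_space ip.
Implicit Types (x y z : X) (a b t r e : R) (u f : R -> X).

Local Notation nrm := (ip_norm ip).
Local Notation rip := (rip ip).
Local Notation leb := (@lebesgue_measure R).

Definition vcont b u : Prop :=
  forall t, t \in `[0, b] -> vcvg ip (within `[0, b]%classic (nbhs t)) u (u t).

Lemma is_C0P b u : is_C0 setT nrm b u <-> vcont b u.
Proof. by split=> [h t /h[]|h t /h]. Qed.

Lemma within_itv_proper b t : t \in `[0, b] -> ProperFilter (within `[0, b]%classic (nbhs t)).
Proof. by move=> tb; apply: within_nbhs_proper; exact: subset_closure. Qed.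

Lemma vcontP b u : vcont b u <-> forall t, t \in `[0, b] -> forall e, 0 < e ->
  exists2 d, 0 < d & forall r, r \in `[0, b] -> `|t - r| < d -> nrm (u r - u t) <= e.
Proof.
split=> [uc t tb e e0|uc t tb].
  have := uc t tb => /(@cvgrPdist_le _ R^o)/(_ e e0).
  rewrite near_withinE => /nbhs_ballP[d /= d0 h]; exists d => // r rb tr.
  by have := h r tr rb; rewrite sub0r normrN ger0_norm ?nrm_ge0.
apply/(@cvgrPdist_le _ R^o) => e e0; have [d d0 h] := uc t tb e e0.
rewrite near_withinE; apply/nbhs_ballP; exists d => // r tr rb.
by rewrite sub0r normrN ger0_norm ?nrm_ge0 // h.
Qed.

Lemma vcont_sub b c u : vcont b u -> c <= b -> vcont c u.
Proof.
move=> /vcontP uc cb; apply/vcontP => t; rewrite in_itv /= => /andP[t0 tc] e e0.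
have [|d d0 h] := uc t _ e e0; first by rewrite in_itv /= t0 (le_trans tc).
exists d => // r; rewrite in_itv /= => /andP[r0 rc]; apply: h.
by rewrite in_itv /= r0 (le_trans rc).
Qed.

Lemma real_cont_within b (g : R -> R) :
  (forall t, t \in `[0, b] -> g @ within `[0, b]%classic (nbhs t) --> g t) ->
  {within `[0, b], continuous g}.
Proof. by move=> gc; apply/subspace_continuousP. Qed.

Lemma vcont_rip b u v : vcont b u -> vcont b v ->
  {within `[0, b], continuous (fun r => rip (u r) (v r))}.
Proof.
move=> uc vc; apply: real_cont_within => t tb.
by have FF := within_itv_proper tb; apply: cvg_rip => //; [exact: uc|exact: vc].
Qed.

Lemma vcont_cst b y : vcont b (fun _ => y).
Proof. by move=> t tb; have FF := within_itv_proper tb; exact: vcvg_cst. Qed.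

Lemma vcont_nrm b u : vcont b u -> {within `[0, b], continuous (fun r => nrm (u r))}.
Proof.
move=> uc; apply: real_cont_within => t tb.
by have FF := within_itv_proper tb; apply: vcvg_nrm => //; exact: uc.
Qed.

Lemma cont_measurable b (g : R -> R) : {within `[0, b], continuous g} ->
  measurable_fun `]0, b[ g.
Proof.
move=> gc; apply: (measurable_funS (E := `[0, b]%classic)) => //.
  by apply: subset_itvW.
exact: subspace_continuous_measurable_fun.
Qed.

Lemma cont_integrable b (g : R -> R) : {within `[0, b], continuous g} ->
  leb.-integrable `]0, b[ (EFin \o g).
Proof.
move=> gc; apply: (@integrableS _ _ _ leb `[0, b]%classic) => //.
  by apply: subset_itvW.
by apply: continuous_compact_integrable => //; exact: segment_compact.
Qed.

Lemma leb_itv_fin b : (leb `]0%R, b[%classic < +oo)%E.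
Proof.
by rewrite lebesgue_measure_itv /=; case: ifP => _; rewrite ?ltry // -EFinB ltry.
Qed.

Lemma fine_leb_itv b : 0 <= b -> fine (leb `]0%R, b[%classic) = b.
Proof.
move=> b0; rewrite lebesgue_measure_itv /= lte_fin; case: ltP => [_|b0'] /=.
  by rewrite subr0.
by apply/eqP; rewrite eq_le b0 b0'.
Qed.

Lemma bounded_integrable b (g : R -> R) C : measurable_fun `]0, b[ g ->
  (forall r, r \in `]0, b[ -> `|g r| <= C) -> leb.-integrable `]0, b[ (EFin \o g).
Proof.
move=> mg gC; apply: measurable_bounded_integrable => //; first exact: leb_itv_fin.
exists C; split; first exact: num_real.
by move=> M CM r rb /=; rewrite (le_trans (gC r rb)) // ltW.
Qed.

(** ** Step functions *)

Lemma simple_fun_in (s : simple_function) (i0 : 'I_(simple_size s)) r :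
  simple_set i0 r -> (forall i, i != i0 -> ~ simple_set i r) ->
  simple_fun s r = simple_value i0 :> X.
Proof.
move=> s0 si; rewrite /simple_fun (bigD1 i0) //= big1 ?addr0 => [|i /si ni].
  by rewrite indicE mem_set // scale1r.
by rewrite indicE memNset // scale0r.
Qed.

(** A finite subcover of a cover by intervals on which [u] varies little, made
    disjoint, carries a step function close to [u]. *)
Lemma step_approx b u e : vcont b u -> 0 < e -> exists s : simple_function,
  simple_in setT s /\ forall r, r \in `[0, b] -> nrm (u r - simple_fun s r) <= e.
Proof.
move=> /vcontP uc e0.
have [d hd] : exists d : R -> R, forall t, t \in `[0, b] -> 0 < d t /\
    forall r, r \in `[0, b] -> `|t - r| < d t -> nrm (u r - u t) <= e.
  have h t : exists d, t \in `[0, b] -> 0 < d /\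
      forall r, r \in `[0, b] -> `|t - r| < d -> nrm (u r - u t) <= e.
    case: (boolP (t \in `[0, b])) => [tb|_]; last by exists 0.
    by have [d d0 hd] := uc t tb e e0; exists d.
  by exists (fun t => projT1 (cid (h t))) => t; exact: projT2 (cid (h t)).
pose B t := ball t (d t) : set R.
have : cover_compact (`[0, b]%classic : set R).
  by rewrite -compact_cover; exact: segment_compact.
move=> /(_ R `[0, b]%classic B)[|t tb|D Dsub cov].
- by move=> t tb; apply: ball_open; have [] := hd t tb.
- by exists t => //; apply: ballxx; have [] := hd t tb.
pose l : seq R := finmap.enum_fset D.
pose c (i : nat) : R := nth 0 l i.
pose S (i : 'I_(size l)) : set R :=
  `[0, b]%classic `&` B (c i) `\` \bigcup_(j in `I_i) B (c j).
have clb (i : 'I_(size l)) : c i \in `[0, b].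
  by have /Dsub := mem_nth 0 (ltn_ord i); rewrite inE.
exists (@SimpleFunction R X (size l) S (fun i => u (c i))); split=> [i|r rb].
  have mS : measurable (S i).
    apply: measurableD; first by apply: measurableI => //; exact: measurable_ball.
    by apply: bigcup_measurable => j _; exact: measurable_ball.
  split=> //; apply: (@le_lt_trans _ _ (leb `[0, b]%classic)).
    by apply: le_measure; rewrite ?inE //= => r [[]].
  by rewrite lebesgue_measure_itv /=; case: ifP => _; rewrite ?ltry // -EFinB ltry.
have ex : exists i, (i < size l)%N && `[< B (c i) r >].
  have [t tD Btr] := cov r rb; exists (index t l).
  by rewrite index_mem tD /c nth_index //; apply/asboolP.
case: (ex_minnP ex) => i /andP[il /asboolP Bi] imin.
set sf := (X in simple_fun X _).
rewrite (@simple_fun_in sf (Ordinal il)) /=.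
- by apply: (hd (c i) _).2 => //; exact: (clb (Ordinal il)).
- split=> // -[j /= ji Bj].
  by have := imin j; rewrite (ltn_trans ji il) asboolT // => /(_ isT); rewrite leqNgt ji.
- move=> j /eqP ji [[_ Bj] nB]; have [jl|lj|eij] := ltngtP j i.
  + by have := imin j; rewrite ltn_ord asboolT // => /(_ isT); rewrite leqNgt jl.
  + by apply: nB; exists i.
  + by apply: ji; apply: val_inj.
Qed.

(** ** Integrals of step functions *)

Lemma rip_simple_fun (s : simple_function) r y :
  rip (simple_fun s r) y = \sum_i \1_(@simple_set _ _ s i) r * rip (simple_value i) y.
Proof. by rewrite (rip_suml HX); apply: eq_bigr => i _; rewrite (ripZl HX). Qed.

Lemma measurable_rip_simple (s : simple_function) y b : simple_in setT s ->
  measurable_fun `]0, b[ (fun r => rip (simple_fun s r) y).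
Proof.
move=> ss; rewrite (_ : (fun r => _) =
    fun r => \sum_i \1_(@simple_set _ _ s i) r * rip (simple_value i) y); last first.
  by apply/funext => r; rewrite rip_simple_fun.
apply: measurable_sum => i; apply: measurable_funM => //.
by apply: measurable_indic; have [] := ss i.
Qed.

Lemma indicZ_integrable b (S : set R) c : measurable S ->
  leb.-integrable `]0, b[ (EFin \o (fun r => \1_S r * c)).
Proof.
move=> mS; apply: (@bounded_integrable _ _ `|c|).
  by apply: measurable_funM => //; exact: measurable_indic.
move=> r _; rewrite normrM ler_piMl // indicE.
by case: (r \in S); rewrite ?normr1 ?normr0.
Qed.

Lemma rip_simple_integral (s : simple_function) y b : simple_in setT s ->
  rip (simple_integral `]0, b[%classic s) y =
  \int[leb]_(r in `]0, b[) rip (simple_fun s r) y.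
Proof.
move=> ss; rewrite (rip_suml HX) /Rintegral.
transitivity (fine (\int[leb]_(r in `]0%R, b[)
    (\sum_i (\1_(@simple_set _ _ s i) r * rip (simple_value i) y)%:E))%E); last first.
  by congr fine; apply: eq_integral => r _; rewrite sumEFin rip_simple_fun.
have int_i i : leb.-integrable `]0, b[
    (EFin \o (fun r => \1_(@simple_set _ _ s i) r * rip (simple_value i) y)).
  by apply: indicZ_integrable; have [] := ss i.
rewrite integral_sum //= -sum_fine => [|i _]; last by apply: integrable_fin_num => //; exact: int_i.
apply: eq_bigr => i _; have [mS _ _] := ss i.
rewrite (ripZl HX); transitivity (\int[leb]_(r in `]0, b[)
  (\1_(@simple_set _ _ s i) r * rip (simple_value i) y)) => //.
rewrite RintegralZr //; last first.
  rewrite (_ : EFin \o _ = EFin \o (fun r => \1_(@simple_set _ _ s i) r * 1)).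
    exact: indicZ_integrable.
  by apply/funext => r /=; rewrite mulr1.
by congr (_ * _); rewrite /Rintegral integral_indic.
Qed.

(** Norms of differences are not visibly measurable functions of time; expanding the square
    leaves only real functions that are continuous or simple. *)
Lemma measurable_nrm_sub b f (s : simple_function) : vcont b f -> simple_in setT s ->
  measurable_fun `]0, b[ (fun r => nrm (f r - simple_fun s r)).
Proof.
move=> fc ss.
have msqrt : measurable_fun setT (Num.sqrt : R -> R).
  exact: (continuous_measurable_fun (@sqrt_continuous R)).
rewrite (_ : (fun r => _) = Num.sqrt \o (fun r => rip (f r - simple_fun s r)
    (f r - simple_fun s r))) //.
apply: measurableT_comp => //.
rewrite (_ : (fun r => _) = fun r => rip (f r) (f r) +
    ((- 2) * (\sum_i \1_(@simple_set _ _ s i) r * rip (f r) (simple_value i)) +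
     \sum_i \1_(@simple_set _ _ s i) r * rip (simple_fun s r) (simple_value i))).
  apply: measurable_funD; first by apply: cont_measurable; exact: vcont_rip.
  apply: measurable_funD.
    apply: measurable_funM => //; apply: measurable_sum => i; apply: measurable_funM.
      by apply: measurable_indic; have [] := ss i.
    by apply: cont_measurable; apply: vcont_rip => //; exact: vcont_cst.
  apply: measurable_sum => i; apply: measurable_funM.
    by apply: measurable_indic; have [] := ss i.
  exact: measurable_rip_simple.
apply/funext => r; rewrite -/(rip _ _) !(ripBl HX, ripBr HX).
have rs z : \sum_i \1_(@simple_set _ _ s i) r * rip z (simple_value i) = rip z (simple_fun s r).
  by rewrite (ripC HX) rip_simple_fun; apply: eq_bigr => i _; rewrite (ripC HX).
by rewrite !rs (ripC HX (simple_fun s r)); ring.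
Qed.

Lemma vcont_bounded b f : 0 <= b -> vcont b f ->
  exists C, forall r, r \in `[0, b] -> nrm (f r) <= C.
Proof.
move=> b0 /vcont_nrm fc; have [c _ cP] := EVT_max b0 fc.
by exists (nrm (f c)).
Qed.

Lemma itv_oo_cc (r b : R) : r \in `]0, b[ -> r \in `[0, b].
Proof. exact: subset_itvW. Qed.

Lemma nrm_sub_integrable b f (s : simple_function) : 0 <= b -> vcont b f -> simple_in setT s ->
  leb.-integrable `]0, b[ (EFin \o (fun r => nrm (f r - simple_fun s r))).
Proof.
move=> b0 fc ss; have [C fC] := vcont_bounded b0 fc.
apply: (@bounded_integrable _ _ (C + \sum_i nrm (@simple_value _ _ s i))).
  exact: measurable_nrm_sub.
move=> r /itv_oo_cc rb; rewrite ger0_norm ?nrm_ge0 // (le_trans (nrmB HX _ _)) //.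
rewrite lerD ?fC // (le_trans (nrm_sum HX _ _ _)) //; apply: ler_sum => i _.
rewrite (nrmZr HX) ler_piMl ?nrm_ge0 // indicE.
by case: (r \in _); rewrite ?normr1 ?normr0.
Qed.

Lemma simple_integral_close b f (s : simple_function) y : 0 <= b -> vcont b f -> simple_in setT s ->
  `|rip (simple_integral `]0, b[%classic s) y - \int[leb]_(r in `]0, b[) rip (f r) y| <=
  nrm y * \int[leb]_(r in `]0, b[) nrm (f r - simple_fun s r).
Proof.
move=> b0 fc ss; rewrite rip_simple_integral //.
have i1 : leb.-integrable `]0, b[ (EFin \o (fun r => rip (f r) y)).
  by apply: cont_integrable; apply: vcont_rip => //; exact: vcont_cst.
have i2 := nrm_sub_integrable b0 fc ss.
have i3 : leb.-integrable `]0, b[ (EFin \o (fun r => rip (simple_fun s r) y)).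
  apply: (@bounded_integrable _ _ (\sum_i `|rip (@simple_value _ _ s i) y|)).
    exact: measurable_rip_simple.
  move=> r _; rewrite rip_simple_fun (le_trans (ler_norm_sum _ _ _)) //.
  apply: ler_sum => i _; rewrite normrM ler_piMl // indicE.
  by case: (r \in _); rewrite ?normr1 ?normr0.
rewrite -RintegralB // (le_trans (le_normr_Rintegral _ _)) //.
  exact: real_integrableB.
rewrite -RintegralZl //; apply: le_Rintegral => //.
- by apply: integrable_norm => //; exact: real_integrableB.
- exact: real_integrableZl.
move=> r _; rewrite -(ripBl HX) (le_trans (cauchy_schwarz HX _ _)) // mulrC.
by rewrite (nrmC HX).
Qed.

(** ** Integrals of continuous functions *)

(** Tested against a vector, a Bochner integral is an ordinary one. This determines it, so that
    all computations with Bochner integrals below are made with real integrals. *)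
Lemma bochner_rip_eq b f z y : 0 <= b -> vcont b f ->
  is_bochner_integral nrm `]0, b[%classic f z ->
  rip z y = \int[leb]_(r in `]0, b[) rip (f r) y.
Proof.
move=> b0 fc [_ [s [ss s0 sz]]].
have h1 : (fun n => rip (simple_integral `]0, b[%classic (s n)) y) @ \oo --> rip z y.
  by apply: cvg_rip => //; exact: vcvg_cst.
apply: (real_cvg_unique h1).
have {}s0 : (fun n => \int[leb]_(r in `]0, b[) nrm (f r - simple_fun (s n) r)) @ \oo --> (0 : R).
  exact: fine_cvg s0.
apply/(@cvgrPdist_le _ R^o) => e e0.
have y0 : 0 < 1 + nrm y by rewrite ltr_pwDl ?nrm_ge0.
have ey : 0 < e / (1 + nrm y) by rewrite divr_gt0.
have /(@cvgrPdist_le _ R^o)/(_ _ ey) := s0; apply: filterS => n.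
rewrite sub0r normrN => /(le_trans (ler_norm _)); rewrite ler_pdivlMr // => hn.
rewrite distrC (le_trans (simple_integral_close y b0 fc (ss n))) //.
apply: le_trans hn; rewrite mulrC ler_wpM2l ?lerDr //.
by apply: Rintegral_ge0 => r _; exact: nrm_ge0.
Qed.

Lemma bochner_exists b f : 0 <= b -> vcont b f ->
  exists z, is_bochner_integral nrm `]0, b[%classic f z.
Proof.
move=> b0 fc.
have [s hs] : exists s : nat -> simple_function, forall n, simple_in setT (s n) /\
    forall r, r \in `[0, b] -> nrm (f r - simple_fun (s n) r) <= n.+1%:R^-1.
  have h n : exists s : simple_function, simple_in setT s /\
      forall r, r \in `[0, b] -> nrm (f r - simple_fun s r) <= n.+1%:R^-1.
    by apply: step_approx => //; rewrite invr_gt0.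
  by exists (fun n => projT1 (cid (h n))) => n; exact: projT2 (cid (h n)).
have inv0 := @cvg_inv_nat R.
have bi n : \int[leb]_(r in `]0, b[) nrm (f r - simple_fun (s n) r) <= b * n.+1%:R^-1.
  have [ss sb] := hs n.
  rewrite (@le_trans _ _ (\int[leb]_(r in `]0, b[) n.+1%:R^-1)) //.
    apply: le_Rintegral => //; first exact: nrm_sub_integrable.
      by apply: (@bounded_integrable _ (cst n.+1%:R^-1) `|n.+1%:R^-1|) => //.
    by move=> r /itv_oo_cc; exact: sb.
  by rewrite Rintegral_cst // fine_leb_itv // mulrC.
have [z sz] : exists z, vcvg ip \oo (fun n => simple_integral `]0, b[%classic (s n)) z.
  apply: (vcauchy_cvg HX (b := fun n => 2 * b * n.+1%:R^-1)).
    by rewrite -[0](mulr0 (2 * b)); apply: cvgM => //; exact: cvg_cst.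
  move=> m n mn; set d := _ - _; have [->|d0] := eqVneq (nrm d) 0.
    by rewrite !mulr_ge0.
  have dp : 0 < nrm d by rewrite lt0r d0 nrm_ge0.
  rewrite -(ler_pM2l dp) -expr2 (nrm2 HX) {1}/d (ripBl HX).
  have := simple_integral_close d b0 fc (hs m).1.
  have := simple_integral_close d b0 fc (hs n).1.
  rewrite !ler_norml => /andP[_ h1] /andP[h2 _].
  have h3 := bi m; have h4 := bi n.
  have h5 : n.+1%:R^-1 <= m.+1%:R^-1 :> R by rewrite lef_pV2 ?posrE // ler_nat.
  have h6 : b * n.+1%:R^-1 <= b * m.+1%:R^-1 by rewrite ler_wpM2l.
  have h7 := ler_wpM2l (ltW dp) (le_trans h4 h6); have h8 := ler_wpM2l (ltW dp) h3.
  rewrite lerNl in h2; have := lerD (le_trans h1 h7) (le_trans h2 h8).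
  rewrite opprB addrA subrK => /le_trans; apply.
  by rewrite le_eqVlt; apply/orP; left; apply/eqP; ring.
exists z; split.
  split; first exact: aeW.
  exists s; split; first by move=> n; exact: (hs n).1.
  apply: aeW => r rb; apply: (@squeeze_cvgr _ _ _ _ (cst 0) (fun n => n.+1%:R^-1)) => //.
    by apply: nearW => n; rewrite nrm_ge0 (hs n).2 //; exact: itv_oo_cc.
  exact: cvg_cst.
exists s; split => //; first by move=> n; exact: (hs n).1.
apply: cvg_EFin.
  apply: nearW => n; apply: integrable_fin_num => //.
  by apply: nrm_sub_integrable => //; exact: (hs n).1.
apply: (@squeeze_cvgr _ _ _ _ (cst 0) (fun n => b * n.+1%:R^-1)).
- apply: nearW => n; apply/andP; split; last exact: bi.
  by apply: fine_ge0; apply: integral_ge0 => r _; rewrite lee_fin nrm_ge0.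
- exact: cvg_cst.
- by rewrite -[0](mulr0 b); apply: cvgM => //; exact: cvg_cst.
Qed.

Lemma rip_vint b f y : 0 <= b -> vcont b f ->
  rip (vint ip b f) y = \int[leb]_(r in `]0, b[) rip (f r) y.
Proof.
move=> b0 fc; apply: bochner_rip_eq => //.
by rewrite unlock; exact: (xgetPex 0 (bochner_exists b0 fc)).
Qed.

End Bochner.

(** * Derivatives on a compact time interval *)

Section TimeDerivatives.
Context {R : realType} {X : lmodType R[i]}.
Variable ip : X -> X -> R[i].
Hypothesis HX : hilbert_space ip.
Variable T : R.
Hypothesis T_gt0 : 0 < T.
Implicit Types (x y z v : X) (s t r e : R) (u w g : R -> X).

Local Notation nrm := (ip_norm ip).
Local Notation rip := (rip ip).
Local Notation leb := (@lebesgue_measure R).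
Local Notation vcont := (vcont ip).
Local Notation vint := (vint ip).
Local Notation near0T t := (within (`[0, T]%classic `\ t) (nbhs t)).

Lemma near0T_proper t : t \in `[0, T] -> ProperFilter (near0T t).
Proof.
rewrite in_itv /= => /andP[t0 tT]; apply: Build_ProperFilter_ex => Q.
rewrite /within /= => /nbhs_ballP[d /= d0 dQ].
have [tT'|tT'] := ltP t T.
  pose m := Num.min (d / 2) (T - t).
  have m0 : 0 < m by rewrite lt_min divr_gt0 // subr_gt0.
  have md : m < d by rewrite gt_min ltr_pdivrMr // ltr_pMr // ltr1n.
  have mT : m <= T - t by rewrite ge_min lexx orbT.
  exists (t + m); apply: dQ.
    by rewrite /ball /= opprD addrA subrr sub0r normrN gtr0_norm.
  split; last by move=> /= /eqP; rewrite -subr_eq0 addrAC subrr add0r gt_eqF.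
  by rewrite /= in_itv /=; apply/andP; split; lra.
pose m := Num.min (d / 2) t.
have t1 : 0 < t by rewrite (lt_le_trans T_gt0).
have m0 : 0 < m by rewrite lt_min divr_gt0.
have md : m < d by rewrite gt_min ltr_pdivrMr // ltr_pMr // ltr1n.
have mT : m <= t by rewrite ge_min lexx orbT.
exists (t - m); apply: dQ.
  by rewrite /ball /= opprB addrCA subrr addr0 gtr0_norm.
split; last by move=> /= /eqP; rewrite -subr_eq0 addrAC subrr add0r oppr_eq0 gt_eqF.
by rewrite /= in_itv /=; apply/andP; split; lra.
Qed.

Lemma near0TP t (Q : R -> Prop) :
  (exists2 d, 0 < d & forall s, s \in `[0, T] -> s != t -> `|t - s| < d -> Q s) ->
  \forall s \near near0T t, Q s.
Proof.
move=> [d d0 dQ]; rewrite near_withinE; apply/nbhs_ballP; exists d => // s ts [sT st].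
by apply: dQ => //; apply/eqP => e; apply: st.
Qed.

Lemma near0T_id t : (fun s => s) @ near0T t --> t.
Proof. exact: cvg_within. Qed.

Lemma near0T_within t : near0T t `=>` within `[0, T]%classic (nbhs t).
Proof. by move=> Q; rewrite /within /=; apply: filterS => s h [? ?]; apply: h. Qed.

Lemma within_near0T u t l : t \in `[0, T] ->
  vcvg ip (near0T t) u l -> u t = l -> vcvg ip (within `[0, T]%classic (nbhs t)) u l.
Proof.
move=> tT ul utl; apply/(@cvgrPdist_le _ R^o) => e e0.
have /(@cvgrPdist_le _ R^o)/(_ e e0) := ul; rewrite !near_withinE.
apply: filterS => s h sT; have [->|/eqP st] := eqVneq s t; last exact: h.
by rewrite utl subrr nrm0 // subrr normr0 ltW.
Qed.

Local Notation tder u t v := (is_tderiv nrm T u t v).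

Lemma tderP u t v : tder u t v <->
  vcvg ip (near0T t) (fun s => (s - t)^-1%:C *: (u s - u t)) v.
Proof. by []. Qed.

Lemma tder_unique u t v v' : t \in `[0, T] -> tder u t v -> tder u t v' -> v = v'.
Proof. by move=> tT; have FF := near0T_proper tT; exact: vcvg_unique. Qed.

Lemma tderivE u t v : t \in `[0, T] -> tder u t v -> tderiv nrm T u t = v.
Proof. by move=> tT uv; apply: xget_unique => // v' /tder_unique; apply. Qed.

Lemma tderD u w t v v' : t \in `[0, T] -> tder u t v -> tder w t v' ->
  tder (fun s => u s + w s) t (v + v').
Proof.
move=> tT uv wv; have FF := near0T_proper tT; apply/tderP.
apply: vcvg_eq (vcvgD HX uv wv) => s.
by rewrite -scalerDr opprD addrACA.
Qed.

Lemma tder_cst x t : tder (fun=> x) t 0.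
Proof.
rewrite /is_tderiv; under eq_fun do rewrite subrr scaler0 subrr nrm0 //.
exact: cvg_cst.
Qed.

Lemma tder_lin (Y : X -> X) c u t v :
  (forall a x y, Y (a%:C *: x + y) = a%:C *: Y x + Y y) ->
  (forall x y, nrm (Y x - Y y) <= c * nrm (x - y)) ->
  t \in `[0, T] -> tder u t v -> tder (fun s => Y (u s)) t (Y v).
Proof.
move=> Yl Yc tT uv; have FF := near0T_proper tT; apply/tderP.
apply: vcvg_eq (vcvg_lip Yc uv) => s.
have Y0 : Y 0 = 0.
  by have := Yl 1 0 0; rewrite !scale1r addr0 => h; apply: (addIr (Y 0)); rewrite add0r -h.
have := Yl ((s - t)^-1) (u s - u t) 0; rewrite !addr0 Y0 addr0 => ->.
have := Yl (-1) (u t) (u s); rewrite rmorphN !scaleN1r addrC => ->.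
by rewrite [- _ + _]addrC.
Qed.

Lemma tder_cont u t v : t \in `[0, T] -> tder u t v ->
  vcvg ip (within `[0, T]%classic (nbhs t)) u (u t).
Proof.
move=> tT uv; have FF := near0T_proper tT; apply: within_near0T => //.
have h : vcvg ip (near0T t) (fun s => (s - t)%:C *: ((s - t)^-1%:C *: (u s - u t)) + u t)
    ((t - t)%:C *: v + u t).
  apply: (vcvgD HX); last exact: vcvg_cst.
  by apply: vcvgZ => //; apply: cvgB; [exact: near0T_id|exact: cvg_cst].
move: h; rewrite subrr scale0r add0r; apply: cvg_trans; apply: near_eq_cvg.
apply: near0TP; exists 1 => // s _ st _.
by rewrite scalerA -rmorphM divff ?subr_eq0 // scale1r subrK.
Qed.

Lemma vcont_tder u : (forall t, t \in `[0, T] -> exists v, tder u t v) -> vcont T u.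
Proof. by move=> ud t tT; have [v uv] := ud t tT; exact: tder_cont uv. Qed.

(** Inside the interval, the one-sided restriction on the difference quotients
    is void. *)
Lemma tder_is_derive u w t v v' : t \in `]0, T[ -> tder u t v -> tder w t v' ->
  is_derive t 1 (fun r => rip (u r) (w r)) (rip v (w t) + rip (u t) v').
Proof.
move=> tT uv wv; have tT' := itv_oo_cc tT; have FF := near0T_proper tT'.
have wt : vcvg ip (near0T t) w (w t) by apply: cvg_trans (tder_cont tT' wv); apply: cvg_app; exact:
  near0T_within.
have h : (fun s => rip ((s - t)^-1%:C *: (u s - u t)) (w s) +
    rip (u t) ((s - t)^-1%:C *: (w s - w t))) @ near0T t --> rip v (w t) + rip (u t) v'.
  by apply: cvgD; apply: cvg_rip => //; exact: vcvg_cst.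
have {}h : (fun h => h^-1 *: (rip (u (h *: 1 + t)) (w (h *: 1 + t)) - rip (u t) (w t))) @ 0^' -->
    rip v (w t) + rip (u t) v'.
  have shift : (fun h => h *: 1 + t) @ 0^' `=>` near0T t.
    move=> Q; rewrite /within /= => /nbhs_ballP[d /= d0 dQ].
    have [t0 tT0] : 0 < t /\ t < T by move: tT; rewrite in_itv /= => /andP.
    pose m := Num.min d (Num.min t (T - t)).
    have m0 : 0 < m by rewrite !lt_min d0 t0 subr_gt0.
    apply/nbhs_ballP; exists m => // k; rewrite /ball /= sub0r normrN => hm k0.
    rewrite /= [k *: 1]mulr1; move: hm; rewrite !lt_min => /and3P[hd ht hT].
    apply: dQ; first by rewrite /ball /= opprD addrCA subrr addr0 normrN.
    split; last by move=> /= /eqP; rewrite -subr_eq0 addrK; apply/negP.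
    move: ht hT; rewrite !ltr_norml => /andP[h1 h2] /andP[h3 h4].
    by rewrite /= in_itv /=; apply/andP; split; lra.
  have := cvg_trans (cvg_app _ shift) h; apply: cvg_trans; apply: near_eq_cvg.
  near=> k; rewrite /= [k *: 1]mulr1 addrK (ripZl HX) (ripZr HX) (ripBl HX) (ripBr HX).
  by rewrite -mulrDr addrA subrK.
split; first by apply/cvg_ex; eexists; exact: h.
by apply: cvg_lim.
Unshelve. all: by end_near. Qed.

Lemma real_zero_derive (f : R -> R) t : t \in `[0, T] -> {within `[0, T], continuous f} ->
  (forall s, s \in `]0, T[ -> is_derive s 1 f 0) -> f t = f 0.
Proof.
rewrite in_itv /= => /andP[t0 tT] fc fd.
have fc' : {within `[0, t], continuous f}.
  apply: continuous_subspaceW fc => s /=; rewrite !in_itv /= => /andP[-> st].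
  exact: le_trans tT.
have fd' s : s \in `]0, t[ -> is_derive s 1 f ((fun=> 0) s).
  rewrite in_itv /= => /andP[s0 st]; apply: fd.
  by rewrite in_itv /= s0 (lt_le_trans st).
by have [c _] := MVT_segment t0 fd' fc'; rewrite mul0r => /subr0_eq.
Qed.

Lemma tder0_const u t : t \in `[0, T] -> vcont T u ->
  (forall s, s \in `]0, T[ -> tder u s 0) -> u t = u 0.
Proof.
move=> tT uc ud; apply: (rip_inj HX) => y.
apply: (real_zero_derive (f := fun r => rip (u r) y)) => //.
  by apply: vcont_rip => //; exact: vcont_cst.
move=> s sT; have := tder_is_derive sT (ud s sT) (tder_cst y s).
by rewrite (rip0l HX) (rip0r HX) addr0.
Qed.

(** ** Primitives *)

(** Mean value inequality, obtained by testing with the left-hand side itself. *)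
Lemma vint_close g c M s t : vcont T g -> 0 <= s -> s < t -> t <= T ->
  (forall r, r \in `]s, t[ -> nrm (g r - c) <= M) ->
  nrm (vint t g - vint s g - (t - s)%:C *: c) <= (t - s) * M.
Proof.
move=> gc s0 st tT gM.
have t0 : 0 <= t by rewrite (le_trans s0) // ltW.
have gct := vcont_sub gc tT; have gcs := vcont_sub gct (ltW st).
have ts0 : 0 < t - s by rewrite subr_gt0.
suff key d : rip (vint t g - vint s g - (t - s)%:C *: c) d <= nrm d * ((t - s) * M).
  have [->|d0] := eqVneq (nrm (vint t g - vint s g - (t - s)%:C *: c)) 0.
    rewrite mulr_ge0 ?(ltW ts0) //; apply: le_trans (gM ((s + t) / 2) _).
      exact: nrm_ge0.
    by rewrite in_itv /=; apply/andP; split; lra.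
  have dp : 0 < nrm (vint t g - vint s g - (t - s)%:C *: c) by rewrite lt0r d0 nrm_ge0.
  by rewrite -(ler_pM2l dp) -expr2 (nrm2 HX) key.
have -> : rip (vint t g - vint s g - (t - s)%:C *: c) d =
    \int[leb]_(r in `]0, t[) rip (g r) d - \int[leb]_(r in `]0, s[) rip (g r) d - (t - s) * rip c d.
  rewrite !(ripBl HX) (ripZl HX).
  congr (_ - _ - _).
    exact: (rip_vint HX d t0 gct).
  exact: (rip_vint HX d s0 gcs).
have gd : {within `[0, t], continuous (fun r => rip (g r) d)}.
  by apply: vcont_rip => //; exact: vcont_cst.
have gi := cont_integrable gd.
have gis : leb.-integrable `]0, s] (EFin \o (fun r => rip (g r) d)).
  apply: (@integrableS _ _ _ leb `]0, t[%classic) => //.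
  by apply: subset_itvl; rewrite bnd_simp.
have gi' : leb.-integrable `]s, t[ (EFin \o (fun r => rip (g r) d)).
  apply: (@integrableS _ _ _ leb `]0, t[%classic) => //.
  by apply: subset_itvr; rewrite bnd_simp.
rewrite (@Rintegral_itv_bndo_bndc _ (BRight 0) s); last first.
  apply: (@integrableS _ _ _ leb `]0, s]%classic) => //.
  by apply: subset_itvl; rewrite bnd_simp.
rewrite Rintegral_itvB ?bnd_simp //.
have lts : fine (leb `]s, t[%classic) = t - s.
  by rewrite lebesgue_measure_itv /= lte_fin st.
have ltsy : (leb `]s, t[%classic < +oo)%E.
  by rewrite lebesgue_measure_itv /= lte_fin st -EFinB ltry.
have ci k : leb.-integrable `]s, t[ (EFin \o cst k).
  apply: measurable_bounded_integrable; [by []|exact: ltsy|by []|].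
  exact: bounded_cst.
have -> : (t - s) * rip c d = \int[leb]_(r in `]s, t[) rip c d.
  by rewrite Rintegral_cst // lts mulrC.
rewrite -RintegralB //; last exact: ci.
have -> : nrm d * ((t - s) * M) = \int[leb]_(r in `]s, t[) (nrm d * M).
  by rewrite Rintegral_cst // lts; ring.
apply: le_Rintegral => //; [apply: real_integrableB => //; exact: ci|exact: ci|].
move=> r rst; rewrite -(ripBl HX) (le_trans (rip_le HX _ _)) // mulrC.
by rewrite ler_wpM2l ?nrm_ge0 // gM.
Qed.

Lemma vint_tder g t : vcont T g -> t \in `[0, T] -> tder (vint ^~ g) t (g t).
Proof.
move=> gc tT; have FF := near0T_proper tT; apply/(@cvgrPdist_le _ R^o) => e e0.
have /vcontP/(_ t tT e e0)[d d0 hd] := gc.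
apply: near0TP; exists d => // s sT st tsd.
rewrite sub0r normrN ger0_norm ?nrm_ge0 //.
have ne : s - t != 0 by rewrite subr_eq0.
have -> : (s - t)^-1%:C *: (vint s g - vint t g) - g t =
    (s - t)^-1%:C *: (vint s g - vint t g - (s - t)%:C *: g t).
  by rewrite [RHS]scalerBr scalerA -rmorphM mulVf // scale1r.
rewrite (nrmZr HX) normfV ler_pdivrMl ?normr_gt0 //.
move: (tT) (sT); rewrite !in_itv /= => /andP[t0 tT'] /andP[s0 sT'].
have [st'|ts|es] := ltgtP s t; last by rewrite es eqxx in st.
- have := @vint_close g (g t) e s t gc s0 st' tT'; rewrite distrC gtr0_norm ?subr_gt0 //.
  have -> : vint s g - vint t g - (s - t)%:C *: g t = - (vint t g - vint s g - (t - s)%:C *: g t).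
    by rewrite !opprB -[s - t]opprB rmorphN scaleNr opprK addrC.
  rewrite (nrmN HX); apply => r; rewrite in_itv /= => /andP[sr rt].
  apply: hd; first by rewrite in_itv /=; apply/andP; split; lra.
  by move: tsd; rewrite !gtr0_norm ?subr_gt0 //; lra.
- have := @vint_close g (g t) e t s gc t0 ts sT'; rewrite gtr0_norm ?subr_gt0 //.
  apply => r; rewrite in_itv /= => /andP[tr rs].
  apply: hd; first by rewrite in_itv /=; apply/andP; split; lra.
  by move: tsd; rewrite !ltr0_norm ?subr_lt0 //; lra.
Qed.

Lemma vint0 g : vcont T g -> vint 0 g = 0.
Proof.
move=> gc; apply: (rip_inj HX) => y; rewrite rip_vint ?(rip0l HX) //.
  by rewrite set_itv_ge ?Rintegral_set0 // bnd_simp ltxx.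
exact: vcont_sub (ltW T_gt0).
Qed.

Lemma vcont_vint g : vcont T g -> vcont T (vint ^~ g).
Proof. by move=> gc; apply: vcont_tder => t tT; exists (g t); exact: vint_tder. Qed.

End TimeDerivatives.

(** * The abstract inhomogeneous evolution equation *)

Section Evolution.
Context {R : realType} {X : lmodType R[i]}.
Variable ip : X -> X -> R[i].
Variable P : set R -> X -> X.
Hypothesis HX : hilbert_space ip.
Hypothesis HP : projection_measure ip P.
Variables (dom : set X) (A : X -> X).
Hypothesis domE : forall x, dom x <-> (\int[spectral_measure ip P x]_l (l ^+ 2)%:E < +oo)%E.
Hypothesis AE : forall x y, dom x -> dom y ->
  ip (A x) y = spectral_integral ip P (fun l => l%:C) x y.
Variable T : R.
Hypothesis T_gt0 : 0 < T.
Implicit Types (x y z v : X) (s t r e : R) (u w g : R -> X).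

Local Notation nrm := (ip_norm ip).
Local Notation rip := (rip ip).
Local Notation leb := (@lebesgue_measure R).
Local Notation vcont := (vcont ip).
Local Notation vint := (vint ip).
Local Notation near0T t := (within (`[0, T]%classic `\ t) (nbhs t)).
Local Notation tder u t v := (is_tderiv nrm T u t v).
Local Notation U := (ugroup ip P).
Local Notation pcut := (pcut P).
Local Notation lcut := (lcut ip P).

Lemma ugroup_joint_cvg {S : Type} {G : set_system S} {FG : ProperFilter G}
    (p : S -> R) (a : S -> X) t x : p @ G --> t -> vcvg ip G a x ->
  vcvg ip G (fun k => U (p k) (a k)) (U t x).
Proof.
move=> pt ax; apply: (vcvg_le (b := fun k => nrm (a k - x) + nrm (U (p k) x - U t x))).
  move=> k; rewrite (le_trans (nrm_triangle HX (U (p k) x) _ _)) // lerD2r.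
  by rewrite -(ugroupB HX HP) (nrm_ugroup HX HP).
rewrite -[0]addr0; apply: cvgD => //.
exact: (cvg_comp _ _ pt (ugroup_cvg HX HP x t)).
Qed.

Lemma vcont_ugroup (p : R -> R) u : continuous p -> vcont T u ->
  vcont T (fun s => U (p s) (u s)).
Proof.
move=> pc uc t tT; have FF := within_itv_proper tT.
apply: ugroup_joint_cvg; last exact: uc.
exact: cvg_within_filter (pc t).
Qed.

(** Product rule; the sign [c] serves both the group and its inverse. *)
Lemma tder_ugroup c u t v : c != 0 -> t \in `[0, T] -> tder u t v -> dom (u t) ->
  tder (fun s => U (c * s) (u s)) t (U (c * t) (c%:C *: (- 'i *: A (u t)) + v)).
Proof.
move=> c0 tT uv du; have FF := near0T_proper T_gt0 tT; apply/tderP.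
have shift : (fun s => c * (s - t)) @ near0T t --> 0^'.
  move=> Q /nbhs_ballP[d /= d0 dQ]; apply: near0TP.
  exists (d / `|c|); first by rewrite divr_gt0 ?normr_gt0.
  move=> s _ st; rewrite ltr_pdivlMr ?normr_gt0 // => ts; apply: dQ.
    by rewrite /ball /= sub0r normrN normrM mulrC distrC.
  by rewrite mulf_neq0 ?subr_eq0.
have h1 := cvg_comp _ _ shift (ugroup_derive0 HX HP domE AE du).
have h2 : vcvg ip (near0T t) (fun s => U (c * t)
    (c%:C *: ((c * (s - t))^-1%:C *: (U (c * (s - t)) (u t) - u t))))
    (U (c * t) (c%:C *: (- 'i *: A (u t)))).
  apply: (vcvg_lip (Y := fun x => U (c * t) (c%:C *: x)) (c := `|c|)) => //.
  by move=> x y; rewrite -(ugroupB HX HP) (nrm_ugroup HX HP) -scalerBr (nrmZr HX).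
have h3 : vcvg ip (near0T t) (fun s => U (c * s) ((s - t)^-1%:C *: (u s - u t))) (U (c * t) v).
  apply: ugroup_joint_cvg; last exact: uv.
  by apply: cvgM; [exact: cvg_cst|exact: near0T_id].
rewrite (ugroupD HX HP).
apply: (cvg_trans _ (vcvgD HX h2 h3)); apply: near_eq_cvg.
apply: near0TP; exists 1 => // s _ st _; congr nrm; congr (_ - _).
have st' : s - t != 0 by rewrite subr_eq0.
rewrite scalerA -rmorphM invfM mulrA divff // mul1r.
rewrite !(ugroupZ HX HP) -scalerDr (ugroupB HX HP) (ugroup_comp HX HP).
congr (_ *: _); rewrite mulrBr [c * t + _]addrC subrK (ugroupB HX HP).
by rewrite [LHS]addrC [LHS]addrA subrK.
Qed.

Lemma lcut_lip n x y : nrm (lcut n x - lcut n y) <= n%:R * nrm (x - y).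
Proof. by rewrite -(lcutB HX HP) (lcut_le HX HP). Qed.

Lemma pcut_lip n x y : nrm (pcut n x - pcut n y) <= 1 * nrm (x - y).
Proof.
by rewrite -(pcutB HP) mul1r (nrm_pm HX HP) //; exact: measurable_cutoff.
Qed.

Lemma vcont_lip (Y : X -> X) c u : (forall x y, nrm (Y x - Y y) <= c * nrm (x - y)) ->
  vcont T u -> vcont T (fun s => Y (u s)).
Proof.
move=> Yc uc t tT; have FF := within_itv_proper tT.
by apply: (vcvg_lip Yc); exact: uc.
Qed.

Lemma vcontD u w : vcont T u -> vcont T w -> vcont T (fun s => u s + w s).
Proof.
by move=> uc wc t tT; have FF := within_itv_proper tT; apply: (vcvgD HX); [exact: uc|exact: wc].
Qed.

Lemma vcontB u w : vcont T u -> vcont T w -> vcont T (fun s => u s - w s).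
Proof.
by move=> uc wc t tT; have FF := within_itv_proper tT; apply: (vcvgB HX); [exact: uc|exact: wc].
Qed.

(** The source transported to time 0. The group commutes with the generator and preserves
    norms, so that regularity questions may be studied there. *)
Definition back g s : X := U (- s) (g s).

Lemma vcont_back g : vcont T g -> vcont T (back g).
Proof. by move=> gc; apply: vcont_ugroup => //; exact: oppr_continuous. Qed.

(** ** Right-hand sides that are square integrable in the domain *)

(** The difference is supported in the spectral region between the two cutoffs. *)
Lemma lcut_pythagoras m n x : (m <= n)%N ->
  nrm (lcut n x - lcut m x) ^+ 2 = nrm (lcut n x) ^+ 2 - nrm (lcut m x) ^+ 2.
Proof.
move=> mn; rewrite !(nrm2 HX) !(ripBl HX, ripBr HX) (ripC HX (lcut m x) (lcut n x)).
suff -> : rip (lcut n x) (lcut m x) = rip (lcut m x) (lcut m x) by ring.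
have := pcut_lcut HX HP x mn; move: (lcut n x) => z <-.
rewrite (ripC HX); symmetry; apply: (rip_pm2 HP); exact: measurable_cutoff.
Qed.

(** Boundedness in n replaces square integrability of g with values in the domain, avoiding
    measurability in the graph norm. *)
Definition cut_energy g n : R := \int[leb]_(r in `]0, T[) (nrm (lcut n (g r)) ^+ 2).

Lemma cont_sqr u : vcont T u -> {within `[0, T], continuous (fun r => nrm (u r) ^+ 2)}.
Proof.
by move=> uc; rewrite (_ : (fun r => _) = fun r => rip (u r) (u r));
  [exact: vcont_rip|apply/funext => r; rewrite (nrm2 HX)].
Qed.

Lemma cut_energy_sub g m n : vcont T g -> (m <= n)%N ->
  \int[leb]_(r in `]0, T[) (nrm (lcut n (g r) - lcut m (g r)) ^+ 2) =
  cut_energy g n - cut_energy g m.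
Proof.
move=> gc mn; rewrite /cut_energy -RintegralB //.
- by apply: eq_Rintegral => r _; exact: lcut_pythagoras.
- by apply: cont_integrable; apply: cont_sqr; apply: vcont_lip gc; exact: lcut_lip.
- by apply: cont_integrable; apply: cont_sqr; apply: vcont_lip gc; exact: lcut_lip.
Qed.

Lemma Rintegral_itv_le t (f : R -> R) : 0 <= t -> t <= T -> (forall r, 0 <= f r) ->
  leb.-integrable `]0, T[ (EFin \o f) ->
  \int[leb]_(r in `]0, t[) f r <= \int[leb]_(r in `]0, T[) f r.
Proof.
move=> t0 tT f0 fi.
have st : (`]0, t[%classic : set R) `<=` `]0, T[%classic.
  by apply: subset_itvl; rewrite bnd_simp.
have fit : leb.-integrable `]0, t[ (EFin \o f) by exact: (@integrableS _ _ _ leb `]0, T[%classic).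
rewrite /Rintegral fine_le //; try exact: integrable_fin_num.
apply: ge0_subset_integral => //; first by have /integrableP[] := fi.
by move=> r _; rewrite lee_fin.
Qed.

(** Cauchy-Schwarz in time. By Pythagoras the bound is a difference of two terms of one
    bounded monotone sequence, uniformly in t. *)
Lemma lcut_vint_cauchy g m n t : vcont T g -> (m <= n)%N -> t \in `[0, T] ->
  nrm (lcut n (vint t (back g)) - lcut m (vint t (back g))) ^+ 2 <=
  T * (cut_energy g n - cut_energy g m).
Proof.
move=> gc mn tT; have bc := vcont_back gc.
have [t0 tT'] : 0 <= t /\ t <= T by move: tT; rewrite in_itv /= => /andP.
pose h r := lcut n (g r) - lcut m (g r).
have hc : vcont T h by apply: vcontB; apply: vcont_lip gc; exact: lcut_lip.
(* y will be the difference itself; the two terms are balanced by Young's inequality *)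
suff key y : rip (lcut n (vint t (back g)) - lcut m (vint t (back g))) y <=
    2^-1 * (T * (cut_energy g n - cut_energy g m)) + 2^-1 * nrm y ^+ 2.
  move: (lcut n _ - lcut m _) (cut_energy g n - cut_energy g m) key => D e key.
  by have := key D; rewrite (nrm2 HX); lra.
rewrite (ripBl HX) !(rip_lcut HX HP) -(ripBr HX).
rewrite (rip_vint HX _ t0 (vcont_sub bc tT')).
have hi : leb.-integrable `]0, T[ (EFin \o (fun r => nrm (h r) ^+ 2)).
  by apply: cont_integrable; exact: cont_sqr.
have hit : leb.-integrable `]0, t[ (EFin \o (fun r => nrm (h r) ^+ 2)).
  by apply: cont_integrable; apply: continuous_subspaceW (cont_sqr hc);
     apply: subset_itvl; rewrite bnd_simp.
have hit2 : leb.-integrable `]0, t[ (EFin \o (fun r => 2^-1 * T * nrm (h r) ^+ 2)).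
  exact: real_integrableZl.
have ci k : leb.-integrable `]0, t[ (EFin \o cst k).
  by apply: (@bounded_integrable _ _ _ `|k|).
apply: (@le_trans _ _ (\int[leb]_(r in `]0, t[)
    (2^-1 * T * nrm (h r) ^+ 2 + 2^-1 * T^-1 * nrm y ^+ 2))); last first.
  rewrite RintegralD //; last exact: ci.
  rewrite RintegralZl // Rintegral_cst // fine_leb_itv // lerD //.
    rewrite -mulrA ler_wpM2l // ler_wpM2l ?(ltW T_gt0) //.
    rewrite -(cut_energy_sub gc mn).
    by apply: Rintegral_itv_le => // r; rewrite sqr_ge0.
  have -> : 2^-1 * T^-1 * nrm y ^+ 2 * t = t / T * (2^-1 * nrm y ^+ 2) by ring.
  apply: ler_piMl; last by rewrite ler_pdivrMr // mul1r.
  by apply: mulr_ge0 => //; exact: sqr_ge0.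
apply: le_Rintegral => //.
- apply: cont_integrable; apply: vcont_rip => //; last exact: vcont_cst.
  exact: vcont_sub tT'.
- by apply: real_integrableD => //; exact: ci.
move=> r _.
have -> : rip (back g r) (lcut n y - lcut m y) = rip (U (- r) (h r)) y.
  rewrite (ugroupB HX HP) (ripBl HX) -!(lcut_ugroup HX HP) !(rip_lcut HX HP).
  by rewrite -(ripBr HX).
rewrite (le_trans (rip_le HX _ _)) // (nrm_ugroup HX HP).
have := sqr_ge0 (T * nrm (h r) - nrm y) => sq.
rewrite -(ler_pM2l T_gt0) mulrDr.
have -> : T * (2^-1 * T^-1 * nrm y ^+ 2) = 2^-1 * nrm y ^+ 2.
  by field; rewrite gt_eqF.
by nra.
Qed.

(** The truncated images of the integral under the generator converge uniformly in time, so
    that their limit Z is continuous, and Z is the image of the integral under the generator. *)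
Lemma square_integrable_generator g C : vcont T g -> (forall n, cut_energy g n <= C) ->
  exists2 Z, vcont T Z & forall n t, t \in `[0, T] ->
    lcut n (vint t (back g)) = pcut n (Z t).
Proof.
move=> gc gC; set W := fun t => vint t (back g).
have Wc : vcont T W by apply: (vcont_vint HX T_gt0); exact: vcont_back.
have nd : nondecreasing_seq (cut_energy g).
  move=> m n mn; rewrite -subr_ge0 -cut_energy_sub //.
  by apply: Rintegral_ge0 => r _; rewrite sqr_ge0.
have ub : has_ubound (range (cut_energy g)) by exists C => _ [n _ <-].
have cv := nondecreasing_cvgn nd ub; set L := sup _ in cv.
have leL n : cut_energy g n <= L by apply: ub_le_sup => //; exists n.
pose b n := Num.sqrt (T * (L - cut_energy g n)).
have b0 : b @ \oo --> (0 : R).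
  rewrite -(sqrtr0 R) /b; apply: (continuous_cvg _ (@sqrt_continuous R 0)).
  rewrite -[X in _ --> X](mulr0 T) -(subrr L).
  by apply: cvgM; [exact: cvg_cst|apply: cvgB => //; exact: cvg_cst].
have bW m n t : t \in `[0, T] -> (m <= n)%N -> nrm (lcut n (W t) - lcut m (W t)) <= b m.
  move=> tT mn; rewrite -[nrm _](ger0_norm (nrm_ge0 _ _)) -sqrtr_sqr ler_wsqrtr //.
  by rewrite (le_trans (lcut_vint_cauchy gc mn tT)) // ler_wpM2l ?(ltW T_gt0) // lerD2r.
have [Z hZ] : exists Z : R -> X, forall t, t \in `[0, T] -> vcvg ip \oo (fun n => lcut n (W t)) (Z t).
  have h t : exists z, t \in `[0, T] -> vcvg ip \oo (fun n => lcut n (W t)) z.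
    case: (boolP (t \in `[0, T])) => [tT|_]; last by exists 0.
    by have [z zP] := vcauchy_cvg HX b0 (fun m n => bW m n t tT); exists z.
  by exists (fun t => projT1 (cid (h t))) => t; exact: projT2 (cid (h t)).
have bZ m t : t \in `[0, T] -> nrm (Z t - lcut m (W t)) <= b m.
  move=> tT.
  apply: (@ler_cvg_to _ \oo _ _ (fun n => nrm (lcut n (W t) - lcut m (W t))) (fun=> b m)).
  - exact: (vcvg_nrm HX (vcvgB HX (hZ t tT) (vcvg_cst HX (lcut m (W t))))).
  - exact: cvg_cst.
  - by exists m => // n /= mn; exact: bW.
exists Z => [|n t tT].
  apply/vcontP => t tT e e0; have e3 : 0 < e / 3 by rewrite divr_gt0.
  have /(@cvgrPdist_le _ R^o)/(_ _ e3)[m _ /(_ m (leqnn m))] := b0.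
  rewrite sub0r normrN ger0_norm ?sqrtr_ge0 // => bm.
  have /vcontP/(_ t tT _ e3)[d d0 hd] := vcont_lip (lcut_lip m) Wc.
  exists d => // r rT tr.
  have h1 := bZ m t tT; have h2 := bZ m r rT; have h3 := hd r rT tr.
  have h4 := nrm_triangle HX (lcut m (W r)) (Z r) (Z t).
  have h5 := nrm_triangle HX (lcut m (W t)) (lcut m (W r)) (Z t).
  by rewrite (nrmC HX (lcut m (W t)) (Z t)) in h5; lra.
have h : vcvg ip \oo (fun m => pcut n (lcut m (W t))) (pcut n (Z t)).
  exact: (vcvg_lip (pcut_lip n) (hZ t tT)).
apply: (vcvg_unique HX (G := \oo) (u := fun m => pcut n (lcut m (W t)))) => //.
apply: cvg_near_cst; exists n => // m /= nm.
by rewrite (pcut_lcut HX HP) // subrr nrm0.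
Qed.

(** ** Continuously differentiable right-hand sides *)

(** Integration by parts:
    [i A \int_0^t U(-s) g(s) ds = U(-t) g(t) - g(0) - \int_0^t U(-s) g'(s) ds]
    holds below every spectral cutoff. *)
Lemma smooth_generator g g' : vcont T g' -> (forall t, t \in `[0, T] -> tder g t (g' t)) ->
  exists2 Z, vcont T Z & forall n t, t \in `[0, T] ->
    lcut n (vint t (back g)) = pcut n (Z t).
Proof.
move=> gc' gd; have gc : vcont T g by apply: (vcont_tder HX T_gt0) => t tT; exists (g' t); exact: gd.
have bc := vcont_back gc; have bc' := vcont_back gc'.
pose Z t := - 'i *: (back g t - g 0 - vint t (back g')).
have Zc : vcont T (fun t => back g t - g 0 - vint t (back g')).
  by apply: vcontB; [apply: vcontB => //; exact: vcont_cst|exact: (vcont_vint HX T_gt0)].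
exists Z => [|n t tT].
  apply: (vcont_lip (Y := fun x => - 'i *: x) (c := 1)) => // x y.
  by rewrite -scalerBr scaleNr (nrmN HX) (nrm_i HX) mul1r.
pose h s := 'i *: lcut n (vint s (back g)) - pcut n (back g s - g 0 - vint s (back g')).
have iL c x y : 'i *: (c *: x + y : X) = c *: ('i *: x) + 'i *: y.
  by rewrite scalerDr !scalerA mulrC.
have hd s : s \in `[0, T] -> tder h s 0.
  move=> sT.
  have d1 : tder (fun s => 'i *: lcut n (vint s (back g))) s ('i *: lcut n (back g s)).
    apply: (tder_lin T_gt0 (Y := fun x => 'i *: lcut n x) (c := n%:R)) => //.
    - by move=> c x y; rewrite (lcutD HX HP) (lcutZ HX HP) iL.
    - by move=> x y; rewrite -scalerBr (nrm_i HX) lcut_lip.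
    - exact: (vint_tder HX T_gt0).
  have d2 : tder (fun s => - pcut n (back g s)) s
      (- ('i *: lcut n (back g s)) - pcut n (back g' s)).
    have dp : tder (fun s => pcut n (g s)) s (pcut n (g' s)).
      apply: (tder_lin T_gt0 (c := 1)) => //; first by move=> c x y; rewrite (pcutD HP) (pcutZ HP).
      - exact: pcut_lip.
      - exact: gd.
    have N10 : (-1 : R) != 0 by rewrite oppr_eq0 oner_eq0.
    have := tder_ugroup N10 sT dp (pcut_dom HX HP domE n (g s)).
    rewrite (pcut_A2 HX HP domE AE) rmorphN scaleN1r scaleNr opprK !mulN1r.
    move=> H0; have := @tder_lin _ _ ip T T_gt0 (fun x => - x) 1 _ s _ _ _ sT H0.
    move: H0 => _; rewrite (ugroupD HX HP) opprD !(ugroupZ HX HP) -(lcut_ugroup HX HP).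
    have Uc x : U (- s) (pcut n x) = pcut n (U (- s) x).
      by rewrite !(pcutE HX HP) (fcalc_ugroup HX HP) //; exact: bmeas_pcut.
    rewrite Uc => H.
    have {}H : tder (fun s0 => - U (-1 * s0) (pcut n (g s0))) s
        (- ('i *: lcut n (U (- s) (g s))) - pcut n (U (- s) (g' s))).
      apply: H; first by move=> c x y; rewrite opprD scalerN.
      by move=> x y; rewrite -opprD (nrmN HX) mul1r.
    apply: cvg_trans H; apply: near_eq_cvg; apply: nearW => k.
    congr (nrm (_ *: (_ - _) - _)); rewrite mulN1r.
      by rewrite /back !(pcutE HX HP) (fcalc_ugroup HX HP) //; exact: bmeas_pcut.
    by rewrite /back !(pcutE HX HP) (fcalc_ugroup HX HP) //; exact: bmeas_pcut.
  have d3 : tder (fun s => pcut n (vint s (back g'))) s (pcut n (back g' s)).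
    apply: (tder_lin T_gt0 (c := 1)) => //; first by move=> c x y; rewrite (pcutD HP) (pcutZ HP).
    - exact: pcut_lip.
    - exact: (vint_tder HX T_gt0).
  have := tderD HX T_gt0 sT (tderD HX T_gt0 sT (tderD HX T_gt0 sT d1 d2) d3)
    (tder_cst HX T (pcut n (g 0)) s).
  (* the three derivatives cancel: h is constant *)
  have -> : 'i *: lcut n (back g s) + (- ('i *: lcut n (back g s)) - pcut n (back g' s)) +
      pcut n (back g' s) + 0 = 0 by rewrite addr0 addrA subrr add0r addNr.
  apply: cvg_trans; apply: near_eq_cvg; apply: nearW => k.
  have hE r : h r = 'i *: lcut n (vint r (back g)) - pcut n (back g r) +
      pcut n (vint r (back g')) + pcut n (g 0).
    rewrite /h !(pcutB HP) opprB [- (_ - pcut n (g 0))]opprB.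
    by rewrite [LHS](AC (1*(1*2)) (((1*4)*2)*3)).
  by rewrite !hE.
have hc : vcont T h by apply: (vcont_tder HX T_gt0) => s sT; exists 0; exact: hd.
have lcut0 : lcut n 0 = 0 by have := lcutZ HX HP n 0 0; rewrite !scale0r.
have pcut0 : pcut n 0 = 0 by have := pcutZ HP n 0 0; rewrite !scale0r.
have h0 : h 0 = 0.
  rewrite /h !(vint0 HX T_gt0) // lcut0 scaler0 subr0 /back oppr0 (ugroup0 HX HP).
  by rewrite subrr pcut0 subr0.
have := tder0_const HX T_gt0 tT hc (fun s sT => hd s (itv_oo_cc sT)).
rewrite h0 /h => /subr0_eq e; rewrite /Z (pcutZ HP) -e scalerA.
by rewrite (_ : - 'i * 'i = 1) ?scale1r //; apply: complex_ext => /=; ring.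
Qed.

(** ** Existence *)

(** The group law takes the factor depending on t out of the integral. *)
Lemma duhamel g t : vcont T g -> t \in `[0, T] ->
  bochner_integral nrm `]0, t[%classic (fun s => U (t - s) (g s)) = U t (vint t (back g)).
Proof.
move=> gc tT; have [t0 tT'] : 0 <= t /\ t <= T by move: tT; rewrite in_itv /= => /andP.
have bc := vcont_back gc.
have gt : vcont t (fun s => U (t - s) (g s)).
  apply: vcont_sub tT'; apply: vcont_ugroup => // s.
  by apply: cvgB; [exact: cvg_cst|exact: cvg_id].
apply: (rip_inj HX) => y; have e := rip_vint HX y t0 gt.
rewrite [in LHS]unlock in e; rewrite e.
rewrite (rip_ugroup HX HP) (rip_vint HX _ t0 (vcont_sub bc tT')).
apply: eq_Rintegral => r _; rewrite -(rip_ugroup HX HP) /back (ugroup_comp HX HP) //.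
Qed.

(** Where the integral term of Duhamel's formula, pulled back by the group, lies in
    the domain, the formula is a classical solution. *)
Lemma duhamel_solution x0 g Z : dom x0 -> vcont T g -> vcont T Z ->
  (forall n t, t \in `[0, T] -> lcut n (vint t (back g)) = pcut n (Z t)) ->
  let v t := U t x0 + U t (vint t (back g)) in
  (forall t, t \in `[0, T] -> dom (v t) /\ tder v t (- 'i *: A (v t) + g t)) /\
  vcont T (fun t => A (v t)).
Proof.
move=> dx0 gc Zc WZ v.
have WA t : t \in `[0, T] -> dom (vint t (back g)) /\ A (vint t (back g)) = Z t.
  by move=> tT; apply: (lcut_dom HX HP domE AE) => n; exact: WZ.
pose Y t := x0 + vint t (back g).
have vE t : v t = U t (Y t) by rewrite /v -(ugroupD HX HP).
have dY t : t \in `[0, T] -> dom (Y t).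
  by move=> tT; apply: (domD HX HP domE) => //; have [] := WA t tT.
have bc := vcont_back gc.
have YA t : t \in `[0, T] -> A (Y t) = A x0 + Z t.
  by move=> tT; have [dW <-] := WA t tT; rewrite (A_add HX HP domE AE).
have vA t : t \in `[0, T] -> dom (v t) /\ A (v t) = U t (A x0 + Z t).
  move=> tT; have [] := A_ugroup HX HP domE AE t (dY t tT).
  by rewrite -vE YA.
split=> [t tT|].
  have [dv Av] := vA t tT; split=> //.
  have tY : tder Y t (back g t).
    by have := tderD HX T_gt0 tT (tder_cst HX T x0 t) (vint_tder HX T_gt0 bc tT); rewrite add0r.
  have := tder_ugroup (oner_neq0 _) tT tY (dY t tT).
  rewrite mul1r scale1r (ugroupD HX HP) (ugroupZ HX HP) YA // -Av.
  rewrite /back (ugroup_comp HX HP) subrr (ugroup0 HX HP).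
  apply: cvg_trans; apply: near_eq_cvg; apply: nearW => k.
  by rewrite !vE !mul1r.
have hc : vcont T (fun t => U t (A x0 + Z t)).
  apply: (vcont_ugroup (p := fun t => t)); first by move=> k; exact: cvg_id.
  by apply: vcontD => //; exact: vcont_cst.
move=> t tT; rewrite (vA t tT).2; apply: cvg_trans (hc t tT); apply: near_eq_cvg.
by rewrite near_withinE; apply: nearW => r rT; rewrite (vA r rT).2.
Qed.

(** A source that is square integrable in the domain and one that is continuously
    differentiable are both admissible: in either case the generator maps the Duhamel
    integral, transported to time 0, to a continuous function. *)
Theorem evolution_exists x0 g1 g2 g2' C : dom x0 -> vcont T g1 -> vcont T g2' ->
  (forall n, cut_energy g1 n <= C) ->
  (forall t, t \in `[0, T] -> tder g2 t (g2' t)) ->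
  let v t := U t x0 + bochner_integral nrm `]0, t[%classic (fun s => U (t - s) (g1 s + g2 s)) in
  (forall t, t \in `[0, T] -> dom (v t) /\ tder v t (- 'i *: A (v t) + (g1 t + g2 t))) /\
  vcont T (fun t => A (v t)).
Proof.
move=> dx0 g1c g2c' g1C g2d v.
have g2c : vcont T g2 by apply: (vcont_tder HX T_gt0) => t tT; exists (g2' t); exact: g2d.
have gc := vcontD g1c g2c.
have [Z1 Z1c Z1P] := square_integrable_generator g1c g1C.
have [Z2 Z2c Z2P] := smooth_generator g2c' g2d.
have WD t : t \in `[0, T] -> vint t (back (fun s => g1 s + g2 s)) =
    vint t (back g1) + vint t (back g2).
  move=> tT; have [t0 tT'] : 0 <= t /\ t <= T by move: tT; rewrite in_itv /= => /andP.
  have b1 := vcont_sub (vcont_back g1c) tT'; have b2 := vcont_sub (vcont_back g2c) tT'.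
  have b12 := vcont_sub (vcont_back gc) tT'.
  apply: (rip_inj HX) => y; rewrite (ripDl HX) (rip_vint HX _ t0 b12).
  rewrite (rip_vint HX _ t0 b1) (rip_vint HX _ t0 b2) -RintegralD //.
  - by apply: eq_Rintegral => r _; rewrite /back (ugroupD HX HP) (ripDl HX).
  - by apply: cont_integrable; apply: vcont_rip => //; exact: vcont_cst.
  - by apply: cont_integrable; apply: vcont_rip => //; exact: vcont_cst.
have [|h1 h2] := @duhamel_solution x0 _ (fun t => Z1 t + Z2 t) dx0 gc (vcontD Z1c Z2c).
  by move=> n t tT; rewrite WD // (lcutD HX HP) Z1P // Z2P // (pcutD HP).
have vE t : t \in `[0, T] -> v t = U t x0 + U t (vint t (back (fun s => g1 s + g2 s))).
  by move=> tT; rewrite /v duhamel.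
split=> [t tT|t tT].
  rewrite vE //; have [dv tv] := h1 t tT; split=> //.
  apply: cvg_trans tv; apply: near_eq_cvg; apply: near0TP; exists 1 => // s sT _ _.
  by rewrite !vE.
rewrite vE //; apply: cvg_trans (h2 t tT); apply: near_eq_cvg.
by rewrite near_withinE; apply: nearW => r rT; rewrite vE.
Qed.

(** ** Uniqueness *)

(** The energy [nrm (w t) ^+ 2] of a solution of the homogeneous equation is
    constant, as the generator is symmetric. *)
Theorem evolution_unique w : vcont T w -> w 0 = 0 ->
  (forall t, t \in `]0, T[ -> dom (w t) /\ tder w t (- 'i *: A (w t))) ->
  forall t, t \in `[0, T] -> w t = 0.
Proof.
move=> wc w0 wd t tT.
have ec : {within `[0, T], continuous (fun r => rip (w r) (w r))} by exact: vcont_rip.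
have ed s : s \in `]0, T[ -> is_derive s 1 (fun r => rip (w r) (w r)) 0.
  move=> sT; have [dw tw] := wd s sT.
  have := tder_is_derive HX T_gt0 sT tw tw.
  suff -> : rip (- 'i *: A (w s)) (w s) + rip (w s) (- 'i *: A (w s)) = 0 by [].
  have s1 := A_sym HX HP domE AE dw (domZ HX HP domE AE 'i dw).
  rewrite (AZ HX HP domE AE) // (ripC HX (w s)) in s1.
  have s2 := ripiC HX (A (w s)) (w s).
  by rewrite (ripC HX (w s)) scaleNr (ripNl HX); lra.
have := real_zero_derive tT ec ed; rewrite w0 (rip0l HX) -(nrm2 HX).
by move=> /eqP; rewrite sqrf_eq0 => /eqP /(nrm_eq0 HX).
Qed.

End Evolution.

(** * Square integrable real functions *)

Section SquareIntegrable.
Context d (T : measurableType d) (R : realType) (mu : {measure set T -> \bar R}).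
Implicit Types f g h : T -> R.

Definition sqint f : Prop :=
  measurable_fun setT f /\ mu.-integrable setT (EFin \o (fun x => f x ^+ 2)).

Lemma Lfun2P f : f \in Lfun mu 2%:E <-> sqint f.
Proof.
split=> [Lf|[mf fi]].
  split; last exact: Lfun2_integrable_sqr.
  by move: Lf; rewrite inE => /andP[/[!inE]].
rewrite inE; apply/andP; split; first by rewrite inE.
rewrite inE /finite_norm unlock /=; apply: poweR_lty.
have /integrableP[_] := fi; congr (_ < _)%E; apply: eq_integral => x _ /=.
by rewrite powR_mulrn ?normr_ge0 // normrX.
Qed.

Lemma integrable_mul f g : sqint f -> sqint g ->
  mu.-integrable setT (EFin \o (fun x => f x * g x)).
Proof.
move=> [mf fi] [mg gi].
apply: le_integrable (real_integrableD measurableT fi gi) => //.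
  by apply/measurable_EFinP; exact: measurable_funM.
move=> x _ /=; rewrite lee_fin [`|_ + _|]ger0_norm ?addr_ge0 ?sqr_ge0 // ler_norml.
by have := sqr_ge0 (f x - g x); have := sqr_ge0 (f x + g x); nra.
Qed.

Lemma sqint_le c f g : measurable_fun setT f -> sqint g ->
  {ae mu, forall x, `|f x| <= c * `|g x|} -> sqint f.
Proof.
move=> mf [mg gi] fg; split=> //; have ci := real_integrableZl (c ^+ 2) measurableT gi.
have mf2 : measurable_fun setT (fun x => f x ^+ 2) by exact: measurable_funX.
apply/integrableP; split; first exact/measurable_EFinP.
have /integrableP[_] := ci; apply: le_lt_trans; apply: ae_ge0_le_integral => //.
- by apply: measurableT_comp => //; apply/measurable_EFinP.
- apply: measurableT_comp => //; apply/measurable_EFinP.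
  by apply: measurable_funM => //; exact: measurable_funX.
- move: fg; apply: filterS => x fgx _ /=.
  rewrite lee_fin [`|c ^+ 2 * _|]normrM !normrX -exprMn ler_pXn2r ?nnegrE ?mulr_ge0 //.
  by rewrite (le_trans fgx) // ler_wpM2r // ler_norm.
Qed.

Lemma sqintZ c f : sqint f -> sqint (fun x => c * f x).
Proof.
move=> Lf; have [mf _] := Lf; apply: (@sqint_le `|c| _ f) => //.
  exact: measurable_funM.
by apply: aeW => x; rewrite normrM.
Qed.

Lemma sqintD f g : sqint f -> sqint g -> sqint (fun x => f x + g x).
Proof.
move=> Lf Lg; have [mf fi] := Lf; have [mg gi] := Lg; split; first exact: measurable_funD.
rewrite (_ : (fun x => _) = fun x => f x ^+ 2 + (g x ^+ 2 + 2 * (f x * g x))).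
  do 2 apply: real_integrableD => //.
  by apply: real_integrableZl => //; exact: integrable_mul.
by apply/funext => x; ring.
Qed.

Lemma sqintB f g : sqint f -> sqint g -> sqint (fun x => f x - g x).
Proof.
move=> Lf Lg; rewrite (_ : (fun x => _) = fun x => f x + -1 * g x).
  by apply: sqintD => //; exact: sqintZ.
by apply/funext => x; rewrite mulN1r.
Qed.

Definition sqdist f g : R := \int[mu]_x (f x - g x) ^+ 2.

Lemma sqdist_ge0 f g : 0 <= sqdist f g.
Proof. by apply: Rintegral_ge0 => x _; rewrite sqr_ge0. Qed.

Lemma sqdistE f g : sqint f -> sqint g ->
  (sqdist f g)%:E = (\int[mu]_x ((f x - g x) ^+ 2)%:E)%E.
Proof.
move=> Lf Lg; rewrite /sqdist /Rintegral fineK //; apply: integrable_fin_num => //.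
by have [] := sqintB Lf Lg.
Qed.

Lemma limn_einf_le (u : nat -> \bar R) c : (\forall n \near \oo, (u n <= c)%E) ->
  (limn_einf u <= c)%E.
Proof.
move=> uc; rewrite limn_einf_lim; apply: lime_le; first exact: is_cvg_einfs.
move: uc; apply: filterS => n; apply: le_trans; apply: ereal_inf_lbound.
by exists n => /=.
Qed.

(** A sequence whose successive distances decrease geometrically converges almost
    everywhere: otherwise the series of the [4 ^+ k * (u k.+1 - u k) ^+ 2] would not
    have a finite integral. *)
Lemma fast_cauchy_ae_cvg (u : nat -> T -> R) : (forall n, sqint (u n)) ->
  (forall n, sqdist (u n.+1) (u n) <= 16^-1 ^+ n) ->
  {ae mu, forall x, cvgn (u ^~ x)}.
Proof.
move=> Lu du; pose h k x : \bar R := (4 ^+ k * (u k.+1 x - u k x) ^+ 2)%:E.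
have Ld k := sqintB (Lu k.+1) (Lu k).
have mh k : measurable_fun setT (h k).
  apply/measurable_EFinP; apply: measurable_funM => //; apply: measurable_funX.
  by have [] := Ld k.
have h0 k x : (0 <= h k x)%E by rewrite lee_fin mulr_ge0 ?sqr_ge0 // exprn_ge0.
have ih k : (\int[mu]_x h k x <= (2^-1 ^+ k)%:E)%E.
  rewrite /h; under eq_integral do rewrite EFinM.
  rewrite ge0_integralZl_EFin ?exprn_ge0 //; last 2 first.
  - by move=> x _; rewrite lee_fin sqr_ge0.
  - by apply/measurable_EFinP; apply: measurable_funX; have [] := Ld k.
  rewrite -sqdistE // -EFinM lee_fin.
  rewrite (@le_trans _ _ (4 ^+ k * 16^-1 ^+ k)) //.
    by rewrite ler_wpM2l ?exprn_ge0.
  rewrite -exprMn; apply: lerXn2r; rewrite ?nnegrE ?divr_ge0 ?invr_ge0 //.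
  by rewrite (_ : 4 / 16 = 4^-1 :> R); [rewrite lef_pV2 ?posrE // ler_nat|field].
have sum2 n : \sum_(0 <= k < n) (2^-1 : R) ^+ k <= 2.
  suff -> : \sum_(0 <= k < n) (2^-1 : R) ^+ k = 2 - 2 * 2^-1 ^+ n.
    by rewrite gerBl mulr_ge0 ?exprn_ge0.
  elim: n => [|n IH]; first by rewrite big_geq // expr0 mulr1 subrr.
  by rewrite big_nat_recr //= IH exprS; field.
pose H x := (\sum_(0 <= k <oo) h k x)%E.
have mH : measurable_fun setT H by apply: ge0_emeasurable_sum => // k x _ _.
have iH : (\int[mu]_x H x <= 2%:E)%E.
  rewrite integral_nneseries //; apply: lime_le.
    by apply: is_cvg_nneseries => k _ _; apply: integral_ge0 => x _.
  apply: nearW => n; apply: (@le_trans _ _ (\sum_(0 <= k < n) (2^-1 ^+ k)%:E)%E).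
    by apply: lee_sum => k _.
  by rewrite sumEFin lee_fin.
have H0 x : (0 <= H x)%E by apply: nneseries_ge0 => k _ _.
have intH : mu.-integrable setT H.
  apply/integrableP; split=> //; under eq_integral do rewrite gee0_abs //.
  by rewrite (le_lt_trans iH) ?ltry.
have := integrable_ae measurableT intH; apply: filterS => x /(_ I) Hx.
set M := fine (H x); have M0 : 0 <= M by rewrite fine_ge0.
have dM k : `|u k.+1 x - u k x| <= (M + 1) * 2^-1 ^+ k.
  have : (h k x <= M%:E)%E.
    rewrite fineK //; apply: le_trans (nneseries_lim_ge k.+1 (fun n _ _ => h0 n x)).
    by rewrite big_nat_recr //= leeDr // sume_ge0.
  rewrite lee_fin => hk.
  rewrite -(@ler_pXn2r _ 2) ?nnegrE ?mulr_ge0 ?exprn_ge0 ?addr_ge0 //.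
  rewrite real_normK ?num_real // exprMn.
  have p4 : 0 < (4 : R) ^+ k by rewrite exprn_gt0.
  rewrite -(ler_pM2l p4) (le_trans hk) //.
  have -> : 4 ^+ k * ((M + 1) ^+ 2 * (2^-1 ^+ k) ^+ 2) = (M + 1) ^+ 2.
    rewrite mulrCA exprAC -exprMn (_ : 4 * 2^-1 ^+ 2 = 1 :> R) ?expr1n ?mulr1 //.
    by field.
  by nra.
have -> : u ^~ x = (fun n => u 0%N x + series (telescope (u ^~ x)) n).
  by apply/funext => n; exact: eq_sum_telescope.
apply: is_cvgD; first exact: is_cvg_cst.
apply: normed_cvg; apply: (series_le_cvg (v_ := geometric (M + 1) 2^-1)).
- by move=> n /=.
- by move=> n; rewrite /geometric /= mulr_ge0 ?exprn_ge0 ?addr_ge0.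
- by move=> n; exact: dM.
- by apply: is_cvg_geometric_series; rewrite ger0_norm // invf_lt1 // ltr1n.
Qed.

(** Riesz-Fischer. The limit vanishes wherever all functions vanish, so that it has
    the support of the sequence. *)
Theorem sqint_complete (f : nat -> T -> R) : (forall n, sqint (f n)) ->
  (forall e : R, 0 < e -> exists n, forall k l, (n <= k)%N -> (n <= l)%N ->
    sqdist (f k) (f l) <= e) ->
  exists g, [/\ sqint g, forall x, (forall n, f n x = 0) -> g x = 0 &
    forall e : R, 0 < e -> exists n, forall k, (n <= k)%N -> sqdist (f k) g <= e].
Proof.
move=> Lf fC.
have [N NP] : exists N : nat -> nat, forall k i j, (N k <= i)%N -> (N k <= j)%N ->
    sqdist (f i) (f j) <= 16^-1 ^+ k.
  have h k : exists n, forall i j, (n <= i)%N -> (n <= j)%N -> sqdist (f i) (f j) <= 16^-1 ^+ k.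
    by apply: fC; rewrite exprn_gt0.
  by exists (fun k => projT1 (cid (h k))) => k; exact: projT2 (cid (h k)).
pose n_ k := (k + \max_(i < k.+1) N i)%N.
have nN k : (N k <= n_ k)%N.
  by rewrite /n_ (leq_trans _ (leq_addl _ _)) // (leq_bigmax (@ord_max k)).
have nS k : (n_ k <= n_ k.+1)%N.
  by rewrite /n_ leq_add ?leqnSn // [X in (_ <= X)%N]big_ord_recr /= leq_maxl.
have nk k : (k <= n_ k)%N by exact: leq_addr.
have cv := fast_cauchy_ae_cvg (fun k => Lf (n_ k))
  (fun k => NP k _ _ (leq_trans (nN k) (nS k)) (nN k)).
pose g x := fine (limn_esup (fun k => (f (n_ k) x)%:E)).
have mg : measurable_fun setT g.
  apply: (measurableT_comp (f := fine)); first exact: fine_measurable.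
  by apply: measurable_fun_limn_esup => k; apply/measurable_EFinP; have [] := Lf (n_ k).
have gcv : {ae mu, forall x, (fun k => f (n_ k) x) @ \oo --> g x}.
  move: cv; apply: filterS => x /cvg_ex[l xl].
  have xlE : (fun k => (f (n_ k) x)%:E) @ \oo --> l%:E by apply/cvg_EFin => //; exact: nearW.
  by rewrite /g (cvg_limn_einf_sup xlE).2.
have mfg n : measurable_fun setT (fun x => f n x - g x).
  by apply: measurable_funB => //; have [] := Lf n.
have fatou_le n e : (forall k, (n_ k >= n)%N -> sqdist (f n) (f (n_ k)) <= e) ->
    (\int[mu]_x ((f n x - g x) ^+ 2)%:E <= e%:E)%E.
  move=> ne; pose F k x := ((f n x - f (n_ k) x) ^+ 2)%:E.
  have mF k : measurable_fun setT (F k).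
    by apply/measurable_EFinP; apply: measurable_funX; have [] := sqintB (Lf n) (Lf (n_ k)).
  have -> : (\int[mu]_x ((f n x - g x) ^+ 2)%:E = \int[mu]_x limn_einf (F ^~ x))%E.
    apply: ae_eq_integral => //.
    - by apply/measurable_EFinP; exact: measurable_funX.
    - rewrite (_ : (fun x => _) = (fun x => - limn_esup (fun k => - F k x))%E).
        apply: measurableT_comp => //; apply: measurable_fun_limn_esup => k.
        exact: measurableT_comp.
      by apply/funext => x; rewrite -[LHS]oppeK -limn_esupN.
    - move: gcv; apply: filterS => x xg _; apply/esym.
      have h : (fun k => F k x) @ \oo --> ((f n x - g x) ^+ 2)%:E.
        apply/cvg_EFin; first exact: nearW.
        rewrite (_ : _ \o _ = fun k => (f n x - f (n_ k) x) * (f n x - f (n_ k) x)).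
          by rewrite expr2; apply: cvgM; apply: cvgB => //; exact: cvg_cst.
        by apply/funext => k /=; rewrite expr2.
      by rewrite (cvg_limn_einf_sup h).1.
  apply: (le_trans (fatou mu measurableT mF _)); first by move=> k x _; rewrite lee_fin sqr_ge0.
  apply: limn_einf_le; exists n => // k /= nk'.
  by rewrite -sqdistE // lee_fin ne // (leq_trans nk').
have fgL n e : (forall k, (n_ k >= n)%N -> sqdist (f n) (f (n_ k)) <= e) ->
    sqint (fun x => f n x - g x).
  move=> /fatou_le h; split=> //; apply/integrableP; split.
    by apply/measurable_EFinP; exact: measurable_funX.
  under eq_integral => x _ do rewrite /= ger0_norm ?sqr_ge0 //.
  by rewrite (le_lt_trans h) ?ltry.
have Lg : sqint g.
  have [n nP] := fC 1 ltr01.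
  have h := fgL n 1 (fun k nk' => nP _ _ (leqnn n) nk').
  rewrite (_ : g = fun x => f n x - (f n x - g x)); first exact: sqintB.
  by apply/funext => x; rewrite subKr.
exists g; split=> // [x fx|e e0].
  rewrite /g (_ : (fun k => _) = fun k => 0%:E) ?(cvg_limn_einf_sup (cvg_cst 0%:E)).2 //.
  by apply/funext => k; rewrite fx.
have [n nP] := fC e e0; exists n => k nk'.
rewrite -lee_fin sqdistE //; apply: fatou_le => j kj.
by apply: nP => //; exact: leq_trans kj.
Qed.

End SquareIntegrable.

(** * The Hilbert space of square integrable forms *)

Section ComplexIntegral.
Context d (T : measurableType d) (R : realType) (mu : {measure set T -> \bar R}).
Implicit Types f g : T -> R[i].

Definition cintegrable f : Prop :=
  mu.-integrable setT (EFin \o (fun x => Re (f x))) /\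
  mu.-integrable setT (EFin \o (fun x => Im (f x))).

Definition cint f : R[i] := complex_integral mu setT f.

Lemma cintE f : cint f = (\int[mu]_x Re (f x)) +i* (\int[mu]_x Im (f x)).
Proof. by []. Qed.

Lemma cintegrableD f g : cintegrable f -> cintegrable g -> cintegrable (fun x => f x + g x).
Proof.
move=> [rf jf] [rg jg]; split.
  by under eq_fun do rewrite ReD; exact: real_integrableD.
by under eq_fun do rewrite ImD; exact: real_integrableD.
Qed.

Lemma cintegrableZ (a : R[i]) f : cintegrable f -> cintegrable (fun x => a * f x).
Proof.
move=> [rf jf]; split.
  by under eq_fun do rewrite ReM; apply: real_integrableB => //; exact: real_integrableZl.
by under eq_fun do rewrite ImM; apply: real_integrableD => //; exact: real_integrableZl.
Qed.

Lemma cintD f g : cintegrable f -> cintegrable g ->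
  cint (fun x => f x + g x) = cint f + cint g.
Proof.
move=> [rf jf] [rg jg]; rewrite !cintE; apply: complex_ext; rewrite ?ReD ?ImD /=.
  by under eq_Rintegral do rewrite ReD; rewrite RintegralD.
by under eq_Rintegral do rewrite ImD; rewrite RintegralD.
Qed.

Lemma cintZ (a : R[i]) f : cintegrable f -> cint (fun x => a * f x) = a * cint f.
Proof.
move=> [rf jf]; rewrite !cintE; apply: complex_ext; rewrite ?ReM ?ImM /=.
  under eq_Rintegral do rewrite ReM.
  by rewrite RintegralB ?RintegralZl //; exact: real_integrableZl.
under eq_Rintegral do rewrite ImM.
by rewrite RintegralD ?RintegralZl //; exact: real_integrableZl.
Qed.

Lemma cint_conj f : cintegrable f -> cint (fun x => (f x)^*) = (cint f)^*.
Proof.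
move=> [rf jf]; rewrite !cintE; apply: complex_ext; rewrite ?ReJ ?ImJ /=.
  by under eq_Rintegral do rewrite ReJ.
under eq_Rintegral do rewrite ImJ -mulN1r.
by rewrite RintegralZl // mulN1r.
Qed.

Lemma Rintegral_ae (f g : T -> R) : measurable_fun setT f -> measurable_fun setT g ->
  {ae mu, forall x, f x = g x} -> \int[mu]_x f x = \int[mu]_x g x.
Proof.
move=> mf mg fg; rewrite /Rintegral; congr fine; apply: ae_eq_integral => //.
- exact/measurable_EFinP.
- exact/measurable_EFinP.
- by move: fg; apply: filterS => x -> _.
Qed.

Lemma cintegrable_measurable f : cintegrable f ->
  measurable_fun setT (fun x => Re (f x)) /\ measurable_fun setT (fun x => Im (f x)).
Proof.
by move=> [/integrableP[mr _] /integrableP[mi _]]; split; apply/measurable_EFinP.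
Qed.

Lemma cint_ae f g : cintegrable f -> cintegrable g -> {ae mu, forall x, f x = g x} ->
  cint f = cint g.
Proof.
move=> /cintegrable_measurable[mrf mif] /cintegrable_measurable[mrg mig] fg.
rewrite !cintE; congr (_ +i* _); apply: Rintegral_ae => //.
  by move: fg; apply: filterS => x ->.
by move: fg; apply: filterS => x ->.
Qed.

End ComplexIntegral.

Section L2Space.
Context {R : realType} {N : nat}.
Local Notation m := (@lebesgueN R N).
Local Notation T := (Rn R N).

(** The coefficient of v /\ * conj(w) with respect to the volume form. *)
Definition cpair (v w : Defs.form R N) (x : T) : R[i] := \sum_A v x A * (w x A)^*.

Definition sqform (v : Defs.form R N) : Prop := forall A,
  sqint m (fun x : T => Re (v x A)) /\ sqint m (fun x : T => Im (v x A)).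

Lemma l2P Omega q (v : Defs.form R N) : v \in l2_pred Omega q <->
  [/\ of_degree q v, forall x, ~ Omega x -> forall A, v x A = 0 & sqform v].
Proof.
split=> [/set_mem[dv ov rv iv]|[dv ov sv]].
  split; [exact: dv|exact: ov|move=> A]; have [h _] := Lfun2P m (fun x : T => Re (v x A)).
  have [h' _] := Lfun2P m (fun x : T => Im (v x A)).
  by split; [exact: h (rv A)|exact: h' (iv A)].
by rewrite inE; split=> // A; have [/Lfun2P ? /Lfun2P ?] := sv A.
Qed.

Lemma Rintegral_sum (I : finType) (f : I -> T -> R) :
  (forall i, m.-integrable setT (EFin \o f i)) ->
  \int[m]_x (\sum_i f i x) = \sum_i \int[m]_x f i x.
Proof.
move=> fi; have : forall s : seq I, m.-integrable setT (EFin \o (fun x => \sum_(i <- s) f i x)) /\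
    \int[m]_x (\sum_(i <- s) f i x) = \sum_(i <- s) \int[m]_x f i x.
  elim=> [|i s [ih1 ih2]].
    split; last by under eq_Rintegral do rewrite big_nil; rewrite big_nil Rintegral_cst // mul0r.
    under eq_fun do rewrite big_nil; exact: (integrable0 m).
  split; first by under eq_fun do rewrite big_cons; exact: real_integrableD.
  by under eq_Rintegral do rewrite big_cons; rewrite RintegralD // ih2 big_cons.
by move=> /(_ (index_enum I))[].
Qed.

Lemma cpair_integrable v w : sqform v -> sqform w -> cintegrable m (cpair v w).
Proof.
move=> sv sw; rewrite /cpair; split.
  rewrite (_ : EFin \o _ = fun x => (\sum_(A : {set 'I_N})
      (Re (v x A) * Re (w x A) + Im (v x A) * Im (w x A))%:E)%E).
    apply: integrable_sum => // A _; have [vr vi] := sv A; have [wr wi] := sw A.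
    by apply: real_integrableD => //; exact: integrable_mul.
  apply/funext => x /=; rewrite sumEFin Re_sum; congr EFin; apply: eq_bigr => A _.
  by rewrite ReM ReJ ImJ; ring.
rewrite (_ : EFin \o _ = fun x => (\sum_(A : {set 'I_N})
    (Im (v x A) * Re (w x A) - Re (v x A) * Im (w x A))%:E)%E).
  apply: integrable_sum => // A _; have [vr vi] := sv A; have [wr wi] := sw A.
  by apply: real_integrableB => //; exact: integrable_mul.
apply/funext => x /=; rewrite sumEFin Im_sum; congr EFin; apply: eq_bigr => A _.
by rewrite ImM ReJ ImJ; ring.
Qed.

Lemma form_pairingE (Omega : set 'rV[R]_N) (v w : Defs.form R N) :
  (forall x, ~ Omega x -> forall A, v x A = 0) -> form_pairing Omega v w = cint m (cpair v w).
Proof.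
move=> ov; rewrite /form_pairing /cint /complex_integral.
have c0 x : ~ Omega x -> cpair v w x = 0.
  by move=> ox; rewrite /cpair big1 // => A _; rewrite ov // mul0r.
congr (_ +i* _); rewrite [in LHS]integral_mkcond; congr fine; apply: eq_integral => x _.
  by rewrite patchE; case: ifPn => // /negP ox; rewrite -/(cpair v w x) c0 //;
    move=> h; apply: ox; rewrite inE.
by rewrite patchE; case: ifPn => // /negP ox; rewrite -/(cpair v w x) c0 //;
  move=> h; apply: ox; rewrite inE.
Qed.

Section Fixed.
Variables (Omega : set 'rV[R]_N) (q : nat).
Local Notation L2 := (L2 Omega q).
Implicit Types u v : L2.

Lemma L2_rep_l2 u : L2_rep u \in l2_pred Omega q.
Proof. exact: valP (repr u). Qed.

Lemma L2_rep_deg u : of_degree q (L2_rep u).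
Proof. by have /l2P[] := L2_rep_l2 u. Qed.

Lemma L2_rep_out u x : ~ Omega x -> forall A, L2_rep u x A = 0.
Proof. by have /l2P[_ h _] := L2_rep_l2 u; exact: h. Qed.

Lemma L2_rep_sq u : sqform (L2_rep u).
Proof. by have /l2P[] := L2_rep_l2 u. Qed.

Lemma pi_eqP (w w' : l2_form Omega q) : \pi_L2 w = \pi_L2 w' <->
  {ae m, forall x : T, forall A, l2_val w x A = l2_val w' x A}.
Proof.
have E : (\pi_L2 w == \pi_L2 w') = (w - w' \in @l2_null R N Omega q).
  by rewrite -[L2]/(Quotient.quot (@l2_null R N Omega q)) -Quotient.idealrBE.
split=> [/eqP|h].
  rewrite E inE /=; apply: filterS => x h A.
  by have := h A; rewrite !fctE => /subr0_eq.
apply/eqP; rewrite E inE /=; move: h; apply: filterS => x h A.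
by rewrite !fctE h subrr.
Qed.

Lemma L2_rep_pi (w : l2_form Omega q) :
  {ae m, forall x : T, forall A, L2_rep (\pi_L2 w) x A = l2_val w x A}.
Proof. by apply/pi_eqP; rewrite reprK. Qed.

Lemma L2_eqP u v : u = v <-> {ae m, forall x : T, forall A, L2_rep u x A = L2_rep v x A}.
Proof.
split=> [-> |h]; first exact: aeW.
by rewrite -[u]reprK -[v]reprK; apply/pi_eqP.
Qed.

Lemma L2_rep_lin (a : R[i]) u v : {ae m, forall x : T, forall A,
  L2_rep (a *: u + v) x A = a * L2_rep u x A + L2_rep v x A}.
Proof.
have -> : a *: u + v = \pi_L2 (a *: repr u + repr v).
  by rewrite L2_piD -[in LHS](reprK v) -[in LHS](reprK u) -L2_scale_pi.
by have := L2_rep_pi (a *: repr u + repr v); apply: filterS => x h A; rewrite h.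
Qed.

Lemma L2_rep0 : {ae m, forall x : T, forall A, L2_rep (0 : L2) x A = 0}.
Proof.
have := L2_rep_lin (-1) (0 : L2) 0; rewrite addr0 scaler0.
by apply: filterS => x h A; have := h A; rewrite mulN1r addNr.
Qed.

Lemma L2_ipE u v : L2_ip u v = cint m (cpair (L2_rep u) (L2_rep v)).
Proof. by rewrite /L2_ip form_pairingE // => x; exact: L2_rep_out. Qed.

Lemma cpair_conj (v w : Defs.form R N) x : cpair w v x = (cpair v w x)^*.
Proof.
rewrite /cpair rmorph_sum; apply: eq_bigr => A _.
by apply: complex_ext; rewrite !(ReM, ImM, ReJ, ImJ); ring.
Qed.

Lemma Re_cpair (v : Defs.form R N) x :
  Re (cpair v v x) = \sum_A (Re (v x A) ^+ 2 + Im (v x A) ^+ 2).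
Proof. by rewrite /cpair Re_sum; apply: eq_bigr => A _; rewrite ReM ReJ ImJ; ring. Qed.

Lemma Im_cpair (v : Defs.form R N) x : Im (cpair v v x) = 0.
Proof. by rewrite /cpair Im_sum big1 // => A _; rewrite ImM ReJ ImJ; ring. Qed.

Definition sqsum (v : Defs.form R N) : R := \sum_A
  (\int[m]_x (Re (v x A) ^+ 2) + \int[m]_x (Im (v x A) ^+ 2)).

Lemma Re_cint_cpair (v : Defs.form R N) : sqform v ->
  Re (cint m (cpair v v)) = sqsum v.
Proof.
move=> sv; rewrite cintE /=; under eq_Rintegral do rewrite Re_cpair.
rewrite Rintegral_sum; last first.
  by move=> A; have [[_ ?] [_ ?]] := sv A; exact: real_integrableD.
by apply: eq_bigr => A _; have [[_ ?] [_ ?]] := sv A; rewrite RintegralD.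
Qed.

Lemma L2_ip_lin (a : R[i]) u v w : L2_ip (a *: u + v) w = a * L2_ip u w + L2_ip v w.
Proof.
have iu (z z' : L2) : cintegrable m (cpair (L2_rep z) (L2_rep z')).
  exact: (cpair_integrable (L2_rep_sq z) (L2_rep_sq z')).
rewrite !L2_ipE -cintZ // -cintD //; last exact: cintegrableZ.
apply: cint_ae => //; first by apply: cintegrableD => //; exact: cintegrableZ.
have := L2_rep_lin a u v; apply: filterS => x h.
rewrite /cpair mulr_sumr -big_split /=; apply: eq_bigr => A _.
by rewrite h mulrDl mulrA.
Qed.

Lemma L2_ip_conj u v : L2_ip v u = (L2_ip u v)^*.
Proof.
rewrite !L2_ipE -cint_conj; last exact: (cpair_integrable (L2_rep_sq u) (L2_rep_sq v)).
by congr cint; apply/funext => x; exact: cpair_conj.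
Qed.

Lemma L2_ip_sq u : L2_ip u u = (sqsum (L2_rep u))%:C.
Proof.
rewrite L2_ipE; apply: complex_ext; first exact: Re_cint_cpair (L2_rep_sq u).
rewrite cintE /=; under eq_Rintegral do rewrite Im_cpair.
by rewrite Rintegral_cst // mul0r.
Qed.

Lemma sqsum_ge0 (v : Defs.form R N) : 0 <= sqsum v.
Proof.
by apply: sumr_ge0 => A _; apply: addr_ge0; apply: Rintegral_ge0 => x _; exact: sqr_ge0.
Qed.

Lemma L2_ip_eq0 u : L2_ip u u = 0 -> u = 0.
Proof.
rewrite L2_ip_sq => -[] /eqP; rewrite psumr_eq0; last first.
  by move=> A _; apply: addr_ge0; apply: Rintegral_ge0 => x _; exact: sqr_ge0.
move=> /allP h.
have ae0 (f : T -> R) : sqint m f -> \int[m]_x (f x ^+ 2) = 0 -> {ae m, forall x, f x = 0}.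
  move=> [mf jf] f0.
  have : (\int[m]_x `|(f x ^+ 2)%:E| = 0)%E.
    under eq_integral do rewrite gee0_abs ?lee_fin ?sqr_ge0 //.
    have fn : (\int[m]_x (f x ^+ 2)%:E)%E \is a fin_num by exact: integrable_fin_num.
    by rewrite -(fineK fn) -[fine _]/(\int[m]_x (f x ^+ 2)) f0.
  have mf2 : measurable_fun setT (EFin \o (fun x => f x ^+ 2)).
    by apply/measurable_EFinP; exact: measurable_funX.
  move/(ae_eq_integral_abs m measurableT mf2); apply: filterS => x /(_ I) [] /eqP.
  by rewrite sqrf_eq0 => /eqP.
have ae1 : forall A, {ae m, forall x : T, L2_rep u x A = 0}.
  move=> A; have := h A; rewrite mem_index_enum => /(_ isT) /=.
  rewrite paddr_eq0; [|by apply: Rintegral_ge0 => x _; exact: sqr_ge0..].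
  move=> /andP[/eqP hr /eqP hi]; have [sr si] := L2_rep_sq u A.
  have := ae0 _ sr hr; have := ae0 _ si hi; apply: filterS2 => x hi' hr'.
  by apply: complex_ext.
apply/L2_eqP; have := L2_rep0.
have : {ae m, forall x : T, forall A, L2_rep u x A = 0}.
  have /= := (@filter_forall _ _ (fun A x => L2_rep u x A = 0) (almost_everywhere m)
    (ae_filter_ringOfSetsType m) ae1).
  exact.
by apply: filterS2 => x h1 h2 A; rewrite h1 h2.
Qed.

Lemma L2_norm2 u : L2_norm u ^+ 2 = sqsum (L2_rep u).
Proof. by rewrite /L2_norm L2_ip_sq /= sqr_sqrtr // sqsum_ge0. Qed.

Lemma sqsum_ae (v w : Defs.form R N) : sqform v -> sqform w ->
  {ae m, forall x : T, forall A, v x A = w x A} -> sqsum v = sqsum w.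
Proof.
move=> sv sw vw; rewrite -!Re_cint_cpair //; congr Re; apply: cint_ae.
- exact: (cpair_integrable sv sv).
- exact: (cpair_integrable sw sw).
by move: vw; apply: filterS => x h; apply: eq_bigr => A _; rewrite h.
Qed.

Lemma L2_class_rep (w : Defs.form R N) : w \in l2_pred Omega q ->
  {ae m, forall x : T, forall A, L2_rep (L2_class Omega q w) x A = w x A}.
Proof.
move=> lw; have := L2_rep_pi (insubd 0 w); apply: filterS => x h A.
by rewrite h [l2_val _](insubdK (0 : l2_form Omega q) lw).
Qed.

Lemma sqformB (v w : Defs.form R N) : sqform v -> sqform w ->
  sqform (fun x A => v x A - w x A).
Proof.
move=> sv sw A; have [vr vi] := sv A; have [wr wi] := sw A.
split; first by under eq_fun do rewrite ReD ReN; exact: sqintB.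
by under eq_fun do rewrite ImD ImN; exact: sqintB.
Qed.

Lemma L2_rep_sub u v : {ae m, forall x : T, forall A,
  L2_rep (u - v) x A = L2_rep u x A - L2_rep v x A}.
Proof.
have := L2_rep_lin (-1) v u; rewrite scaleN1r addrC.
by apply: filterS => x h A; rewrite h mulN1r addrC.
Qed.

Lemma L2_norm_sub u v (w w' : Defs.form R N) : sqform w -> sqform w' ->
  {ae m, forall x : T, forall A, L2_rep u x A = w x A} ->
  {ae m, forall x : T, forall A, L2_rep v x A = w' x A} ->
  L2_norm (u - v) ^+ 2 = \sum_A
   (sqdist m (fun x => Re (w x A)) (fun x => Re (w' x A)) +
    sqdist m (fun x => Im (w x A)) (fun x => Im (w' x A))).
Proof.
move=> sw sw' uw vw; rewrite L2_norm2.
rewrite (@sqsum_ae _ (fun x A => w x A - w' x A)).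
- rewrite /sqsum /sqdist; apply: eq_bigr => A _; congr (_ + _).
    by under eq_Rintegral do rewrite ReD ReN.
  by under eq_Rintegral do rewrite ImD ImN.
- exact: L2_rep_sq.
- exact: sqformB.
have := L2_rep_sub u v; move: uw vw; apply: filterS3 => x h1 h2 h3 A.
by rewrite h3 h1 h2.
Qed.

(** Riesz-Fischer for the real and imaginary parts of every coefficient. The coefficientwise
    limits keep the degree and the support. *)
Lemma L2_complete (f : nat -> L2) :
  (forall e : R, 0 < e -> exists n, forall k l, (n <= k)%N -> (n <= l)%N ->
     L2_norm (f k - f l) < e) ->
  exists x, (fun n => L2_norm (f n - x)) @ \oo --> (0 : R).
Proof.
move=> fC.
have ae_refl u : {ae m, forall x : T, forall A, L2_rep u x A = L2_rep u x A} by exact: aeW.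
have fE k l := L2_norm_sub (L2_rep_sq (f k)) (L2_rep_sq (f l)) (ae_refl (f k)) (ae_refl (f l)).
pose c (b : bool) (A : {set 'I_N}) n (x : T) : R :=
  if b then Re (L2_rep (f n) x A) else Im (L2_rep (f n) x A).
have cle b A k l : sqdist m (c b A k) (c b A l) <= L2_norm (f k - f l) ^+ 2.
  rewrite fE (bigD1 A) //=; apply: (@le_trans _ _
      (sqdist m (c true A k) (c true A l) + sqdist m (c false A k) (c false A l))).
    by case: b; rewrite ?lerDl ?lerDr sqdist_ge0.
  by rewrite lerDl sumr_ge0 // => B _; rewrite addr_ge0 // sqdist_ge0.
have csq b A n : sqint m (c b A n) by have [? ?] := L2_rep_sq (f n) A; case: b.
have [g gP] : exists g : bool -> {set 'I_N} -> T -> R, forall b A,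
    [/\ sqint m (g b A), forall x, (forall n, c b A n x = 0) -> g b A x = 0 &
      forall e : R, 0 < e -> exists n, forall k, (n <= k)%N -> sqdist m (c b A k) (g b A) <= e].
  have h b A : exists g, [/\ sqint m g, forall x, (forall n, c b A n x = 0) -> g x = 0 &
      forall e : R, 0 < e -> exists n, forall k, (n <= k)%N -> sqdist m (c b A k) g <= e].
    apply: sqint_complete => // e e0.
    have se : 0 < Num.sqrt e by rewrite sqrtr_gt0.
    have [n nP] := fC _ se; exists n => k l nk nl.
    apply: le_trans (cle b A k l) _; rewrite -(sqr_sqrtr (ltW e0)).
    by rewrite ler_sqr ?nnegrE ?sqrtr_ge0 //; exact: ltW (nP _ _ nk nl).
  by exists (fun b A => projT1 (cid (h b A))) => b A; exact: projT2 (cid (h b A)).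
pose w : Defs.form R N := fun x A => g true A x +i* g false A x.
have sw : sqform w by move=> A; split; [have [] := gP true A|have [] := gP false A].
have lw : w \in l2_pred Omega q.
  apply/l2P; split; [|move=> x ox A|exact: sw].
    move=> x A Aq; apply: complex_ext => /=.
      by have [_ -> //] := gP true A => n; rewrite /c (L2_rep_deg _ _ Aq).
    by have [_ -> //] := gP false A => n; rewrite /c (L2_rep_deg _ _ Aq).
  apply: complex_ext => /=.
    by have [_ -> //] := gP true A => n; rewrite /c (L2_rep_out _ ox).
  by have [_ -> //] := gP false A => n; rewrite /c (L2_rep_out _ ox).
exists (L2_class Omega q w).
have wE k := L2_norm_sub (L2_rep_sq (f k)) sw (ae_refl (f k)) (L2_class_rep lw).
have conv b A : sqdist m (c b A n) (g b A) @[n --> \oo] --> (0 : R).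
  have [_ _ h] := gP b A; apply/cvgrPdist_le => e e0; have [n nP] := h e e0.
  exists n => // k /= nk; rewrite sub0r normrN ger0_norm ?sqdist_ge0 //; exact: nP.
have sq_cvg : (fun n => L2_norm (f n - L2_class Omega q w) ^+ 2) @ \oo --> (0 : R).
  have -> : (0 : R) = \sum_(A : {set 'I_N}) (0 + 0) by rewrite big1 // => A _; rewrite addr0.
  under eq_fun do rewrite wE.
  apply: (@cvg_big _ _ +%R 0 predT add_continuous) => A _.
  by apply: cvgD; [exact: (conv true)|exact: (conv false)].
apply/cvgrPdist_lt => e e0; have e2 : 0 < e ^+ 2 by rewrite exprn_gt0.
move/cvgrPdist_lt : sq_cvg => /(_ _ e2); apply: filterS => n.
rewrite !sub0r !normrN ger0_norm ?sqr_ge0 // ger0_norm ?sqrtr_ge0 //.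
by rewrite ltr_sqr // nnegrE ?sqrtr_ge0 // ltW.
Qed.

Lemma L2_hilbert : hilbert_space (@L2_ip R N Omega q).
Proof.
split; [exact: L2_ip_lin|exact: L2_ip_conj|move=> u|exact: L2_ip_eq0|exact: L2_complete].
by rewrite L2_ip_sq lecE /= eqxx sqsum_ge0.
Qed.

End Fixed.
End L2Space.

(** * Open sets are Lebesgue measurable *)

Section OpenMeasurable.
Context {R : realType} {N : nat}.
Local Notation Rn' := 'rV[R]_N.

(** The volume formula of a box in which empty boxes, with b <= a in some direction, need no
    separate treatment. *)
Definition box_len (a b : Rn') (i : 'I_N) : R := Num.max 0 (b 0 i - a 0 i).

Lemma box_len_ge0 a b i : 0 <= box_len a b i.
Proof. by rewrite /box_len le_max lexx. Qed.

Lemma box_lenE a b x : box a b x -> forall i, b 0 i - a 0 i = box_len a b i.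
Proof.
move=> abx i; have /andP[h1 h2] := abx i; rewrite /box_len max_r //.
by rewrite subr_ge0 ltW // (le_lt_trans h1).
Qed.

Lemma box_volume_le (a b : Rn') : (box_volume (box a b) <= (\prod_i box_len a b i)%:E)%E.
Proof.
rewrite /box_volume; case: asboolP => [_|/eqP/set0P[x xab]].
  by rewrite lee_fin prodr_ge0 // => i _; exact: box_len_ge0.
apply: ereal_inf_lbound; exists (a, b) => //=.
by congr EFin; apply: eq_bigr => i _; exact: box_lenE xab i.
Qed.

(** Cutting a box by a hyperplane yields two boxes, whose volumes add up. *)
Lemma box_volume_cut (A : set Rn') (i : 'I_N) (c : R) :
  (box_volume (A `&` [set x : Rn' | (x 0 i < c)%R]) +
   box_volume (A `&` ~` [set x : Rn' | (x 0 i < c)%R]) <= box_volume A)%E.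
Proof.
have [->|/set0P[x xA]] := eqVneq A set0.
  by rewrite !set0I box_volume0 adde0.
rewrite [leRHS]/box_volume asboolF; last by move=> A0; move: xA; rewrite A0.
apply: le_ereal_inf_tmp => _ [[a b] /= AE <-].
pose b' : Rn' := \row_j (if j == i then Num.min (b 0 i) c else b 0 j).
pose a' : Rn' := \row_j (if j == i then Num.max (a 0 i) c else a 0 j).
have -> : A `&` [set x | x 0 i < c] = box a b'.
  rewrite AE; apply/seteqP; split => y /=.
    move=> [h yc] j; have := h j; rewrite !mxE; case: eqP => // -> /andP[-> /= h2].
    by rewrite lt_min h2.
  move=> h; split; last by have := h i; rewrite !mxE eqxx lt_min => /and3P[].
  move=> j; have := h j; rewrite !mxE; case: eqP => // ->.
  by rewrite lt_min => /and3P[-> ->].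
have -> : A `&` ~` [set x | x 0 i < c] = box a' b.
  rewrite AE; apply/seteqP; split => y /=.
    move=> [h /negP]; rewrite -leNgt => yc j; have := h j; rewrite !mxE.
    by case: eqP => // -> /andP[h1 ->]; rewrite ge_max h1 yc.
  move=> h; split.
    move=> j; have := h j; rewrite !mxE; case: eqP => // ->.
    by rewrite ge_max => /andP[/andP[-> _] ->].
  have := h i; rewrite !mxE eqxx ge_max => /andP[/andP[_ h1] _].
  by apply/negP; rewrite -leNgt.
apply: le_trans (leeD (box_volume_le a b') (box_volume_le a' b)) _.
have xab : box a b x by rewrite -AE.
rewrite -EFinD lee_fin (bigD1 i) //= (bigD1 (i : 'I_N) (F := box_len a' b)) //=.
rewrite [leRHS](bigD1 i) //=.
have P1 : \prod_(j < N | j != i) box_len a b' j = \prod_(j < N | j != i) (b 0 j - a 0 j).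
  by apply: eq_bigr => j ji; rewrite (box_lenE xab) /box_len !mxE (negPf ji).
have P2 : \prod_(j < N | j != i) box_len a' b j = \prod_(j < N | j != i) (b 0 j - a 0 j).
  by apply: eq_bigr => j ji; rewrite (box_lenE xab) /box_len !mxE (negPf ji).
rewrite P1 P2 -mulrDl ler_wpM2r //.
  by apply: prodr_ge0 => j _; rewrite (box_lenE xab) box_len_ge0.
have /andP[h1 h2] := xab i; rewrite /box_len !mxE eqxx.
by rewrite /Num.max /Num.min; do ! case: ifP; lra.
Qed.

(** Caratheodory criterion: cutting the boxes of a covering costs no volume. *)
Lemma halfspace_measurable (i : 'I_N) (c : R) :
  measurable ([set x | x 0 i < c] : set (Rn R N)).
Proof.
apply: le_caratheodory_measurable => X.
apply: le_ereal_inf_tmp => _ [A [_ XA] <-].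
have v0 B : (0 <= box_volume (B : set Rn'))%E by exact: box_volume_ge0.
have cut B : (lebesgue_outer (X `&` B) <= \big[+%E/0%R]_(0 <= k <oo) box_volume (A k `&` B))%E.
  apply: ereal_inf_lbound; exists (fun k => A k `&` B) => //; split=> // x [/XA[k _ kx] Bx].
  by exists k.
apply: le_trans (leeD (cut _) (cut _)) _.
rewrite -nneseriesD; [|by move=> *; exact: v0..].
by apply: lee_nneseries => [*|k _]; [rewrite adde_ge0 | exact: box_volume_cut].
Qed.

Lemma box_measurable (a b : Rn') : measurable (box a b : set (Rn R N)).
Proof.
rewrite (_ : box a b = \bigcap_(i in [set: 'I_N])
    ([set x | x 0 i < b 0 i] `&` ~` [set x | x 0 i < a 0 i])).
  apply: fin_bigcap_measurable => // i _; apply: measurableI; first exact: halfspace_measurable.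
  by apply: measurableC; exact: halfspace_measurable.
apply/seteqP; split => x /= h i.
  move=> _; have /andP[h1 h2] := h i; split=> //=; by apply/negP; rewrite -leNgt.
by have [h1 /negP] := h i I; rewrite -leNgt => ->.
Qed.

(** An open set is the union of the countably many grid cells it contains. *)
Lemma open_measurable_Rn (O : set Rn') : open O -> measurable (O : set (Rn R N)).
Proof.
move=> oO; pose cell (p : nat * {ffun 'I_N -> int}) : set Rn' :=
  box (\row_i ((p.2 i)%:~R / p.1.+1%:R)) (\row_i ((p.2 i + 1)%:~R / p.1.+1%:R)).
rewrite (_ : O = \bigcup_(p in setT) (if `[< cell p `<=` O >] then cell p else set0)).
  apply: countable_bigcupT_measurable => [|p]; first exact: countableP.
  case: ifP => _; [exact: box_measurable|exact: measurable0].
apply/seteqP; split => [x Ox|x [p _]]; last by case: asboolP => // h /h.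
have : nbhs x O by exact: open_nbhs_nbhs.
move=> /nbhs_ballP[e /= e0 eO].
have [n _ nP] := near_infty_natSinv_lt (PosNum e0).
have ne : n.+1%:R^-1 < e := nP n (leqnn n).
have n0 : 0 < n.+1%:R :> R by rewrite ltr0n.
exists (n, [ffun i => Num.floor (x 0 i * n.+1%:R)]) => //.
set p := (n, _).
have cx : cell p x.
  move=> i; rewrite !mxE /= ffunE ler_pdivrMr // ltr_pdivlMr //.
  exact: floor_itv.
rewrite asboolT // => y cy; apply: eO; split=> // i j; rewrite ord1.
have := cx j; have := cy j; rewrite !mxE /= ffunE.
set f := Num.floor _; rewrite intrD mulrDl mul1r => /andP[a1 a2] /andP[b1 b2].
move: a1 a2 b1 b2 ne; rewrite /ball /= ltr_distlC; set u := _ / _; set v := n.+1%:R^-1.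
by move=> *; apply/andP; split; lra.
Qed.

End OpenMeasurable.

(** * Coercive operators and products of Hilbert spaces *)

Section Coercive.
Context {R : realType} {X : lmodType R[i]} {ip : X -> X -> R[i]}.
Local Notation nrm := (ip_norm ip).
Local Notation rip := (rip ip).

Record coercive_operator (B : X -> X) (c C : R) : Prop := CoerciveOperator {
  coercive_linear : linear B;
  coercive_sym : forall x y, ip (B x) y = ip x (B y);
  coercive_gt0 : 0 < c;
  coercive_bound_gt0 : 0 < C;
  coercive_ge : forall x, c * nrm x ^+ 2 <= rip (B x) x;
  coercive_bound : forall x, nrm (B x) <= C * nrm x }.

Hypothesis HX : hilbert_space ip.
Context {B : X -> X} {c C : R}.
Hypothesis HB : coercive_operator B c C.
Let c_gt0 := coercive_gt0 HB.
Let C_gt0 := coercive_bound_gt0 HB.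

Lemma coerciveB x y : B (x - y) = B x - B y.
Proof. by rewrite -[x - y]addrC -scaleN1r (coercive_linear HB) scaleN1r addrC. Qed.

Lemma coercive_le x : c * nrm x <= nrm (B x).
Proof.
have [x0|x0] := eqVneq (nrm x) 0; first by rewrite x0 mulr0 nrm_ge0.
have xp : 0 < nrm x by rewrite lt0r x0 nrm_ge0.
rewrite -(ler_pM2r xp) -mulrA -expr2 (le_trans (coercive_ge HB x)) //.
exact: rip_le.
Qed.

Lemma coercive_inj x y : B x = B y -> x = y.
Proof.
move=> xy; apply/eqP; rewrite -subr_eq0; apply/eqP/(nrm_eq0 HX)/eqP.
have := coercive_le (x - y); rewrite coerciveB xy subrr (nrm0 HX).
by rewrite pmulr_rle0 // => h; rewrite eq_le h nrm_ge0.
Qed.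

(** Lax-Milgram: the residuals of the iteration x |-> x + theta (f - B x) are
    contracted by 1 - theta B when theta = c / C^2, and they control the differences
    of the iterates. *)
Lemma coercive_surj f : exists x, B x = f.
Proof.
pose th := c / C ^+ 2.
pose x_ := fix x_ n := if n is n'.+1 then x_ n' + th%:C *: (f - B (x_ n')) else 0 : X.
pose r n := f - B (x_ n).
have C2 : 0 < C ^+ 2 by rewrite exprn_gt0.
have rS n : r n.+1 = r n - th%:C *: B (r n).
  rewrite /r /= -/(r n) -[x_ n + _]addrC (coercive_linear HB) opprD addrA addrAC.
  by rewrite -[X in _ = X - _]/(f - B (x_ n)).
have rE n : r n = f - B (x_ n) by [].
clearbody r.
pose rho : R := Num.max 0 (1 - th * c).
have th0 : 0 < th by rewrite divr_gt0.
have rho0 : 0 <= rho by rewrite /rho le_max lexx.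
have rho1 : rho < 1 by rewrite /rho gt_max ltr01 /= ltrBlDr ltrDl mulr_gt0.
have contract n : nrm (r n.+1) ^+ 2 <= rho * nrm (r n) ^+ 2.
  apply: (@le_trans _ _ ((1 - th * c) * nrm (r n) ^+ 2)); last first.
    by rewrite ler_wpM2r ?sqr_ge0 // /rho le_max lexx orbT.
  rewrite rS nrm2 // !(ripBl HX, ripBr HX, ripZl HX, ripZr HX) (ripC HX (r n)) -!(nrm2 HX).
  have h1 := coercive_ge HB (r n); have h2 : nrm (B (r n)) ^+ 2 <= C ^+ 2 * nrm (r n) ^+ 2.
    by rewrite -exprMn ler_sqr ?nnegrE ?mulr_ge0 ?nrm_ge0 ?(ltW C_gt0) ?(coercive_bound HB).
  have h3 : th * (th * nrm (B (r n)) ^+ 2) <= th * (c * nrm (r n) ^+ 2).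
    rewrite ler_pM2l // (le_trans (ler_wpM2l (ltW th0) h2)) // mulrA /th divfK //.
    exact: lt0r_neq0.
  have h4 : th * (c * nrm (r n) ^+ 2) <= th * rip (B (r n)) (r n) by rewrite ler_pM2l.
  lra.
have small e : 0 < e -> exists n, forall k, (n <= k)%N -> nrm (r k) < e.
  move=> e0; have geo : rho ^+ n * nrm (r 0) ^+ 2 @[n --> \oo] --> 0 * nrm (r 0) ^+ 2.
    by apply: cvgMl; apply: cvg_expr; rewrite ger0_norm.
  rewrite mul0r in geo; have e2 : 0 < e ^+ 2 by rewrite exprn_gt0.
  move/cvgrPdist_lt : geo => /(_ _ e2) [n _ nP]; exists n => k nk.
  have := nP k nk; rewrite /= sub0r normrN ger0_norm ?mulr_ge0 ?exprn_ge0 ?nrm_ge0 // => h.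
  rewrite -ltr_sqr ?nnegrE ?nrm_ge0 ?ltW //; apply: le_lt_trans h.
  elim: k {nk} => [|k ih]; first by rewrite expr0 mul1r.
  by rewrite (le_trans (contract k)) // (exprS rho) -mulrA ler_wpM2l.
have diff k l : c * nrm (x_ k - x_ l) <= nrm (r k) + nrm (r l).
  apply: le_trans (coercive_le _) _; rewrite coerciveB [leRHS]addrC.
  have -> : B (x_ k) - B (x_ l) = r l - r k by rewrite !rE opprD opprK addrACA subrr add0r addrC.
  exact: nrmB.
have [x xP] : exists x, (fun n => nrm (x_ n - x)) @ \oo --> (0 : R).
  apply: (ip_complete HX) => e e0; have ec : 0 < c * e / 2 by rewrite divr_gt0 // mulr_gt0.
  have [n nP] := small _ ec; exists n => k l nk nl.
  rewrite -(ltr_pM2l c_gt0) (le_lt_trans (diff k l)) // (splitr (c * e)).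
  by apply: ltrD; exact: nP.
exists x; apply/eqP; rewrite eq_sym -subr_eq0; apply/eqP/(nrm_eq0 HX)/eqP.
rewrite eq_le nrm_ge0 andbT; apply/ler_addgt0Pl => e e0; rewrite addr0.
have e2 : 0 < e / 2 by rewrite divr_gt0.
have eC : 0 < e / 2 / C by rewrite divr_gt0.
have [n nP] := small _ e2; move/cvgrPdist_lt : xP => /(_ _ eC) [m _ mP].
have := mP (maxn n m) (leq_maxr _ _); rewrite /= sub0r normrN ger0_norm ?nrm_ge0 //.
set k := maxn n m => h; have -> : f - B x = r k + B (x_ k - x).
  by rewrite coerciveB rE addrA subrK.
apply: le_trans (nrmD HX _ _) _; rewrite (splitr e); apply: lerD.
  by apply/ltW/nP; exact: leq_maxl.
apply: le_trans (coercive_bound HB _) _; rewrite mulrC -ler_pdivlMr //; exact: ltW.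
Qed.

Local Notation ipB := (fun x y => ip (B x) y).

Lemma coercive_nrm2 x : ip_norm ipB x ^+ 2 = rip (B x) x.
Proof.
rewrite /ip_norm sqr_sqrtr //; apply: le_trans (coercive_ge HB x).
by rewrite mulr_ge0 ?sqr_ge0 // ltW.
Qed.

Lemma coercive_nrm_ge x : c * nrm x ^+ 2 <= ip_norm ipB x ^+ 2.
Proof. by rewrite coercive_nrm2; exact: (coercive_ge HB x). Qed.

Lemma coercive_nrm_le x : ip_norm ipB x ^+ 2 <= C * nrm x ^+ 2.
Proof.
rewrite coercive_nrm2; apply: le_trans (rip_le HX _ _) _.
by rewrite expr2 mulrA ler_wpM2r ?nrm_ge0 //; exact: (coercive_bound HB x).
Qed.

(** Energy norm and original norm are equivalent. *)
Lemma coercive_hilbert : hilbert_space ipB.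
Proof.
split.
- by move=> a x y z; rewrite (coercive_linear HB) (ip_linear HX).
- by move=> x y; rewrite (coercive_sym HB) (ip_conj HX).
- move=> x; rewrite lecE /=; apply/andP; split; last first.
    by apply: le_trans (coercive_ge HB x); rewrite mulr_ge0 ?sqr_ge0 // ltW.
  have := ip_conj HX (B x) x; rewrite -(coercive_sym HB) => /(congr1 (@complex.Im R)).
  rewrite ImJ => h; apply/eqP; lra.
- move=> x x0; apply: (nrm_eq0 HX); apply/eqP; rewrite -sqrf_eq0 eq_le sqr_ge0 andbT.
  by have := coercive_ge HB x; rewrite /rip x0 /= pmulr_rle0.
- move=> u uC; have sc : 0 < Num.sqrt c by rewrite sqrtr_gt0.
  have nB x : Num.sqrt c * nrm x <= ip_norm ipB x.
    rewrite -ler_sqr ?nnegrE ?mulr_ge0 ?nrm_ge0 ?sqrtr_ge0 //.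
    by rewrite exprMn (sqr_sqrtr (ltW c_gt0)) coercive_nrm_ge.
  have Bn x : ip_norm ipB x <= Num.sqrt C * nrm x.
    rewrite -ler_sqr ?nnegrE ?mulr_ge0 ?nrm_ge0 ?sqrtr_ge0 //.
    by rewrite exprMn (sqr_sqrtr (ltW C_gt0)) coercive_nrm_le.
  have [x xP] : exists x, (fun n => nrm (u n - x)) @ \oo --> (0 : R).
    apply: (ip_complete HX) => e e0; have [|n nP] := uC (Num.sqrt c * e); first exact: mulr_gt0.
    by exists n => k l nk nl; rewrite -(ltr_pM2l sc) (le_lt_trans (nB _)) // nP.
  exists x; apply: (@squeeze_cvgr _ _ _ _ (cst 0) (fun n => Num.sqrt C * nrm (u n - x))).
  + by apply: nearW => n; rewrite Bn sqrtr_ge0.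
  + exact: cvg_cst.
  + by rewrite -[0](mulr0 (Num.sqrt C)); apply: cvgMr.
Qed.

End Coercive.

Section ProductSpace.
Context {R : realType} {X Y : lmodType R[i]} {ip1 : X -> X -> R[i]} {ip2 : Y -> Y -> R[i]}.
Hypothesis (H1 : hilbert_space ip1) (H2 : hilbert_space ip2).
Local Notation XY := (X * Y)%type.
Local Notation ip := (fun u v : XY => ip1 u.1 v.1 + ip2 u.2 v.2).

Lemma prod_nrm2 (u : XY) : ip_norm ip u ^+ 2 = ip_norm ip1 u.1 ^+ 2 + ip_norm ip2 u.2 ^+ 2.
Proof.
have h1 := rip_ge0 H1 u.1; have h2 := rip_ge0 H2 u.2.
by rewrite /ip_norm ReD !sqr_sqrtr // addr_ge0.
Qed.

Lemma prod_nrm_le (u : XY) : ip_norm ip u <= ip_norm ip1 u.1 + ip_norm ip2 u.2.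
Proof.
have h1 := @nrm_ge0 _ _ ip1 u.1; have h2 := @nrm_ge0 _ _ ip2 u.2.
rewrite -ler_sqr ?nnegrE ?nrm_ge0 ?addr_ge0 // prod_nrm2; nra.
Qed.

Lemma prod_nrm_ge1 (u : XY) : ip_norm ip1 u.1 <= ip_norm ip u.
Proof. by rewrite -ler_sqr ?nnegrE ?nrm_ge0 // prod_nrm2 lerDl sqr_ge0. Qed.

Lemma prod_nrm_ge2 (u : XY) : ip_norm ip2 u.2 <= ip_norm ip u.
Proof. by rewrite -ler_sqr ?nnegrE ?nrm_ge0 // prod_nrm2 lerDr sqr_ge0. Qed.

Lemma prod_hilbert : hilbert_space ip.
Proof.
split.
- by move=> a x y z /=; rewrite (ip_linear H1) (ip_linear H2) mulrDr addrACA.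
- by move=> x y /=; rewrite (ip_conj H1) (ip_conj H2) rmorphD.
- by move=> x /=; rewrite addr_ge0 ?(ip_ge0 H1) ?(ip_ge0 H2).
- move=> [x y] /= /eqP; rewrite paddr_eq0 ?(ip_ge0 H1) ?(ip_ge0 H2) // => /andP[/eqP h1 /eqP h2].
  by rewrite (ip_eq0 H1 h1) (ip_eq0 H2 h2).
- move=> u uC.
  have [x xP] : exists x, (fun n => ip_norm ip1 ((u n).1 - x)) @ \oo --> (0 : R).
    apply: (ip_complete H1) => e e0; have [n nP] := uC e e0; exists n => k l nk nl.
    exact: le_lt_trans (prod_nrm_ge1 (u k - u l)) (nP _ _ nk nl).
  have [y yP] : exists y, (fun n => ip_norm ip2 ((u n).2 - y)) @ \oo --> (0 : R).
    apply: (ip_complete H2) => e e0; have [n nP] := uC e e0; exists n => k l nk nl.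
    exact: le_lt_trans (prod_nrm_ge2 (u k - u l)) (nP _ _ nk nl).
  exists (x, y); apply: (@squeeze_cvgr _ _ _ _ (cst 0)
      (fun n => ip_norm ip1 ((u n).1 - x) + ip_norm ip2 ((u n).2 - y))).
  + by apply: nearW => n; rewrite sqrtr_ge0 (prod_nrm_le (u n - (x, y))).
  + exact: cvg_cst.
  + by rewrite -[0]addr0; exact: cvgD.
Qed.

End ProductSpace.

(** * Coefficients act as coercive operators *)

Section AlmostEverywhere.
Context d (T : measurableType d) (R : realType) (m : {measure set T -> \bar R}).

(** A function that is nonnegative almost everywhere has the integral of its absolute value. *)
Lemma Rintegral_ae_ge0 (f : T -> R) : measurable_fun setT f ->
  {ae m, forall x, 0 <= f x} -> 0 <= \int[m]_x f x.
Proof.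
move=> mf f0; rewrite (@Rintegral_ae _ _ _ m f (fun x => `|f x|)).
- by apply: Rintegral_ge0 => x _; exact: normr_ge0.
- exact: mf.
- exact: measurableT_comp.
- by move: f0; apply: filterS => x h; rewrite ger0_norm.
Qed.

Lemma Re_cint_le (f g : T -> R[i]) : cintegrable m f -> cintegrable m g ->
  {ae m, forall x, Re (f x) <= Re (g x)} -> Re (cint m f) <= Re (cint m g).
Proof.
move=> [rf _] [rg _] fg; rewrite !cintE /= -subr_ge0 -RintegralB //.
apply: Rintegral_ae_ge0.
  by apply/measurable_EFinP; have /integrableP[] := real_integrableB measurableT rg rf.
by move: fg; apply: filterS => x; rewrite subr_ge0.
Qed.

(** The factor b is only known on D, outside of which the other factor vanishes. *)
Lemma sqint_mul_bounded (b : T -> R) (D : set T) (c : R) (f : T -> R) :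
  measurable D -> measurable_fun D b -> {ae m, forall x, D x -> `|b x| <= c} ->
  sqint m f -> (forall x, ~ D x -> f x = 0) -> sqint m (fun x => b x * f x).
Proof.
move=> mD mb bc sf f0; have [mf _] := sf.
have E : (fun x => b x * f x) = (fun x => (b \_ D) x * f x).
  apply/funext => x; rewrite patchE; case: ifPn => // /negP xD.
  by rewrite f0 ?mulr0 // => h; apply: xD; rewrite inE.
apply: (@sqint_le _ _ _ _ c _ f).
- rewrite E; apply: measurable_funM => //.
  by apply/(measurable_restrictT _ mD).1.
- exact: sf.
move: bc; apply: filterS => x bx; rewrite normrM.
have [xD|xD] := pselect (D x); last by rewrite f0 // normr0 !mulr0.
by rewrite ler_wpM2r // bx.
Qed.

Lemma sqint_sum (I : Type) (s : seq I) (P : pred I) (f : I -> T -> R) :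
  (forall i, P i -> sqint m (f i)) -> sqint m (fun x => \sum_(i <- s | P i) f i x).
Proof.
move=> sf; elim: s => [|i s ih].
  under eq_fun do rewrite big_nil; split; first exact: measurable_cst.
  under eq_fun do rewrite expr0n /=; exact: (integrable0 m).
have [Pi|/negPf Pi] := boolP (P i); last by under eq_fun do rewrite big_cons Pi.
by under eq_fun do rewrite big_cons Pi; apply: sqintD => //; exact: sf.
Qed.

End AlmostEverywhere.

Section Coefficients.
Context {R : realType} {N : nat}.
Local Notation m := (@lebesgueN R N).
Local Notation T := (Rn R N).

Context {Omega : set 'rV[R]_N} {q : nat} {a : coefficient R N}.
Hypothesis mO : measurable (Omega : set T).
Hypothesis Ha : admissible Omega q a.

Local Notation form := (Defs.form R N).

Lemma mul_conj0 (x y : R[i]) : y = 0 -> x * y^* = 0.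
Proof. by move=> ->; apply: complex_ext; rewrite ?(ReM, ImM) ReJ ImJ /=; ring. Qed.

Lemma coeff_form_lin (k : R[i]) (v w : form) x A :
  coeff_form q a (fun x A => k * v x A + w x A) x A =
  k * coeff_form q a v x A + coeff_form q a w x A.
Proof.
rewrite /coeff_form; case: eqP => _; last by rewrite mulr0 addr0.
rewrite mulr_sumr -big_split /=; apply: eq_bigr => B _.
by rewrite mulrDr mulrCA.
Qed.

Lemma Re_coeff_form (w : form) x (A : {set 'I_N}) : #|A| = q -> Re (coeff_form q a w x A) =
  \sum_(B : {set 'I_N} | #|B| == q) a x A B * Re (w x B).
Proof.
move=> Aq; rewrite /coeff_form Aq eqxx Re_sum; apply: eq_bigr => B _.
by rewrite ReM /= mul0r subr0.
Qed.

Lemma Im_coeff_form (w : form) x (A : {set 'I_N}) : #|A| = q -> Im (coeff_form q a w x A) =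
  \sum_(B : {set 'I_N} | #|B| == q) a x A B * Im (w x B).
Proof.
move=> Aq; rewrite /coeff_form Aq eqxx Im_sum; apply: eq_bigr => B _.
by rewrite ImM /= mul0r addr0.
Qed.

Lemma coeff_sqint (f : {set 'I_N} -> T -> R) (A : {set 'I_N}) : #|A| = q ->
  (forall B, sqint m (f B)) -> (forall B x, ~ Omega x -> f B x = 0) ->
  sqint m (fun x => \sum_(B : {set 'I_N} | #|B| == q) a x A B * f B x).
Proof.
move=> Aq sf f0; have [mA [c bA] _ _] := Ha.
apply: sqint_sum => B /eqP Bq.
apply: (@sqint_mul_bounded _ _ _ _ _ (Omega : set T) c).
- exact: mO.
- exact: mA.
- by move: bA; apply: filterS => x bx xO; exact: bx.
- exact: sf.
- exact: f0.
Qed.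

Lemma coeff_form_l2 (w : form) : w \in l2_pred Omega q -> coeff_form q a w \in l2_pred Omega q.
Proof.
move=> /l2P[dw ow sw]; apply/l2P; split.
- by move=> x A /negPf; rewrite /coeff_form => ->.
- move=> x xO A; rewrite /coeff_form; case: ifP => // _.
  by rewrite big1 // => B _; rewrite ow // mulr0.
move=> A; have [Aq|/eqP/negPf Aq] := pselect (#|A| = q); last first.
  have s0 : sqint m (fun _ : T => 0 : R).
    have [h _] := sw A; have := sqintB h h; by under eq_fun do rewrite subrr.
  by split; under eq_fun do rewrite /coeff_form Aq /=.
split.
  under eq_fun do rewrite Re_coeff_form //.
  apply: (coeff_sqint Aq) => B; first by have [] := sw B.
  by move=> x xO; rewrite ow.
under eq_fun do rewrite Im_coeff_form //.
apply: (coeff_sqint Aq) => B; first by have [] := sw B.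
by move=> x xO; rewrite ow.
Qed.

Lemma coeff_op_rep (u : L2 Omega q) : {ae m, forall x : T, forall A,
  L2_rep (coeff_op a u) x A = coeff_form q a (L2_rep u) x A}.
Proof. exact: L2_class_rep (coeff_form_l2 (L2_rep_l2 u)). Qed.

Lemma coeff_op_linear : linear (coeff_op a : L2 Omega q -> L2 Omega q).
Proof.
move=> k u v; apply/L2_eqP.
have h1 := coeff_op_rep (k *: u + v); have h2 := L2_rep_lin k u v.
have h3 := L2_rep_lin k (coeff_op a u) (coeff_op a v).
have h4 := coeff_op_rep u; have h5 := coeff_op_rep v.
near=> x => A; rewrite (near h1 x) // (near h3 x) // (near h4 x) // (near h5 x) //.
rewrite -coeff_form_lin /coeff_form; case: eqP => // _; apply: eq_bigr => B _.
by rewrite (near h2 x).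
Unshelve. all: by end_near.
Qed.

Lemma coeff_pair (u v : L2 Omega q) :
  L2_ip (coeff_op a u) v = cint m (cpair (coeff_form q a (L2_rep u)) (L2_rep v)).
Proof.
rewrite L2_ipE; have su := L2_rep_sq (coeff_op a u); have sv := L2_rep_sq v.
have /l2P[_ _ sc] := coeff_form_l2 (L2_rep_l2 u).
apply: cint_ae; [exact: cpair_integrable|exact: cpair_integrable|].
by have := coeff_op_rep u; apply: filterS => x h; apply: eq_bigr => A _; rewrite h.
Qed.

Lemma coeff_op_sym (u v : L2 Omega q) : L2_ip (coeff_op a u) v = L2_ip u (coeff_op a v).
Proof.
rewrite [RHS](ip_conj (L2_hilbert _ _)) !coeff_pair.
have /l2P[_ ou sc] := coeff_form_l2 (L2_rep_l2 u); have su := L2_rep_sq u.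
have /l2P[_ ov sd] := coeff_form_l2 (L2_rep_l2 v); have sv := L2_rep_sq v.
rewrite -cint_conj; last exact: cpair_integrable.
apply: cint_ae; first exact: cpair_integrable.
  under eq_fun do rewrite -cpair_conj; exact: cpair_integrable.
have [_ _ symA _] := Ha; move: symA; apply: filterS => x sx.
rewrite -cpair_conj /cpair; have [xO|xO] := pselect (Omega x); last first.
  by rewrite !big1 // => A _; [rewrite (L2_rep_out u xO) mul0r|rewrite ou // mul0r].
rewrite (bigID (fun A : {set 'I_N} => #|A| == q)) /= [X in _ + X]big1 ?addr0; last first.
  by move=> A /negPf h; rewrite /coeff_form h mul0r.
rewrite [RHS](bigID (fun A : {set 'I_N} => #|A| == q)) /= [X in _ = _ + X]big1 ?addr0; last first.
  by move=> A /negPf h; apply: mul_conj0; rewrite /coeff_form h.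
under eq_bigr => A Aq do rewrite /coeff_form Aq mulr_suml.
rewrite exchange_big /=; apply: eq_bigr => B Bq; rewrite /coeff_form Bq rmorph_sum mulr_sumr.
apply: eq_bigr => A Aq; rewrite (sx xO A B) ?(eqP Aq) ?(eqP Bq) //.
by apply: complex_ext; rewrite !(ReM, ImM, ReJ, ImJ) /=; ring.
Qed.

Lemma Re_cpair_deg (w : form) (x : T) : of_degree q w ->
  Re (cpair w w x) = \sum_(A : {set 'I_N} | #|A| == q) (Re (w x A) ^+ 2 + Im (w x A) ^+ 2).
Proof.
move=> dw; rewrite Re_cpair (bigID (fun A : {set 'I_N} => #|A| == q)) /=.
by rewrite [X in _ + X]big1 ?addr0 // => A Aq; rewrite dw //= expr0n addr0.
Qed.

(** Ellipticity, applied separately to real and imaginary parts, gives the lower bound; the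
    upper one bounds every entry of a matrix times a vector by the number of multi-indices
    times the largest products. *)
Lemma coeff_op_coercive : exists c C, @coercive_operator R (L2 Omega q) (@L2_ip R N Omega q)
  (coeff_op a) c C.
Proof.
have [_ [b bA] _ [c c0 cA]] := Ha.
pose K : R := #|{set 'I_N}|%:R; pose d : R := Num.sqrt (K * 2) * (K * (`|b| + 1)).
have K0 : 0 < K by rewrite ltr0n; apply/card_gt0P; exists (finset.set0 : {set 'I_N}).
have d0 : 0 < d by rewrite !mulr_gt0 // ?sqrtr_gt0 ?mulr_gt0 // ltr_pwDr.
exists c, d; split => //; [exact: coeff_op_linear|exact: coeff_op_sym|move=> u|move=> u].
- have su := L2_rep_sq u; have /l2P[dc _ sc] := coeff_form_l2 (L2_rep_l2 u).
  rewrite (nrm2 (L2_hilbert _ _)) /rip coeff_pair (L2_ipE u).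
  have -> : c * Re (cint m (cpair (L2_rep u) (L2_rep u))) =
      Re (cint m (fun x => c%:C * cpair (L2_rep u) (L2_rep u) x)).
    by rewrite cintZ ?ReM /= ?mul0r ?subr0 //; exact: cpair_integrable.
  apply: Re_cint_le; [apply: cintegrableZ; exact: cpair_integrable|exact: cpair_integrable|].
  move: cA; apply: filterS => x cx; have [xO|xO] := pselect (Omega x); last first.
    by rewrite /cpair !big1 ?mulr0 // => A _; apply: mul_conj0; exact: L2_rep_out.
  rewrite ReM /= mul0r subr0 (Re_cpair_deg x (@L2_rep_deg _ _ _ _ u)) big_split /= mulrDr.
  apply: le_trans (lerD (cx xO (fun A => Re (L2_rep u x A))) (cx xO (fun A => Im (L2_rep u x A)))) _.
  rewrite -big_split /= Re_sum [leRHS](bigID (fun A : {set 'I_N} => #|A| == q)) /=.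
  rewrite [X in _ <= _ + X]big1 ?addr0; last by move=> A /negPf h; rewrite /coeff_form h mul0r.
  apply: ler_sum => A /eqP Aq; rewrite -big_split /= ReM ReJ ImJ Re_coeff_form // Im_coeff_form //.
  rewrite mulrN opprK !mulr_suml -big_split /=; apply: ler_sum => B _; lra.
- have su := L2_rep_sq u; have /l2P[dc _ sc] := coeff_form_l2 (L2_rep_l2 u).
  have pu := cpair_integrable su su; have pc := cpair_integrable sc sc.
  apply: (le_nrm (L2_hilbert Omega q)); first by rewrite mulr_ge0 ?sqrtr_ge0 // ltW.
  rewrite -(nrm2 (L2_hilbert _ _)) exprMn -/(L2_norm _) -/(L2_norm u) !L2_norm2.
  rewrite (sqsum_ae (L2_rep_sq _) sc (coeff_op_rep u)) -!Re_cint_cpair //.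
  have -> : d ^+ 2 * Re (cint m (cpair (L2_rep u) (L2_rep u))) =
      Re (cint m (fun x => (d ^+ 2)%:C * cpair (L2_rep u) (L2_rep u) x)).
    by rewrite cintZ // ReM /= mul0r subr0.
  apply: Re_cint_le; [exact: pc|exact: cintegrableZ|].
  move: bA; apply: filterS => x bx; have [xO|xO] := pselect (Omega x); last first.
    rewrite /cpair !big1 ?mulr0 // => A _; apply: mul_conj0; first exact: L2_rep_out.
    by have /l2P[_ -> ] := coeff_form_l2 (L2_rep_l2 u).
  rewrite ReM /= mul0r subr0 Re_cpair; set S := Re (cpair _ _ _).
  have SE : S = \sum_A (Re (L2_rep u x A) ^+ 2 + Im (L2_rep u x A) ^+ 2) by exact: Re_cpair.
  have S0 : 0 <= S by rewrite SE sumr_ge0 // => A _; rewrite addr_ge0 ?sqr_ge0.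
  have bnd (r : {set 'I_N} -> R) (A : {set 'I_N}) : #|A| = q -> (forall B, r B ^+ 2 <= S) ->
      (\sum_(B : {set 'I_N} | #|B| == q) a x A B * r B) ^+ 2 <= (K * (`|b| + 1)) ^+ 2 * S.
    move=> Aq rS; rewrite -[S](sqr_sqrtr S0) -exprMn -[leLHS]real_normK ?num_real //.
    rewrite ler_sqr ?nnegrE ?mulr_ge0 ?addr_ge0 ?sqrtr_ge0 // ?(ltW K0) //.
    apply: le_trans (ler_norm_sum _ _ _) _.
    apply: (@le_trans _ _ (\sum_(B : {set 'I_N}) (`|b| + 1) * Num.sqrt S)); last first.
      by rewrite sumr_const -mulr_natl mulrA.
    rewrite [leRHS](bigID (fun B : {set 'I_N} => #|B| == q)) /=.
    apply: le_trans (_ : _ <= \sum_(B : {set 'I_N} | #|B| == q) (`|b| + 1) * Num.sqrt S) _.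
      apply: ler_sum => B /eqP Bq; rewrite normrM ler_pM //.
        rewrite (le_trans (bx xO A B Aq Bq)) // (le_trans (ler_norm _)) //.
        by rewrite lerDl.
      by rewrite -sqrtr_sqr ler_wsqrtr.
    by rewrite lerDl sumr_ge0 // => B _; rewrite mulr_ge0 ?sqrtr_ge0 // addr_ge0.
  have SRe B : Re (L2_rep u x B) ^+ 2 <= S.
    rewrite SE (bigD1 B) //= -addrA lerDl addr_ge0 ?sqr_ge0 //.
    by rewrite sumr_ge0 // => A _; rewrite addr_ge0 ?sqr_ge0.
  have SIm B : Im (L2_rep u x B) ^+ 2 <= S.
    rewrite SE (bigD1 B) //= [X in X + _]addrC -addrA lerDl addr_ge0 ?sqr_ge0 //.
    by rewrite sumr_ge0 // => A _; rewrite addr_ge0 ?sqr_ge0.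
  apply: (@le_trans _ _ (\sum_(A : {set 'I_N}) 2 * ((K * (`|b| + 1)) ^+ 2 * S))); last first.
    rewrite sumr_const -[leLHS]mulr_natl /d [in leRHS]exprMn sqr_sqrtr; last first.
      by rewrite mulr_ge0 // ltW.
    by rewrite !mulrA.
  apply: ler_sum => A _; have [Aq|/eqP/negPf Aq] := pselect (#|A| = q); last first.
    rewrite /coeff_form Aq /= expr0n addr0.
    by rewrite mulr_ge0 // mulr_ge0 ?sqr_ge0.
  rewrite mulrDl mul1r lerD //; first by rewrite Re_coeff_form // bnd.
  by rewrite Im_coeff_form // bnd.
Unshelve. all: by end_near.
Qed.

End Coefficients.

(** * Test forms are square integrable *)

Lemma bounded_support_sqint d (T : measurableType d) (R : realType)
    (m : {measure set T -> \bar R}) (K : set T) (f : T -> R) (b : R) :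
  measurable K -> (m K < +oo)%E -> measurable_fun setT f ->
  0 < b -> (forall x, K x -> `|f x| <= b) -> (forall x, ~ K x -> f x = 0) -> sqint m f.
Proof.
move=> mK Kfin mf b0 bP f0; split=> //.
apply: (@le_integrable _ _ _ m _ _ _ (EFin \o (fun x : T => b ^+ 2 * \1_K x))) => //.
- by apply/measurable_EFinP; exact: measurable_funX.
- move=> x _ /=; rewrite lee_fin ger0_norm ?sqr_ge0 // [leRHS]ger0_norm ?(mulr_ge0 (sqr_ge0 b)) //.
  rewrite indicE; case: (pselect (K x)) => [Kx|nK]; last first.
    by rewrite f0 // expr0n memNset // mulr0.
  rewrite mem_set // mulr1 -[leLHS]real_normK ?num_real //.
  by have h := bP x Kx; rewrite ler_sqr ?nnegrE // ltW.
apply: real_integrableZl => //; apply/integrableP; split.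
  by apply/measurable_EFinP; exact: measurable_indic.
under eq_integral do rewrite /= ger0_norm //.
by rewrite integral_indic // setIT.
Qed.

Section TestForms.
Context {R : realType} {N : nat}.
Local Notation m := (@lebesgueN R N).
Local Notation T := (Rn R N).
Local Notation form := (Defs.form R N).
Implicit Types (K : set 'rV[R]_N) (f : 'rV[R]_N -> R).

Lemma continuous_measurable_Rn f : continuous f -> measurable_fun setT (f : T -> R).
Proof.
move=> cf; apply: (measurability _ (RGenOpens.measurableE R)).
move=> _ [_ [a [b ->] <-]]; rewrite setTI; apply: open_measurable_Rn.
by apply: open_comp; [move=> x _; exact: cf|exact: interval_open].
Qed.

Lemma box_measure_lty (a b : 'rV[R]_N) : (m (box a b : set T) < +oo)%E.
Proof.
rewrite lebesgueN.unlock; apply: le_lt_trans (ltry (\prod_i box_len a b i)).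
apply: le_trans (box_volume_le a b); apply: ereal_inf_lbound.
pose cov (k : nat) : set 'rV[R]_N := if k is 0%N then box a b else set0.
exists cov.
  by split=> // x abx; exists 0%N.
rewrite (@nneseries_split R _ 0%N 1%N) => [|[|k] _]; [|exact: box_volume_ge0|by rewrite box_volume0].
rewrite /= big_nat1 eseries0 ?adde0 // => -[|k] // _ _; exact: box_volume0.
Qed.

Lemma compact_measurable_Rn K : compact K -> measurable (K : set T).
Proof.
move=> cK; rewrite -[K]setCK; apply: measurableC; apply: open_measurable_Rn.
by apply: closed_openC; apply: compact_closed => //; exact: norm_hausdorff.
Qed.

Lemma compact_image_bounded K f : compact K -> continuous f ->
  exists2 b, 0 < b & forall x, K x -> `|f x| <= b.
Proof.
move=> cK cf; have : compact [set f x | x in K].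
  by apply: continuous_compact => //; exact: continuous_subspaceT.
move=> /(@compact_bounded _ R^o)[M [_ MP]]; exists (`|M| + 1); first by rewrite ltr_wpDl.
move=> x Kx; apply: (MP (`|M| + 1)); last by exists x.
by rewrite (le_lt_trans (ler_norm _)) // ltrDl.
Qed.

(** A compact set lies in a box, as its coordinates are bounded. *)
Lemma compact_measure_lty K : compact K -> (m (K : set T) < +oo)%E.
Proof.
move=> cK; have h i := compact_image_bounded cK (@coord_continuous R 1 N 0 i).
pose b i := projT1 (cid2 (h i)).
have bP i x : K x -> `|x 0 i| <= b i by rewrite /b; case: cid2 => c /= _; apply.
apply: le_lt_trans (box_measure_lty (\row_i (- b i)) (\row_i (b i + 1))).
apply: le_measure; rewrite ?inE; [exact: compact_measurable_Rn|exact: box_measurable|].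
move=> x Kx i; rewrite !mxE; have := bP i x Kx; rewrite ler_norml => /andP[-> h2].
by rewrite (le_lt_trans h2) // ltrDl.
Qed.

Lemma compact_support_sqint K f : compact K -> continuous f ->
  (forall x, ~ K x -> f x = 0) -> sqint m f.
Proof.
move=> cK cf f0; have [b b0 bP] := compact_image_bounded cK cf.
exact: (bounded_support_sqint (compact_measurable_Rn cK) (compact_measure_lty cK)
  (continuous_measurable_Rn cf) b0 bP f0).
Qed.

(** Coefficients of test forms, to first order. *)
Definition C1_support K f : Prop := [/\ continuous f,
  forall i x, derivable f x (delta_mx 0 i),
  forall i, continuous (fun x => 'D_(delta_mx 0 i) f x) &
  forall x, ~ K x -> f x = 0].

Lemma C1_supportZ K f (c : R) : C1_support K f -> C1_support K (fun x => c * f x).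
Proof.
move=> [cf df dcf f0]; split.
- by move=> x; exact: (cvgM (cvg_cst c) (cf x)).
- by move=> i x; exact: (derivableZ (df i x)).
- move=> i; have -> : (fun x => 'D_(delta_mx 0 i) (fun x => c * f x) x) =
      (fun x => c * 'D_(delta_mx 0 i) f x).
    by apply/funext => x; exact: (deriveZ c (df i x)).
  by move=> x; exact: (cvgM (cvg_cst c) (dcf i x)).
- by move=> x /f0 ->; rewrite mulr0.
Qed.

Lemma C1_support_derive K f i x : compact K -> C1_support K f -> ~ K x ->
  'D_(delta_mx 0 i) f x = 0.
Proof.
move=> cK [_ _ _ f0] nK; rewrite -[RHS](derive_cst (0 : R) x (delta_mx 0 i)).
apply: near_eq_derive; have oK : open (~` K).
  by apply: closed_openC; apply: compact_closed => //; exact: norm_hausdorff.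
have : nbhs x (~` K) by exact: open_nbhs_nbhs.
by apply: filterS => y /f0.
Qed.

Definition C1_form K (w : form) : Prop := forall A,
  C1_support K (fun x => Re (w x A)) /\ C1_support K (fun x => Im (w x A)).

Lemma test_C1_form Omega q w : test_form Omega q w ->
  exists2 K, compact K & C1_form K w.
Proof.
move=> [_ sw [K [cK _ w0]]]; exists K => // A; have [sr si] := sw A.
have [dr cdr] := sr 1%N; have [di cdi] := si 1%N.
split; split=> //.
- exact: sr 0%N.
- by move=> x /w0 ->.
- exact: si 0%N.
- by move=> x /w0 ->.
Qed.

Lemma Re_sign n (z : R[i]) : Re ((-1) ^+ n * z) = (-1) ^+ n * Re z.
Proof.
by elim: n => [|n ih]; [rewrite !mul1r|rewrite !exprS -!mulrA !mulN1r ReN ih].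
Qed.

Lemma Im_sign n (z : R[i]) : Im ((-1) ^+ n * z) = (-1) ^+ n * Im z.
Proof.
by elim: n => [|n ih]; [rewrite !mul1r|rewrite !exprS -!mulrA !mulN1r ImN ih].
Qed.

Lemma C1_form_hodge K w : C1_form K w -> C1_form K (hodge w).
Proof.
move=> cw A; have [cr ci] := cw (~: A)%SET; rewrite /hodge; split.
  by under eq_fun do rewrite Re_sign; exact: C1_supportZ.
by under eq_fun do rewrite Im_sign; exact: C1_supportZ.
Qed.

Lemma sqform_hodge (w : form) : sqform w -> sqform (hodge w).
Proof.
move=> sw A; have [sr si] := sw (~: A)%SET; rewrite /hodge; split.
  by under eq_fun do rewrite Re_sign; exact: sqintZ.
by under eq_fun do rewrite Im_sign; exact: sqintZ.
Qed.

Lemma C1_sqform K w : compact K -> C1_form K w -> sqform w.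
Proof.
move=> cK cw A; have [[cr _ _ r0] [ci _ _ i0]] := cw A.
by split; exact: compact_support_sqint cK _ _.
Qed.

Lemma C1_sqform_derivative K w : compact K -> C1_form K w -> sqform (exterior_derivative w).
Proof.
move=> cK cw A; rewrite /exterior_derivative; split.
  under eq_fun do rewrite Re_sum; apply: sqint_sum => i _.
  under eq_fun do rewrite Re_sign; apply: sqintZ.
  have [cr _] := cw (A :\ i)%SET; have [_ _ cd _] := cr.
  apply: (compact_support_sqint cK); first exact: (cd i).
  by move=> x nK; exact: (C1_support_derive i cK cr nK).
under eq_fun do rewrite Im_sum; apply: sqint_sum => i _.
under eq_fun do rewrite Im_sign; apply: sqintZ.
have [_ ci] := cw (A :\ i)%SET; have [_ _ cd _] := ci.
apply: (compact_support_sqint cK); first exact: (cd i).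
by move=> x nK; exact: (C1_support_derive i cK ci nK).
Qed.

Lemma test_sqform Omega q (w : form) : test_form Omega q w -> sqform w.
Proof. by move=> /test_C1_form[K cK cw]; exact: C1_sqform cw. Qed.

Lemma test_sqform_derivative Omega q (w : form) : test_form Omega q w -> sqform (exterior_derivative w).
Proof. by move=> /test_C1_form[K cK cw]; exact: C1_sqform_derivative cw. Qed.

(** The weak derivatives pair with derivatives of test forms; their square integrability makes
    these pairings additive. *)
Lemma test_sqform_coderivative Omega q p (w : form) : test_form Omega q w -> sqform (coderivative p w).
Proof.
move=> /test_C1_form[K cK cw] A; rewrite /coderivative.
have sh := sqform_hodge (C1_sqform_derivative cK (C1_form_hodge cw)).
have [sr si] := sh A; split.
  by under eq_fun do rewrite Re_sign; exact: sqintZ.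
by under eq_fun do rewrite Im_sign; exact: sqintZ.
Qed.

End TestForms.

(** * Weak derivatives *)

Section WeakDerivativeTheory.
Context {R : realType} {N : nat} {Omega : set 'rV[R]_N}.
Local Notation m := (@lebesgueN R N).
Local Notation T := (Rn R N).
Local Notation form := (Defs.form R N).
Local Notation fp := (form_pairing Omega).

Lemma form_pairing_lin q (a : R[i]) (u v : L2 Omega q) (w : form) : sqform w ->
  fp (L2_rep (a *: u + v)) w = a * fp (L2_rep u) w + fp (L2_rep v) w.
Proof.
move=> sw; have iu (z : L2 Omega q) : cintegrable m (cpair (L2_rep z) w).
  exact: cpair_integrable (L2_rep_sq z) sw.
rewrite !form_pairingE; [|by move=> x; exact: L2_rep_out..].
rewrite -cintZ // -cintD //; last exact: cintegrableZ.
apply: cint_ae; [exact: iu|by apply: cintegrableD => //; exact: cintegrableZ|].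
have := L2_rep_lin a u v; apply: filterS => x h.
rewrite /cpair mulr_sumr -big_split /=; apply: eq_bigr => A _.
by rewrite h mulrDl mulrA.
Qed.

Lemma weak_d_lin q (a : R[i]) (E E' : L2 Omega q) F F' :
  weak_d E F -> weak_d E' F' -> weak_d (a *: E + E') (a *: F + F').
Proof.
move=> EF EF' w tw; rewrite !form_pairing_lin; first by rewrite EF // EF' //; ring.
  exact: test_sqform_coderivative tw.
exact: test_sqform tw.
Qed.

Lemma weak_delta_lin q (a : R[i]) (H H' : L2 Omega q) K K' :
  weak_delta H K -> weak_delta H' K' -> weak_delta (a *: H + H') (a *: K + K').
Proof.
move=> HK HK' w tw; rewrite !form_pairing_lin; first by rewrite HK // HK' //; ring.
  exact: test_sqform_derivative tw.
exact: test_sqform tw.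
Qed.

Lemma test_l2 q w : test_form Omega q w -> w \in l2_pred Omega q.
Proof.
move=> tw; have sw := test_sqform tw; have [dw _ [K [_ KO w0]]] := tw.
by apply/l2P; split=> // x xO A; rewrite w0 // => /KO.
Qed.

Definition test_separating q : Prop := forall k : L2 Omega q,
  (forall w, test_form Omega q w -> fp (L2_rep k) w = 0) -> k = 0.

Lemma L2_ip_class q (k : L2 Omega q) w : w \in l2_pred Omega q ->
  L2_ip k (L2_class Omega q w) = fp (L2_rep k) w.
Proof.
move=> lw; have /l2P[_ _ sw] := lw; have sk := L2_rep_sq k.
rewrite L2_ipE form_pairingE; last by move=> x; exact: L2_rep_out.
apply: cint_ae; [exact: (cpair_integrable sk (L2_rep_sq _))|exact: (cpair_integrable sk sw)|].
by have := L2_class_rep lw; apply: filterS => x h; apply: eq_bigr => A _; rewrite h.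
Qed.

(** A form orthogonal to a dense set is orthogonal to itself. *)
Lemma dense_separating q :
  (forall (E : L2 Omega q) (e : R), 0 < e -> exists2 w, test_form Omega q w &
     L2_norm (E - L2_class Omega q w) < e) -> test_separating q.
Proof.
move=> dense k k0; have HL := L2_hilbert Omega q.
apply: (nrm_eq0 HL); have [//|kn] := eqVneq (ip_norm L2_ip k) 0.
have kp : 0 < L2_norm k by rewrite lt0r kn sqrtr_ge0.
have [w tw] := dense k (L2_norm k) kp; rewrite ltNge => /negP[].
rewrite -(ler_pM2l kp); apply: le_trans (rip_le HL _ _).
rewrite (ripBr HL) -(nrm2 HL) /rip (L2_ip_class _ (test_l2 tw)) k0 // subr0.
by rewrite expr2 -[L2_norm k]/(ip_norm L2_ip k).
Qed.

(** The other coefficients of a form with a single nonzero coefficient. *)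
Lemma smooth0 : smooth (fun _ : 'rV[R]_N => 0 : R).
Proof.
elim=> [|k ih] /=; first exact: cst_continuous.
split=> i; first by move=> x; exact: derivable_cst.
rewrite (_ : (fun x => _) = fun _ => 0) //; apply/funext => x; exact: derive_cst.
Qed.

(** The coefficient of dx^A, |A| = q + 1, becomes that of dx^(A \ i), which reduces degree
    q + 1 to degree q. *)
Lemma separatingS q : test_separating q -> test_separating q.+1.
Proof.
move=> sep k k0; apply/L2_eqP.
have coef (A : {set 'I_N}) : {ae m, forall x : T, L2_rep k x A = 0}.
  have [Aq|/eqP Aq] := pselect (#|A| = q.+1); last first.
    by apply: aeW => x; exact: L2_rep_deg.
  have /card_gt0P[i iA] : (0 < #|A|)%N by rewrite Aq.
  pose A0 : {set 'I_N} := (A :\ i)%SET.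
  have A0q : #|A0| = q by have := cardsD1 i A; rewrite iA Aq => -[].
  pose k' : form := fun x B => if B == A0 then L2_rep k x A else 0.
  have sk' : sqform k'.
    have [h1 h2] := L2_rep_sq k A; have h0 := sqintZ 0 h1; move=> B.
    have e0 : (fun x : T => 0 * Re (L2_rep k x A)) = (fun x => 0).
      by apply/funext => x; rewrite mul0r.
    rewrite e0 in h0; rewrite /k'; case: (B == A0).
      by split; [exact: h1|exact: h2].
    by split; exact: h0.
  have lk' : k' \in l2_pred Omega q.
    apply/l2P; split; [move=> x B Bq|move=> x xO B|exact: sk'].
      by rewrite /k'; case: eqP => // BA; move: Bq; rewrite BA A0q eqxx.
    by rewrite /k'; case: eqP => // _; exact: L2_rep_out.
  have K0 : L2_class Omega q k' = 0.
    apply: sep => w tw; pose w' : form := fun x B => if B == A then w x A0 else 0.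
    have tw' : test_form Omega q.+1 w'.
      have [dw sw [K [cK KO w0]]] := tw; split.
      - by move=> x B Bq; rewrite /w'; case: eqP => // BA; move: Bq; rewrite BA Aq eqxx.
      - move=> B; rewrite /w'; case: eqP => _; first exact: sw.
        by split; exact: smooth0.
      - by exists K; split=> // x xK B; rewrite /w'; case: eqP => // _; exact: w0.
    have sw := test_sqform tw; have sw' := test_sqform tw'.
    rewrite -[RHS](k0 _ tw') !form_pairingE; [|by move=> x; exact: L2_rep_out..].
    apply: cint_ae; [exact: (cpair_integrable (L2_rep_sq _) sw)|exact: (cpair_integrable (L2_rep_sq
      _) sw')|].
    have := L2_class_rep lk'; apply: filterS => x h; rewrite /cpair.
    rewrite (bigD1 A0) //= [in RHS](bigD1 A) //= !big1 ?addr0.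
    - by rewrite h /k' /w' !eqxx.
    - by move=> B BA; apply: mul_conj0; rewrite /w' (negPf BA).
    - by move=> B BA; rewrite h /k' (negPf BA) mul0r.
  have h := L2_class_rep lk'; rewrite K0 in h.
  have := L2_rep0 Omega q; move: h; apply: filterS2 => x h1 h2.
  by have := h1 A0; rewrite h2 /k' eqxx.
have all : {ae m, forall x : T, forall A, L2_rep k x A = 0}.
  exact: (@filter_forall _ _ (fun A x => L2_rep k x A = 0) (almost_everywhere m)
    (ae_filter_ringOfSetsType m) coef).
have := L2_rep0 Omega q.+1; move: all.
by apply: filterS2 => x h1 h2 A; rewrite h1 h2.
Qed.

Section Separating.
Context {q : nat}.
Hypothesis sep : test_separating q.

Lemma weak_d_unique (E : L2 Omega q) F F' : weak_d E F -> weak_d E F' -> F = F'.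
Proof.
move=> h h'; apply/eqP; rewrite -subr_eq0; apply/eqP; apply: (separatingS sep) => w tw.
rewrite -[F - F']addrC -scaleN1r form_pairing_lin; last exact: test_sqform tw.
by rewrite h // h' //; ring.
Qed.

Lemma extdP (E : L2 Omega q) : Dspace E -> weak_d E (extd E).
Proof. by move=> h; exact: (xgetPex 0 h). Qed.

Lemma extd_eq (E : L2 Omega q) F : weak_d E F -> extd E = F.
Proof. by move=> h; apply/esym/(weak_d_unique h); apply: extdP; exists F. Qed.

Lemma Dspace_lin a (E E' : L2 Omega q) : Dspace E -> Dspace E' ->
  Dspace (a *: E + E') /\ extd (a *: E + E') = a *: extd E + extd E'.
Proof.
move=> /extdP h /extdP h'; have H := weak_d_lin a h h'; split; last exact: extd_eq.
by exists (a *: extd E + extd E').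
Qed.

Lemma weak_delta_unique (H : L2 Omega q.+1) (K K' : L2 Omega q) :
  weak_delta H K -> weak_delta H K' -> K = K'.
Proof.
move=> h h'; apply/eqP; rewrite -subr_eq0; apply/eqP; apply: sep => w tw.
rewrite -[K - K']addrC -scaleN1r form_pairing_lin; last exact: test_sqform tw.
by rewrite h // h' //; ring.
Qed.

Lemma codiffP (H : L2 Omega q.+1) : Deltaspace H -> weak_delta H (codiff H).
Proof. by move=> h; exact: (xgetPex 0 h). Qed.

Lemma codiff_eq (H : L2 Omega q.+1) (K : L2 Omega q) : weak_delta H K -> codiff H = K.
Proof. by move=> h; apply/esym/(weak_delta_unique h); apply: codiffP; exists K. Qed.

Lemma Deltaspace_lin a (H H' : L2 Omega q.+1) : Deltaspace H -> Deltaspace H' ->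
  Deltaspace (a *: H + H') /\
  codiff (a *: H + H') = a *: (codiff H : L2 Omega q) + (codiff H' : L2 Omega q).
Proof.
move=> /codiffP h /codiffP h'; have hh := weak_delta_lin a h h'; split; last exact: codiff_eq.
by exists (a *: (codiff H : L2 Omega q) + (codiff H' : L2 Omega q)).
Qed.

End Separating.
End WeakDerivativeTheory.

(** * Upper integrals and images of functions of time *)

(** ** Integrals of possibly non-measurable functions *)

Lemma ge0_integral_mono d (T : measurableType d) (R : realType) (m : {measure set T -> \bar R})
    (D : set T) (f g : T -> \bar R) :
  (forall x, D x -> (0 <= f x)%E) -> (forall x, D x -> (f x <= g x)%E) ->
  (\int[m]_(x in D) f x <= \int[m]_(x in D) g x)%E.
Proof.
move=> f0 fg; have g0 x : D x -> (0 <= g x)%E by move=> Dx; rewrite (le_trans (f0 x Dx)) // fg.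
rewrite !ge0_integralE //; apply: ereal_sup_le => _ [h hf <-].
exists h => //= x; apply: le_trans (hf x) _.
by rewrite !patchE; case: ifPn => // /set_mem; exact: fg.
Qed.

(** The integral of g ^+ 2 is meant as an upper integral, the supremum of the integrals of
    simple functions below; f is first lowered to 0 on the exceptional null set. *)
Lemma Rintegral_le_ae d (T : measurableType d) (R : realType) (m : {measure set T -> \bar R})
    (D : set T) (f g : T -> R) (a b : R) : measurable D -> (m D < +oo)%E ->
  m.-integrable D (EFin \o f) -> 0 < a -> 0 <= b ->
  {ae m, forall x, D x -> f x <= a * g x ^+ 2 + b} ->
  (\int[m]_(x in D) (g x ^+ 2)%:E < +oo)%E ->
  \int[m]_(x in D) f x <= a * fine (\int[m]_(x in D) (g x ^+ 2)%:E) + b * fine (m D).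
Proof.
move=> mD Dfin fi a0 b0 [Z [mZ Z0 ZP]] gfin.
pose h x := Num.max 0 ((f x - b) / a).
have /integrableP[/measurable_EFinP mf _] := fi.
have cb : m.-integrable D (EFin \o (fun _ => b)).
  apply/integrableP; split; first exact: measurable_cst.
  by under eq_integral do rewrite /= ger0_norm //; rewrite integral_cst // lte_mul_pinfty // lee_fin.
have mh : measurable_fun D h.
  apply: measurable_maxr => //; apply: measurable_funM => //.
  by apply: measurable_funB.
have h0 x : 0 <= h x by rewrite /h le_max lexx.
have hi : m.-integrable D (EFin \o h).
  apply: (@le_integrable _ _ _ m D mD _ (EFin \o (fun x => a^-1 * (f x - b)))).
  - exact/measurable_EFinP.
  - move=> x Dx /=; rewrite lee_fin ger0_norm // /h mulrC.
    by rewrite ge_max normr_ge0 ler_norm.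
  - by apply: real_integrableZl => //; exact: real_integrableB.
have h1 : (\int[m]_(x in D) (h x)%:E <= \int[m]_(x in D) (g x ^+ 2)%:E)%E.
  have -> : (\int[m]_(x in D) (h x)%:E = \int[m]_(x in D) (h x * \1_(~` Z) x)%:E)%E.
    apply: ae_eq_integral => //.
    - exact/measurable_EFinP.
    - apply/measurable_EFinP; apply: measurable_funM => //.
      exact: (measurable_indic (measurableC mZ)).
    exists Z; split=> // x /= nx; apply: contrapT => nZ; apply: nx => Dx.
    by rewrite indicE mem_set // mulr1.
  apply: ge0_integral_mono => x Dx; rewrite lee_fin; first by rewrite mulr_ge0.
  rewrite indicE; have [xZ|xZ] := pselect (Z x).
    by rewrite memNset ?mulr0 ?sqr_ge0 //; apply.
  rewrite mem_set // mulr1 /h ge_max sqr_ge0 /= ler_pdivrMr // lerBlDr mulrC.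
  by have [//|nP] := pselect (f x <= a * g x ^+ 2 + b); case: xZ; apply: ZP => /(_ Dx).
have h2 : \int[m]_(x in D) h x <= fine (\int[m]_(x in D) (g x ^+ 2)%:E).
  by apply: fine_le => //; [exact: integrable_fin_num|rewrite ge0_fin_numE // integral_ge0 // => x
    _; rewrite lee_fin sqr_ge0].
apply: (@le_trans _ _ (a * \int[m]_(x in D) h x + b * fine (m D))); last first.
  by rewrite lerD2r ler_pM2l.
rewrite -RintegralZl // -Rintegral_cst // -RintegralD //; last exact: real_integrableZl.
apply: le_Rintegral => //; first by apply: real_integrableD => //; exact: real_integrableZl.
move=> x _; rewrite /h -lerBlDr -ler_pdivrMl // mulrC.
by rewrite le_max lexx orbT.
Qed.

(** ** Bounded linear images of functions of time *)

Section LinearImages.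
Context {R : realType} {X Y : lmodType R[i]} {nX : X -> R} {nY : Y -> R} {T : R}.
Variables (L : X -> Y) (c : R).
Hypothesis nY0 : forall y, 0 <= nY y.
Hypothesis Llin : linear L.
Hypothesis Lc : forall x, nY (L x) <= c * nX x.

Lemma linear_propB x y : L (x - y) = L x - L y.
Proof. by rewrite -[x - y]addrC -scaleN1r Llin scaleN1r addrC. Qed.

Lemma linear_propZ a x : L (a *: x) = a *: L x.
Proof.
have L0 : L 0 = 0 by rewrite -[0 in LHS](subrr 0) linear_propB subrr.
by rewrite -[a *: x]addr0 Llin L0 addr0.
Qed.

Lemma bounded_image_cvg {S : Type} (G : set_system S) (FG : ProperFilter G) (u : S -> X) l :
  (fun s => nX (u s - l)) @ G --> (0 : R) -> (fun s => nY (L (u s) - L l)) @ G --> (0 : R).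
Proof.
move=> ul; apply: (@squeeze_cvgr _ _ _ _ (cst 0) (fun s => c * nX (u s - l))).
- by apply: nearW => s; rewrite nY0 -linear_propB Lc.
- exact: cvg_cst.
- by rewrite -[0](mulr0 c); apply: cvgMr.
Qed.

Lemma bounded_image_tder (u : R -> X) t v : 0 < T -> t \in `[0, T] ->
  is_tderiv nX T u t v -> is_tderiv nY T (fun s => L (u s)) t (L v).
Proof.
move=> T0 tT uv; have FF := near0T_proper T0 tT.
have h := bounded_image_cvg FF uv; apply: cvg_trans h; apply: near_eq_cvg.
by apply: nearW => s; rewrite linear_propZ linear_propB.
Qed.

End LinearImages.

Lemma vcont_eq {R : realType} {X : lmodType R[i]} {ip : X -> X -> R[i]} (T : R) (u v : R -> X) :
  (forall t, t \in `[0, T] -> u t = v t) -> vcont ip T u -> vcont ip T v.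
Proof.
move=> uv /vcontP uc; apply/vcontP => t tT e e0; have [d d0 h] := uc t tT e e0.
by exists d => // r rT tr; rewrite -!uv //; exact: h.
Qed.

Lemma bounded_image_vcont {R : realType} {X Y : lmodType R[i]} {ipX : X -> X -> R[i]}
    {ipY : Y -> Y -> R[i]} (L : X -> Y) (c T : R) (u : R -> X) : linear L ->
  (forall x, ip_norm ipY (L x) <= c * ip_norm ipX x) ->
  vcont ipX T u -> vcont ipY T (fun s => L (u s)).
Proof.
move=> Ll Lc uc t tT; have FF := within_itv_proper tT.
apply: (bounded_image_cvg (nX := ip_norm ipX) _ Ll Lc) => //; last exact: uc.
by move=> y; exact: nrm_ge0.
Qed.

(** * The energy space and the Maxwell operator *)

Lemma sqrt_add_sqr_le (R : realType) (a b : R) : 0 <= a -> 0 <= b -> Num.sqrt (a ^+ 2 + b ^+ 2) <= a + b.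
Proof.
move=> a0 b0; rewrite -ler_sqr ?nnegrE ?sqrtr_ge0 ?addr_ge0 // sqr_sqrtr ?addr_ge0 ?sqr_ge0 //.
by rewrite sqrrD -addrA lerD2l lerDr mulrn_wge0 // mulr_ge0.
Qed.

Lemma le_sqrt_add_sqr (R : realType) (a b : R) : 0 <= a -> 0 <= b ->
  a <= Num.sqrt (a ^+ 2 + b ^+ 2) /\ b <= Num.sqrt (a ^+ 2 + b ^+ 2).
Proof.
move=> a0 b0; split; rewrite -ler_sqr ?nnegrE ?sqrtr_ge0 // sqr_sqrtr ?addr_ge0 ?sqr_ge0 //.
  by rewrite lerDl sqr_ge0.
by rewrite lerDr sqr_ge0.
Qed.

Section MaxwellSpace.
Context {R : realType} {N : nat} {Omega : set 'rV[R]_N} {q : nat} {eps mu : coefficient R N}.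
Context {ce Ce cm Cm : R}.
Local Notation X := (Hspace Omega q).
Local Notation nX := (Hspace_norm eps mu).
Hypothesis He : @coercive_operator R (L2 Omega q) (@L2_ip R N Omega q) (coeff_op eps) ce Ce.
Hypothesis Hm : @coercive_operator R (L2 Omega q.+1) (@L2_ip R N Omega q.+1) (coeff_op mu) cm Cm.
Let Lq := L2_hilbert Omega q.
Let Lq1 := L2_hilbert Omega q.+1.

(** Ellipticity of the coefficients makes the weighted space a Hilbert space. *)
Lemma Hspace_hilbert : hilbert_space (@Hspace_ip R N Omega q eps mu).
Proof. exact: (prod_hilbert (coercive_hilbert Lq He) (coercive_hilbert Lq1 Hm)). Qed.

Lemma Hspace_norm_equiv : exists k K, [/\ 0 < k, 0 < K,
  forall u : X, L2_norm u.1 <= k * nX u, forall u : X, L2_norm u.2 <= k * nX u &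
  forall u : X, nX u <= K * (L2_norm u.1 + L2_norm u.2)].
Proof.
have [ce0 Ce0] := (coercive_gt0 He, coercive_bound_gt0 He).
have [cm0 Cm0] := (coercive_gt0 Hm, coercive_bound_gt0 Hm).
have sce : 0 < Num.sqrt ce by rewrite sqrtr_gt0.
have scm : 0 < Num.sqrt cm by rewrite sqrtr_gt0.
pose n1 := ip_norm (fun x y : L2 Omega q => L2_ip (coeff_op eps x) y).
pose n2 := ip_norm (fun x y : L2 Omega q.+1 => L2_ip (coeff_op mu x) y).
have l1 (x : L2 Omega q) : Num.sqrt ce * L2_norm x <= n1 x.
  rewrite -ler_sqr ?nnegrE ?mulr_ge0 ?sqrtr_ge0 // exprMn (sqr_sqrtr (ltW ce0)).
  exact: coercive_nrm_ge He x.
have l2 (x : L2 Omega q.+1) : Num.sqrt cm * L2_norm x <= n2 x.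
  rewrite -ler_sqr ?nnegrE ?mulr_ge0 ?sqrtr_ge0 // exprMn (sqr_sqrtr (ltW cm0)).
  exact: coercive_nrm_ge Hm x.
have g1 (x : L2 Omega q) : n1 x <= Num.sqrt Ce * L2_norm x.
  rewrite -ler_sqr ?nnegrE ?mulr_ge0 ?sqrtr_ge0 // exprMn (sqr_sqrtr (ltW Ce0)).
  by have := coercive_nrm_le Lq He x.
have g2 (x : L2 Omega q.+1) : n2 x <= Num.sqrt Cm * L2_norm x.
  rewrite -ler_sqr ?nnegrE ?mulr_ge0 ?sqrtr_ge0 // exprMn (sqr_sqrtr (ltW Cm0)).
  by have := coercive_nrm_le Lq1 Hm x.
have H1 := coercive_hilbert Lq He; have H2 := coercive_hilbert Lq1 Hm.
pose k := (Num.sqrt ce)^-1 + (Num.sqrt cm)^-1; pose K := Num.sqrt Ce + Num.sqrt Cm.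
have [ice icm] : 0 < (Num.sqrt ce)^-1 /\ 0 < (Num.sqrt cm)^-1 by rewrite !invr_gt0.
have [sCe sCm] : 0 < Num.sqrt Ce /\ 0 < Num.sqrt Cm by rewrite !sqrtr_gt0.
have nX0 u : 0 <= nX u by exact: sqrtr_ge0.
have [n10 n20] : (forall x : L2 Omega q, 0 <= L2_norm x) /\ (forall x : L2 Omega q.+1, 0 <= L2_norm x).
  by split=> x; exact: sqrtr_ge0.
exists k, K; split; [by rewrite addr_gt0|by rewrite addr_gt0|move=> u|move=> u|move=> u].
- have h : Num.sqrt ce * L2_norm u.1 <= nX u := le_trans (l1 u.1) (prod_nrm_ge1 H1 H2 u).
  rewrite mulrC -ler_pdivlMr // in h; apply: le_trans h _.
  by rewrite mulrC ler_wpM2r // lerDl ltW.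
- have h : Num.sqrt cm * L2_norm u.2 <= nX u := le_trans (l2 u.2) (prod_nrm_ge2 H1 H2 u).
  rewrite mulrC -ler_pdivlMr // in h; apply: le_trans h _.
  by rewrite mulrC ler_wpM2r // lerDr ltW.
- apply: le_trans (prod_nrm_le H1 H2 u) _.
  apply: le_trans (lerD (g1 u.1) (g2 u.2)) _; rewrite mulrDr.
  by apply: lerD; rewrite ler_wpM2r // ?lerDl ?lerDr ltW.
Qed.

Lemma coeff_invK_eps (y : L2 Omega q) : coeff_op eps (coeff_inv eps y) = y.
Proof. exact: (@xgetPex _ 0 [set x | coeff_op eps x = y] (coercive_surj Lq He y)). Qed.

Lemma coeff_invK_mu (y : L2 Omega q.+1) : coeff_op mu (coeff_inv mu y) = y.
Proof. exact: (@xgetPex _ 0 [set x | coeff_op mu x = y] (coercive_surj Lq1 Hm y)). Qed.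

Lemma coeff_inv_eps_lin : linear (coeff_inv eps : L2 Omega q -> L2 Omega q).
Proof.
move=> a x y; apply: (coercive_inj Lq He).
by rewrite (coercive_linear He) !coeff_invK_eps.
Qed.

Lemma coeff_inv_mu_lin : linear (coeff_inv mu : L2 Omega q.+1 -> L2 Omega q.+1).
Proof.
move=> a x y; apply: (coercive_inj Lq1 Hm).
by rewrite (coercive_linear Hm) !coeff_invK_mu.
Qed.

Lemma coeff_inv_eps_le (y : L2 Omega q) : L2_norm (coeff_inv eps y) <= ce^-1 * L2_norm y.
Proof.
rewrite -(ler_pM2l (coercive_gt0 He)) mulrA mulfV ?mul1r; last exact: lt0r_neq0 (coercive_gt0 He).
by have := coercive_le Lq He (coeff_inv eps y); rewrite coeff_invK_eps.
Qed.

Lemma coeff_inv_mu_le (y : L2 Omega q.+1) : L2_norm (coeff_inv mu y) <= cm^-1 * L2_norm y.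
Proof.
rewrite -(ler_pM2l (coercive_gt0 Hm)) mulrA mulfV ?mul1r; last exact: lt0r_neq0 (coercive_gt0 Hm).
by have := coercive_le Lq1 Hm (coeff_inv mu y); rewrite coeff_invK_mu.
Qed.

(** [maxwell_gen u] is - i times the Maxwell operator at u. *)
Definition maxwell_gen (u : X) : X := (coeff_inv eps (codiff u.2), coeff_inv mu (extd u.1)).

Lemma maxwell_genE (u : X) : - 'i *: maxwell eps mu u = maxwell_gen u.
Proof.
rewrite /maxwell scalerA (_ : - 'i * (0 +i* 1) = 1) ?scale1r //.
by apply: complex_ext; rewrite ?ReM ?ImM ?ReN ?ImN /=; ring.
Qed.

(** The domain of a selfadjoint operator is dense, and the electric fields of its elements
    are limits of test forms: no other nonzero form is orthogonal to all of these. *)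
Lemma maxwell_dense_separating :
  (forall (x : X) e, 0 < e -> exists2 y : X, maxwell_dom y & nX (x - y) < e) ->
  @test_separating R N Omega q.
Proof.
move=> dense; apply: dense_separating => E e e0.
have [k [K [k0 _ n1 _ _]]] := Hspace_norm_equiv.
have ek : 0 < e / 2 / k by rewrite !divr_gt0.
have [[E' H'] [[_ E'0] _]] := dense (E, 0) _ ek; rewrite ltr_pdivlMr // mulrC => h.
have h1 : L2_norm (E - E') < e / 2 := le_lt_trans (n1 ((E, 0) - (E', H'))) h.
have e2 : 0 < e / 2 by rewrite divr_gt0.
have [w tw h2] := E'0 _ e2; exists w => //.
apply: le_lt_trans (nrm_triangle Lq E' _ _) _; rewrite (splitr e); apply: ltrD; first exact: h1.
apply: le_lt_trans h2.
by have [] := @le_sqrt_add_sqr _ (L2_norm (E' - L2_class Omega q w))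
  (L2_norm (extd (E' - L2_class Omega q w))) (sqrtr_ge0 _) (sqrtr_ge0 _).
Qed.

Hypothesis sep : @test_separating R N Omega q.

Lemma maxwell_gen_lin (a : R[i]) (u v : X) : graph_dom u -> graph_dom v ->
  maxwell_gen (a *: u + v) = a *: maxwell_gen u + maxwell_gen v.
Proof.
move=> [u1 u2] [v1 v2]; rewrite /maxwell_gen /=.
have [_ ->] := Dspace_lin sep a u1 v1; have [_ ->] := Deltaspace_lin sep a u2 v2.
by rewrite coeff_inv_mu_lin coeff_inv_eps_lin.
Qed.

Lemma maxwell_gen_sub (u v : X) : graph_dom u -> graph_dom v -> maxwell_gen (u - v) = maxwell_gen u
  - maxwell_gen v.
Proof.
by move=> du dv; rewrite addrC -scaleN1r maxwell_gen_lin // scaleN1r addrC.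
Qed.

Lemma graph_norm_le (u : X) : graph_norm u <=
  L2_norm u.1 + L2_norm (extd u.1) + (L2_norm u.2 + L2_norm (codiff u.2)).
Proof.
apply: le_trans (sqrt_add_sqr_le (sqrtr_ge0 _) (sqrtr_ge0 _)) _.
by apply: lerD; apply: sqrt_add_sqr_le; exact: sqrtr_ge0.
Qed.

Lemma extd_le_graph_norm (u : X) : L2_norm (extd u.1) <= graph_norm u.
Proof.
have [h _] := le_sqrt_add_sqr (sqrtr_ge0 _ : 0 <= Dspace_norm u.1) (sqrtr_ge0 _ : 0 <=
  Deltaspace_norm u.2).
apply: le_trans h; have [_] := @le_sqrt_add_sqr _ (L2_norm u.1) (L2_norm (extd u.1)) (sqrtr_ge0 _)
  (sqrtr_ge0 _).
exact.
Qed.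

Lemma codiff_le_graph_norm (u : X) : L2_norm (codiff u.2) <= graph_norm u.
Proof.
have [_ h] := le_sqrt_add_sqr (sqrtr_ge0 _ : 0 <= Dspace_norm u.1) (sqrtr_ge0 _ : 0 <=
  Deltaspace_norm u.2).
apply: le_trans h; have [_] := @le_sqrt_add_sqr _ (L2_norm u.2) (L2_norm (codiff u.2)) (sqrtr_ge0
  _) (sqrtr_ge0 _).
exact.
Qed.

End MaxwellSpace.

(** * Splitting off the boundary values *)

Section MaxwellEvolution.
Context {R : realType} {N q : nat} {Omega : set 'rV[R]_N} {eps mu : coefficient R N}.
Context {ce Ce cm Cm : R}.
Local Notation X := (Hspace Omega q).
Local Notation ip := (@Hspace_ip R N Omega q eps mu).
Local Notation nX := (@Hspace_norm R N Omega q eps mu).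
Local Notation ipq := (@L2_ip R N Omega q).
Local Notation ipq1 := (@L2_ip R N Omega q.+1).
Hypothesis He : @coercive_operator R (L2 Omega q) ipq (coeff_op eps) ce Ce.
Hypothesis Hm : @coercive_operator R (L2 Omega q.+1) ipq1 (coeff_op mu) cm Cm.
Context {P : set R -> X -> X}.
Hypothesis P_resolution : spectral_resolution ip P (@maxwell_dom R N Omega q) (maxwell eps mu).
Context {V : lmodType R[i]} {ipV : V -> V -> R[i]}.
Hypothesis V_hilbert : hilbert_space ipV.
Context {tau : L2 Omega q -> V}.
Hypothesis tau_trace : tangential_trace ipV tau.
Context {ext : {linear V -> L2 Omega q}}.
Hypothesis ext_tau : trace_extension eps ipV tau ext.
Context {T : R}.
Hypothesis T_gt0 : 0 < T.
Context {lambda : R -> V}.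
Hypothesis lambda_C1 : is_C1 (ip_norm ipV) T lambda.
Context {E0 : L2 Omega q} {H0 : L2 Omega q.+1} {F : R -> L2 Omega q} {G : R -> L2 Omega q.+1}.
Hypothesis EH0_dom : Dspace E0 /\ Deltaspace H0.
Hypothesis FG_C0 : is_C0 setT nX T (fun t => (F t, G t) : X).
Hypothesis FG_L2 : is_L2 (@graph_dom R N Omega q) (@graph_norm R N Omega q) `]0, T[
     (fun t => (F t, G t) : X).
Hypothesis F_lambda : {ae lebesgue_measure, forall t, t \in `]0, T[ ->
     tau (F t) = tderiv (ip_norm ipV) T lambda t}.
Hypothesis E0_lambda : tau E0 = lambda 0.

Let HX : hilbert_space ip := Hspace_hilbert He Hm.
Let Lq := L2_hilbert Omega q.
Let Lq1 := L2_hilbert Omega q.+1.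
Let HP : projection_measure ip P. Proof. by case: P_resolution. Qed.
Let domE : forall x, maxwell_dom x <-> (\int[spectral_measure ip P x]_l (l ^+ 2)%:E < +oo)%E.
Proof. by case: P_resolution. Qed.
Let AE : forall x y : X, maxwell_dom x -> maxwell_dom y ->
  ip (maxwell eps mu x) y = spectral_integral ip P (fun l => l%:C) x y.
Proof. by case: P_resolution. Qed.

Local Notation dLambda := (tderiv (ip_norm ipV) T lambda).
Local Notation maxwell_gen := (@maxwell_gen R N Omega q eps mu).

Lemma maxwell_dom_graph (u : X) : maxwell_dom u -> graph_dom u.
Proof. by move=> [[Du _] du]. Qed.

(** Spectral projections onto bounded sets map into the domain and converge to the identity. *)
Lemma maxwell_separating : @test_separating R N Omega q.
Proof.
apply: (maxwell_dense_separating He Hm) => x e e0.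
have := pcut_cvg HX HP x; rewrite /vcvg => /cvgrPdist_lt /(_ e e0)[n _ nP].
exists (pcut P n x); first exact (pcut_dom HX HP domE n x).
have := nP n (leqnn n); rewrite /= sub0r normrN ger0_norm ?nrm_ge0 //.
by rewrite (nrmC HX).
Qed.
Let sep := maxwell_separating.

Lemma tau_lin (a : R[i]) E E' : Dspace E -> Dspace E' -> tau (a *: E + E') = a *: tau E + tau E'.
Proof. exact: (trace_linear tau_trace). Qed.

Lemma tau_sub E E' : Dspace E -> Dspace E' -> tau (E - E') = tau E - tau E'.
Proof. by move=> h h'; rewrite [E - E']addrC -[- E']scaleN1r tau_lin // scaleN1r addrC. Qed.

Lemma Dspace_sub (E E' : L2 Omega q) : Dspace E -> Dspace E' ->
  Dspace (E - E') /\ extd (E - E') = extd E - extd E'.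
Proof.
move=> h h'; have [h1 h2] := Dspace_lin sep (-1) h' h.
by move: h1 h2; rewrite !scaleN1r ![- _ + _]addrC.
Qed.

(** Fields with equal traces differ by an element of the kernel of the trace, which is the
    first component of the domain. *)
Lemma trace_dom_sub (E E' : L2 Omega q) (H H' : L2 Omega q.+1) :
  Dspace E -> Dspace E' -> tau E = tau E' -> Deltaspace H -> maxwell_dom (E - E', H).
Proof.
move=> DE DE' EE dH; split=> //; have [DD _] := Dspace_sub DE DE'.
by apply/(trace_kernel tau_trace DD); rewrite tau_sub // EE subrr.
Qed.

Lemma ext_D v : Dspace (ext v). Proof. by have [] := ext_dom ext_tau v. Qed.

Lemma extd_ext_lin : linear (fun v => extd (ext v)).
Proof. by move=> a v w; rewrite linearP; have [_ ->] := Dspace_lin sep a (ext_D v) (ext_D w). Qed.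

Lemma ext_lin : linear ext. Proof. exact: linearP. Qed.

Lemma ext_norms : exists2 c, 0 <= c & forall v, L2_norm (ext v) <= c * ip_norm ipV v /\
  L2_norm (extd (ext v)) <= c * ip_norm ipV v.
Proof.
have [c cP] := ext_bounded ext_tau; exists `|c| => [|v]; first exact: normr_ge0.
have le1 : Dspace_norm (ext v) <= `|c| * ip_norm ipV v.
  apply: (@le_trans _ _ (c * ip_norm ipV v)); last by rewrite ler_wpM2r ?nrm_ge0 ?ler_norm.
  apply: le_trans (cP v).
  by have [] := @le_sqrt_add_sqr _ (Dspace_norm (ext v)) (Deltaspace_norm (coeff_op eps (ext v)))
    (sqrtr_ge0 _) (sqrtr_ge0 _).
have [h1 h2] := @le_sqrt_add_sqr _ (L2_norm (ext v)) (L2_norm (extd (ext v)))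
  (sqrtr_ge0 _) (sqrtr_ge0 _).
by split; apply: le_trans le1.
Qed.

Lemma lambda_der t : t \in `[0, T] -> is_tderiv (ip_norm ipV) T lambda t (dLambda t).
Proof. by move=> tT; have [h _] := lambda_C1; exact: (xgetPex 0 (h t tT)). Qed.

Lemma dLambda_cont : vcont ipV T dLambda.
Proof. by have [_ h] := lambda_C1; apply/is_C0P. Qed.

Lemma extLambda_der t : t \in `[0, T] ->
  is_tderiv (@L2_norm R N Omega q) T (fun r => ext (lambda r)) t (ext (dLambda t)).
Proof.
move=> tT; have [c c0 cP] := ext_norms.
apply: (bounded_image_tder (nX := ip_norm ipV) (c := c) _ ext_lin) => //.
- by move=> y; exact: sqrtr_ge0.
- by move=> v; have [] := cP v.
- exact: lambda_der.
Qed.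

Lemma extLambda_derE t : t \in `[0, T] ->
  tderiv (@L2_norm R N Omega q) T (fun r => ext (lambda r)) t = ext (dLambda t).
Proof. by move=> tT; apply: (tderivE Lq T_gt0 tT); exact: extLambda_der. Qed.

(** After subtracting the extension (ext lambda, 0) of the boundary values, the source is
    (F - d/dt ext lambda, G + mu^-1 d ext lambda). Its two parts have different reasons to
    be admissible: [shifted_source] has vanishing trace and is square integrable with values
    in the domain, whereas nothing bounds mu^-1 d ext lambda in the domain; [curl_source]
    is instead continuously differentiable in time. *)
Definition shifted_source s : X :=
  (F s - tderiv (@L2_norm R N Omega q) T (fun r => ext (lambda r)) s, G s).
Definition curl_source (v : V) : X := (0, coeff_inv mu (extd (ext v))).
Definition trace_field (v : V) : X := (ext v, 0).

Lemma trace_field_lin : linear trace_field.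
Proof. by move=> a v w; rewrite /trace_field linearP; congr (_, _); rewrite /= scaler0 addr0. Qed.

Lemma curl_source_lin : linear curl_source.
Proof.
move=> a v w; rewrite /curl_source extd_ext_lin (coeff_inv_mu_lin Hm).
by congr (_, _); rewrite /= scaler0 addr0.
Qed.

Lemma trace_field_le : exists c, forall v, nX (trace_field v) <= c * ip_norm ipV v /\
  nX (curl_source v) <= c * ip_norm ipV v.
Proof.
have [k [K [_ K0 _ _ nK]]] := Hspace_norm_equiv He Hm.
have [c c0 cP] := ext_norms; have cm0 := coercive_gt0 Hm.
exists (K * c * (1 + cm^-1)) => v; have [h1 h2] := cP v.
have n0 := @nrm_ge0 _ _ ipV v; have icm : 0 < cm^-1 by rewrite invr_gt0.
have Kc : 0 <= K * c * ip_norm ipV v by rewrite !mulr_ge0 // ltW.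
split.
  apply: le_trans (nK (trace_field v)) _; rewrite /= (nrm0 Lq1 : L2_norm 0 = 0) addr0.
  apply: (@le_trans _ _ (K * c * ip_norm ipV v)); first by rewrite -mulrA ler_pM2l.
  by rewrite [leRHS]mulrAC ler_peMr // lerDl ltW.
apply: le_trans (nK (curl_source v)) _; rewrite /= (nrm0 Lq : L2_norm 0 = 0) add0r.
apply: (@le_trans _ _ (K * c * ip_norm ipV v * cm^-1)); last first.
  by rewrite [leRHS]mulrAC ler_wpM2l // lerDr.
rewrite -!mulrA ler_pM2l // mulrA mulrC; apply: le_trans (coeff_inv_mu_le Hm _) _.
by rewrite ler_pM2l.
Qed.

Lemma trace_field_der t : t \in `[0, T] ->
  is_tderiv nX T (fun r => trace_field (lambda r)) t (trace_field (dLambda t)).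
Proof.
move=> tT; have [c cP] := trace_field_le.
apply: (bounded_image_tder (nX := ip_norm ipV) (c := c) _ trace_field_lin) => //.
- by move=> y; exact: sqrtr_ge0.
- by move=> v; have [] := cP v.
- exact: lambda_der.
Qed.

Lemma curl_source_der t : t \in `[0, T] ->
  is_tderiv nX T (fun r => curl_source (lambda r)) t (curl_source (dLambda t)).
Proof.
move=> tT; have [c cP] := trace_field_le.
apply: (bounded_image_tder (nX := ip_norm ipV) (c := c) _ curl_source_lin) => //.
- by move=> y; exact: sqrtr_ge0.
- by move=> v; have [] := cP v.
- exact: lambda_der.
Qed.

Lemma curl_source_der_cont : vcont ip T (fun r => curl_source (dLambda r)).
Proof.
have [c cP] := trace_field_le.
apply: (bounded_image_vcont (c := c) curl_source_lin) dLambda_cont => v; by have [] := cP v.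
Qed.

Lemma FG_cont : vcont ip T (fun t => (F t, G t) : X).
Proof. exact/is_C0P. Qed.

Lemma shifted_sourceE t : t \in `[0, T] -> shifted_source t = ((F t, G t) : X) - trace_field (dLambda t).
Proof. by move=> tT; rewrite /shifted_source extLambda_derE //; congr (_, _); rewrite /= subr0. Qed.

Lemma shifted_source_cont : vcont ip T shifted_source.
Proof.
have [c cP] := trace_field_le.
apply: (vcont_eq (u := fun t => ((F t, G t) : X) - trace_field (dLambda t))).
  by move=> t tT; rewrite shifted_sourceE.
apply: (vcontB HX); first exact: FG_cont.
apply: (bounded_image_vcont (c := c) trace_field_lin) dLambda_cont => v; by have [] := cP v.
Qed.

Lemma initial_dom : maxwell_dom ((E0 - ext (lambda 0), H0) : X).
Proof.
have [DE dH] := EH0_dom; apply: trace_dom_sub => //; first exact: ext_D.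
by rewrite (ext_right_inverse ext_tau).
Qed.

(** Almost everywhere, the trace condition on F puts the shifted source into the domain of
    the Maxwell operator, with a norm controlled by that of (F, G) in the graph space, up to
    a constant bounding the extension of the continuous boundary velocity. *)
Lemma shifted_source_gen : exists c b, [/\ 0 < c, 0 <= b & {ae lebesgue_measure, forall t, t \in
  `]0, T[ ->
  maxwell_dom (shifted_source t) /\
  nX (maxwell eps mu (shifted_source t)) ^+ 2 <= c * graph_norm ((F t, G t) : X) ^+ 2 + b}].
Proof.
have [k [K [_ K0 _ _ nK]]] := Hspace_norm_equiv He Hm.
have [ce0 cm0] := (coercive_gt0 He, coercive_gt0 Hm).
have [ice icm] : 0 < ce^-1 /\ 0 < cm^-1 by rewrite !invr_gt0.
have [d d0 dP] := ext_norms.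
have [B BP] := vcont_bounded V_hilbert (ltW T_gt0) dLambda_cont.
have B0 : 0 <= B.
  by apply: le_trans (BP 0 _); [exact: nrm_ge0|rewrite in_itv /= lexx ltW].
pose a := K * (ce^-1 + cm^-1); have a0 : 0 < a by rewrite mulr_gt0 // addr_gt0.
pose b := K * cm^-1 * (d * B); have b0 : 0 <= b by rewrite !mulr_ge0 // ltW.
exists (2 * a ^+ 2), (2 * b ^+ 2); split.
- by rewrite mulr_gt0 // exprn_gt0.
- by rewrite mulr_ge0 // sqr_ge0.
have [[aedom _] _] := FG_L2; apply: (@filterS2 _ _ (ae_filter_ringOfSetsType lebesgue_measure) _ _
  _ _ aedom F_lambda) => t dFG FL tT.
have tT' : t \in `[0, T] by exact: itv_oo_cc.
have [DF dG] : graph_dom ((F t, G t) : X) by apply: dFG; rewrite /= tT.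
have S1 : shifted_source t = (F t - ext (dLambda t), G t) by rewrite /shifted_source extLambda_derE.
split.
  rewrite S1; apply: trace_dom_sub => //; first exact: ext_D.
  by rewrite (ext_right_inverse ext_tau) FL.
set g := graph_norm _.
have h : nX (maxwell eps mu (shifted_source t)) <= a * g + b.
  have -> : nX (maxwell eps mu (shifted_source t)) = nX (maxwell_gen (shifted_source t)).
    by rewrite -maxwell_genE scaleNr /Hspace_norm (nrmN HX) [RHS](nrm_i HX).
  apply: le_trans (nK _) _; rewrite S1 /maxwell_gen /=.
  have [_ ->] := Dspace_sub DF (ext_D (dLambda t)).
  have e1 : L2_norm (coeff_inv eps (codiff (G t) : L2 Omega q)) <= ce^-1 * g.
    apply: le_trans (coeff_inv_eps_le He _) _.
    by rewrite ler_pM2l // (codiff_le_graph_norm ((F t, G t) : X)).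
  have e2 : L2_norm (coeff_inv mu (extd (F t) - extd (ext (dLambda t)))) <= cm^-1 * (g + d * B).
    apply: le_trans (coeff_inv_mu_le Hm _) _; rewrite ler_pM2l //.
    apply: le_trans (nrmB Lq1 _ _) _; apply: lerD.
      exact: (extd_le_graph_norm ((F t, G t) : X)).
    have [_ h] := dP (dLambda t); apply: le_trans h _.
    by rewrite ler_wpM2l // BP.
  apply: le_trans (_ : _ <= K * (ce^-1 * g + cm^-1 * (g + d * B))) _.
    by rewrite ler_pM2l //; apply: lerD.
  by rewrite /a /b le_eqVlt; apply/orP; left; apply/eqP; ring.
have g0 : 0 <= g by exact: sqrtr_ge0.
have n0 : 0 <= nX (maxwell eps mu (shifted_source t)) by exact: sqrtr_ge0.
move: h n0; set n := nX _ => h n0.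
have h2 : n ^+ 2 <= (a * g + b) ^+ 2 by rewrite ler_sqr // nnegrE (le_trans n0).
have h3 := sqr_ge0 (a * g - b).
by apply: le_trans h2 _; lra.
Qed.

(** The spectral cutoffs are contractions, so that the previous bound integrates. The squared
    graph norm is only integrable in the sense of an upper integral. *)
Lemma shifted_source_energy : exists C, forall n, cut_energy ip P T shifted_source n <= C.
Proof.
have [c [b [c0 b0 ae]]] := shifted_source_gen; have [_ FGfin] := FG_L2.
have lT : (lebesgue_measure (`]0%R, T[%classic : set R) < +oo)%E.
  by rewrite lebesgue_measure_itv /= lte_fin T_gt0 ltry.
have mI : measurable (`]0%R, T[%classic : set R) by exact: measurable_itv.
exists (c * fine (\int[lebesgue_measure]_(t in `]0%R, T[) (graph_norm ((F t, G t) : X) ^+ 2)%:E) +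
  b * fine (lebesgue_measure (`]0%R, T[%classic : set R))) => n.
have fi := cont_integrable (cont_sqr HX (vcont_lip (@lcut_lip _ _ _ _ HX HP n) shifted_source_cont)).
have le : {ae lebesgue_measure, forall t, (`]0%R, T[%classic : set R) t ->
    nX (lcut ip P n (shifted_source t)) ^+ 2 <= c * graph_norm ((F t, G t) : X) ^+ 2 + b}.
  apply: (@filterS _ _ (ae_filter_ringOfSetsType lebesgue_measure) _ _ _ ae) => t h tT.
  have [dt nt] := h tT; apply: le_trans nt.
  rewrite -(pcut_A HX HP domE AE) // ler_sqr ?nnegrE ?nrm_ge0 //.
  by apply: (nrm_pm HX HP); exact: measurable_cutoff.
exact: (@Rintegral_le_ae _ _ R (@lebesgue_measure R) _ _ (fun t => graph_norm ((F t, G t) : X)) c b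
  mI lT fi c0 b0 le FGfin).
Qed.

(** Duhamel's formula for the problem with homogeneous boundary condition. *)
Definition mild_part t : X := ugroup ip P t ((E0 - ext (lambda 0), H0) : X) +
  bochner_integral nX `]0, t[ (fun s => ugroup ip P (t - s) (shifted_source s + curl_source (lambda s))).

Lemma mild_part_spec :
  (forall t, t \in `[0, T] -> maxwell_dom (mild_part t) /\
     is_tderiv nX T mild_part t (maxwell_gen (mild_part t) + (shifted_source t + curl_source
       (lambda t)))) /\
  vcont ip T (fun t => maxwell_gen (mild_part t)).
Proof.
have [C CP] := shifted_source_energy.
have [h1 h2] := evolution_exists HX HP domE AE T_gt0 initial_dom shifted_source_cont
  curl_source_der_cont CP curl_source_der.
split=> [t tT|]; first by have [d h] := h1 t tT; split; [exact: d|rewrite -maxwell_genE; exact: h].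
have := vcont_lip (Y := fun x => - 'i *: x) (c := 1) _ h2.
rewrite (_ : (fun s => _) = fun t => maxwell_gen (mild_part t)); first apply.
  by move=> x y; rewrite -scalerBr scaleNr (nrmN HX) (nrm_i HX) mul1r.
by apply/funext => t; rewrite maxwell_genE.
Qed.

Lemma curl_source_cont : vcont ip T (fun t => curl_source (lambda t)).
Proof. by apply: (vcont_tder HX T_gt0) => t tT; eexists; exact: curl_source_der. Qed.

Lemma mild_part0 : mild_part 0 = (E0 - ext (lambda 0), H0).
Proof.
rewrite /mild_part (ugroup0 HX HP).
have := @vint0 _ _ _ HX T T_gt0 (fun s => ugroup ip P (0 - s) (shifted_source s + curl_source
  (lambda s))).
rewrite vint.unlock => ->; first by rewrite addr0.
apply: (vcont_ugroup HX HP).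
  by move=> x; apply: cvgB; [exact: cvg_cst|exact: cvg_id].
by apply: (vcontD HX); [exact: shifted_source_cont|exact: curl_source_cont].
Qed.

(** ** The boundary values are split off *)

Section Solution.
Variable v : R -> X.
Hypothesis v_spec : forall t, t \in `[0, T] -> maxwell_dom (v t) /\
  is_tderiv nX T v t (maxwell_gen (v t) + (shifted_source t + curl_source (lambda t))).
Hypothesis v_cont : vcont ip T (fun t => maxwell_gen (v t)).
Hypothesis v0 : v 0 = (E0 - ext (lambda 0), H0).

Definition solution t : X := trace_field (lambda t) + v t.

Lemma solution_dom t : t \in `[0, T] -> graph_dom (solution t).
Proof.
move=> tT; have [d _] := v_spec tT.
have [D1 D2] := maxwell_dom_graph d; split.
  have [] := Dspace_lin sep 1 (ext_D (lambda t)) D1; rewrite scale1r.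
  by move=> hD _.
by rewrite /= add0r.
Qed.

Lemma maxwell_gen_solution t : t \in `[0, T] ->
  maxwell_gen (solution t) = curl_source (lambda t) + maxwell_gen (v t).
Proof.
move=> tT; have [d _] := v_spec tT.
have [D1 D2] := maxwell_dom_graph d; rewrite /maxwell_gen /curl_source /=.
have [_] := Dspace_lin sep 1 (ext_D (lambda t)) D1; rewrite !scale1r => ->.
rewrite add0r; congr (_, _); first by rewrite /= add0r.
by have := coeff_inv_mu_lin Hm 1 (extd (ext (lambda t))) (extd (v t).1); rewrite !scale1r.
Qed.

Lemma solution_der t : t \in `[0, T] ->
  is_tderiv nX T solution t (maxwell_gen (solution t) + ((F t, G t) : X)).
Proof.
move=> tT; have [_ d] := v_spec tT.
have := tderD HX T_gt0 tT (trace_field_der tT) d.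
suff -> : trace_field (dLambda t) + (maxwell_gen (v t) + (shifted_source t + curl_source (lambda t))) =
    maxwell_gen (solution t) + ((F t, G t) : X) by [].
rewrite maxwell_gen_solution // shifted_sourceE //; move: (trace_field _) (curl_source _)
  (maxwell_gen _) ((F t, G t) : X) => a b c d'.
by rewrite addrCA [a + _]addrA [a + _]addrC subrK [RHS]addrC addrA [_ + b]addrC addrA addrC.
Qed.

Lemma solution0 : solution 0 = (E0, H0).
Proof.
by rewrite /solution v0 /trace_field; congr (_, _); rewrite /= ?add0r // addrC subrK.
Qed.

Lemma tau_solution t : t \in `[0, T] -> tau (solution t).1 = lambda t.
Proof.
move=> tT; have [d _] := v_spec tT.
have [D1 _] := maxwell_dom_graph d; have [D0 _] := d.
have := tau_lin 1 (ext_D (lambda t)) D1; rewrite !scale1r => ->.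
rewrite (ext_right_inverse ext_tau).
by rewrite ((trace_kernel tau_trace D1).2 D0) addr0.
Qed.

Lemma maxwell_gen_solution_cont : vcont ip T (fun t => maxwell_gen (solution t)).
Proof.
apply: (vcont_eq (u := fun t => curl_source (lambda t) + maxwell_gen (v t))).
  by move=> t tT; rewrite maxwell_gen_solution.
by apply: (vcontD HX); [exact: curl_source_cont|exact: v_cont].
Qed.

Lemma solution_cont : vcont ip T solution.
Proof. by apply: (vcont_tder HX T_gt0) => t tT; eexists; exact: solution_der. Qed.

Lemma fst_le : exists c, forall u : X, L2_norm u.1 <= c * nX u.
Proof. by have [k [K [_ _ h _ _]]] := Hspace_norm_equiv He Hm; exists k. Qed.

Lemma snd_le : exists c, forall u : X, L2_norm u.2 <= c * nX u.
Proof. by have [k [K [_ _ _ h _]]] := Hspace_norm_equiv He Hm; exists k. Qed.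

Lemma fst_cont (u : R -> X) : vcont ip T u -> vcont ipq T (fun t => (u t).1).
Proof. by have [c cP] := fst_le; exact: (bounded_image_vcont (c := c) (L := fst)). Qed.

Lemma snd_cont (u : R -> X) : vcont ip T u -> vcont ipq1 T (fun t => (u t).2).
Proof. by have [c cP] := snd_le; exact: (bounded_image_vcont (c := c) (L := snd)). Qed.

Lemma fst_der (u : R -> X) t u' : t \in `[0, T] -> is_tderiv nX T u t u' ->
  tderiv (@L2_norm R N Omega q) T (fun t => (u t).1) t = u'.1.
Proof.
move=> tT uv; have [c cP] := fst_le; apply: (tderivE Lq T_gt0 tT).
apply: (bounded_image_tder (nX := nX) (c := c) (L := fst)) uv => //.
by move=> y; exact: sqrtr_ge0.
Qed.

Lemma snd_der (u : R -> X) t u' : t \in `[0, T] -> is_tderiv nX T u t u' ->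
  tderiv (@L2_norm R N Omega q.+1) T (fun t => (u t).2) t = u'.2.
Proof.
move=> tT uv; have [c cP] := snd_le; apply: (tderivE Lq1 T_gt0 tT).
apply: (bounded_image_tder (nX := nX) (c := c) (L := snd)) uv => //.
by move=> y; exact: sqrtr_ge0.
Qed.

(** The derivatives of the fields are recovered from the generator, whose values along the
    solution are continuous, by multiplication with the coefficients. *)
Lemma solution_graph_cont : is_C0 (@graph_dom R N Omega q) (@graph_norm R N Omega q) T solution.
Proof.
move=> t tT; split; first exact: solution_dom.
have Ec := fst_cont solution_cont tT; have Hc := snd_cont solution_cont tT.
have cu : forall u : L2 Omega q, L2_norm (coeff_op eps u) <= Ce * L2_norm u by exact: coercive_bound He.
have cu1 : forall u : L2 Omega q.+1, L2_norm (coeff_op mu u) <= Cm * L2_norm u by exact: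
  coercive_bound Hm.
have dHc : vcont ipq T (fun s => codiff (solution s).2 : L2 Omega q).
  have := bounded_image_vcont (coercive_linear He) cu (fst_cont maxwell_gen_solution_cont).
  by apply: vcont_eq => s _; exact: coeff_invK_eps He _.
have dEc : vcont ipq1 T (fun s => extd (solution s).1).
  have := bounded_image_vcont (coercive_linear Hm) cu1 (snd_cont maxwell_gen_solution_cont).
  by apply: vcont_eq => s _; exact: coeff_invK_mu Hm _.
have {dHc}dHc := dHc t tT; have {dEc}dEc := dEc t tT.
pose bnd s := L2_norm ((solution s).1 - (solution t).1) +
  L2_norm (extd (solution s).1 - extd (solution t).1) +
  (L2_norm ((solution s).2 - (solution t).2) +
   L2_norm ((codiff (solution s).2 : L2 Omega q) - (codiff (solution t).2 : L2 Omega q))).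
have FF := within_itv_proper tT.
apply: (@squeeze_cvgr _ _ _ _ (cst 0) bnd).
- near=> s; rewrite /cst sqrtr_ge0 /=.
  have sT : s \in `[0, T].
    by near: s; rewrite near_withinE; apply: nearW.
  have [s1 s2] := solution_dom sT; have [t1 t2] := solution_dom tT.
  rewrite /bnd; move: (solution s) (solution t) s1 s2 t1 t2 => a b s1 s2 t1 t2.
  apply: le_trans (graph_norm_le _) _; rewrite /=.
  have [_ ->] := Dspace_sub s1 t1.
  have [_] := Deltaspace_lin sep (-1) t2 s2; rewrite !scaleN1r [_ + a.2]addrC => ->.
  by rewrite [- (codiff b.2 : L2 Omega q) + _]addrC.
- exact: cvg_cst.
have := cvgD (cvgD Ec dEc) (cvgD Hc dHc); rewrite !addr0; exact.
Unshelve. all: by end_near.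
Qed.

Lemma solution_solves : maxwell_solution eps mu tau T lambda E0 H0 F G solution.
Proof.
split.
- split=> [t tT|]; first by exists (maxwell_gen (solution t) + ((F t, G t) : X)); exact: solution_der.
  apply/is_C0P; apply: (vcont_eq (u := fun t => maxwell_gen (solution t) + ((F t, G t) : X))).
    by move=> t tT; apply/esym/(tderivE HX T_gt0 tT); exact: solution_der.
  by apply: (vcontD HX); [exact: maxwell_gen_solution_cont|exact: FG_cont].
- exact: solution_graph_cont.
- move=> t tT; have tT' := itv_oo_cc tT; have d := solution_der tT'; split.
  + by rewrite (fst_der tT' d) /= addrAC subrr add0r.
  + by rewrite (snd_der tT' d) /= addrAC subrr add0r.
  + exact: tau_solution.
- exact: solution0.
Qed.

(** The two scalar equations determine both components of the time derivative of any solution. *)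
Lemma maxwell_solution_der u t : maxwell_solution eps mu tau T lambda E0 H0 F G u ->
  t \in `]0, T[ -> is_tderiv nX T u t (maxwell_gen (u t) + ((F t, G t) : X)).
Proof.
move=> [[ud _] _ ueq _] tT; have tT' := itv_oo_cc tT.
have [u' uv] := ud t tT'; have [e1 e2 _] := ueq t tT.
suff -> : maxwell_gen (u t) + ((F t, G t) : X) = u' by [].
rewrite [u']surjective_pairing -(fst_der tT' uv) -(snd_der tT' uv) -e1 -e2.
by congr (_, _); rewrite /= addrC subrK.
Qed.

(** The difference of two solutions has zero trace, hence lies in the domain, and solves the
    homogeneous equation with zero initial value. *)
Lemma maxwell_solution_unique u : maxwell_solution eps mu tau T lambda E0 H0 F G u ->
  forall t, t \in `[0, T] -> u t = solution t.
Proof.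
move=> us t tT; apply/eqP; rewrite -subr_eq0; apply/eqP.
have [[ud _] ug ueq u0] := us.
apply: (evolution_unique HX HP domE AE T_gt0 (w := fun t => u t - solution t)) tT.
- apply: (vcontB HX); last exact: solution_cont.
  exact: (vcont_tder HX T_gt0).
- by rewrite u0 solution0 subrr.
move=> s sT; have sT' := itv_oo_cc sT; have [us' _] := ug s sT'; have ss := solution_dom sT'.
have [u1 u2] := us'; have [s1 s2] := ss; split.
  have -> : u s - solution s = ((u s).1 - (solution s).1, (u s).2 - (solution s).2) by [].
  apply: trace_dom_sub => //.
    by have [_ _ ->] := ueq s sT; rewrite tau_solution.
  have [] := Deltaspace_lin sep (-1) s2 u2.
  by rewrite scaleN1r [- _ + (u s).2]addrC.
rewrite maxwell_genE (maxwell_gen_sub He Hm sep us' ss).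
have dN : is_tderiv nX T (fun t => - solution t) s (- (maxwell_gen (solution s) + ((F s, G s) : X))).
  apply: (tder_lin T_gt0 (Y := fun x : X => - x) (c := 1)) (solution_der sT') => //.
    by move=> a x y; rewrite opprD scalerN.
  by move=> x y; rewrite -opprD (nrmN HX) mul1r.
have := tderD HX T_gt0 sT' (maxwell_solution_der us sT) dN.
suff -> : maxwell_gen (u s) + ((F s, G s) : X) - (maxwell_gen (solution s) + ((F s, G s) : X)) =
  maxwell_gen (u s) - maxwell_gen (solution s) by [].
move: (maxwell_gen (u s)) (maxwell_gen (solution s)) ((F s, G s) : X) => a b f.
by rewrite opprD addrACA subrr addr0.
Qed.

End Solution.
End MaxwellEvolution.

(** * The boundary value problem *)

Theorem theorem4p3 (R : realType) (N q : nat) (qN : (q <= N)%N)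
  (Omega : set 'rV[R]_N)
  (Omega_exterior : exterior_domain Omega)
  (Omega_lipschitz : lipschitz_boundary Omega)
  (eps mu : coefficient R N)
  (eps_admissible : admissible Omega q eps)
  (mu_admissible : admissible Omega q.+1 mu)
  (P : set R -> Hspace Omega q -> Hspace Omega q)
  (P_resolution : spectral_resolution (Hspace_ip eps mu) P
     (@maxwell_dom R N Omega q) (maxwell eps mu))
  (V : lmodType R[i]) (ipV : V -> V -> R[i]) (V_hilbert : hilbert_space ipV)
  (tau : L2 Omega q -> V) (tau_trace : tangential_trace ipV tau)
  (ext : {linear V -> L2 Omega q}) (ext_tau : trace_extension eps ipV tau ext)
  (T : R) (T_gt0 : 0 < T)
  (lambda : R -> V) (lambda_C1 : is_C1 (ip_norm ipV) T lambda)
  (E0 : L2 Omega q) (H0 : L2 Omega q.+1)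
  (F : R -> L2 Omega q) (G : R -> L2 Omega q.+1)
  (EH0_dom : Dspace E0 /\ Deltaspace H0)
  (FG_C0 : is_C0 setT (Hspace_norm eps mu) T
     (fun t => (F t, G t) : Hspace Omega q))
  (FG_L2 : is_L2 (@graph_dom R N Omega q) (@graph_norm R N Omega q) `]0, T[
     (fun t => (F t, G t) : Hspace Omega q))
  (lambda_Delta : forall t, t \in `[0, T] ->
     (coeff_op mu @` @Deltaspace R N Omega q.+1) (extd (ext (lambda t))))
  (F_lambda : {ae lebesgue_measure, forall t, t \in `]0, T[ ->
     tau (F t) = tderiv (ip_norm ipV) T lambda t})
  (E0_lambda : tau E0 = lambda 0) :
  let sol : R -> Hspace Omega q := fun t =>
    (ext (lambda t), 0)
    + exp_group (Hspace_ip eps mu) P t (E0 - ext (lambda 0), H0)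
    + bochner_integral (Hspace_norm eps mu) `]0, t[ (fun s =>
        exp_group (Hspace_ip eps mu) P (t - s)
          (F s - tderiv (@L2_norm R N Omega q) T (fun r => ext (lambda r)) s,
           G s + coeff_inv mu (extd (ext (lambda s))))) in
  maxwell_solution eps mu tau T lambda E0 H0 F G sol /\
  forall u : R -> Hspace Omega q,
    maxwell_solution eps mu tau T lambda E0 H0 F G u ->
    forall t, t \in `[0, T] -> u t = sol t.
Proof.
have mO : measurable (Omega : set (Rn R N)).
  by case: Omega_exterior => oO _; exact: open_measurable_Rn.
have [ce [Ce He]] := coeff_op_coercive mO eps_admissible.
have [cm [Cm Hm]] := coeff_op_coercive mO mu_admissible.
move=> sol.
have [_ HP _] : [/\ True, projection_measure (@Hspace_ip R N Omega q eps mu) P & True].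
  by case: P_resolution.
have HX := Hspace_hilbert He Hm.
pose v := @mild_part R N q Omega eps mu P V ext T lambda E0 H0 F G.
have [v_spec v_cont] := mild_part_spec He Hm P_resolution V_hilbert tau_trace ext_tau T_gt0
  lambda_C1 EH0_dom FG_C0 FG_L2 F_lambda E0_lambda.
have v0 : v 0 = (E0 - ext (lambda 0), H0).
  exact: (mild_part0 He Hm P_resolution ext_tau T_gt0 lambda_C1 FG_C0).
have -> : sol = @solution R N q Omega V ext lambda v.
  apply/funext => t.
  have e1 := exp_groupE HX HP t ((E0 - ext (lambda 0), H0) : Hspace Omega q).
  have e2 : bochner_integral (Hspace_norm eps mu) `]0, t[ (fun s =>
        exp_group (Hspace_ip eps mu) P (t - s)
          ((F s - tderiv (@L2_norm R N Omega q) T (fun r => ext (lambda r)) s,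
           G s + coeff_inv mu (extd (ext (lambda s)))) : Hspace Omega q)) =
      bochner_integral (Hspace_norm eps mu) `]0, t[ (fun s =>
        ugroup (Hspace_ip eps mu) P (t - s)
          (@shifted_source R N q Omega V ext T lambda F G s + @curl_source R N q Omega mu V ext
            (lambda s))).
    congr bochner_integral; apply/funext => s; rewrite (exp_groupE HX HP).
    by congr ugroup; congr (_, _); rewrite /= addr0.
  exact: (etrans (esym (addrA _ _ _)) (congr2 +%R erefl (congr2 +%R e1 e2))).
split.
  exact: (solution_solves He Hm P_resolution tau_trace ext_tau T_gt0 lambda_C1 FG_C0 v_spec v_cont v0).
exact: (maxwell_solution_unique He Hm P_resolution tau_trace ext_tau T_gt0 lambda_C1 v_spec v0).
Qed.
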